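(* Consider an arbitrary (multichain) average-reward MDP $(\mathcal{S},\mathcal{A},P,r)$ with finite $\mathcal{S},\mathcal{A}$, accessed through a generative model. Let $\epsilon>0$, $\delta>0$, $\alpha\in(0,1/|\mathcal{A}|)$, $\mu\in\mathcal{M}_+(\mathcal{S})$, $\pi_0\in\Pi_\alpha$, and $\pi_\alpha\in\arg\max_{\pi\in\Pi_\alpha}J^\pi_\mu$. (1) Constant step size. With constant step size $\eta_k=\eta>0$ and $$K=\frac{2}{\epsilon}\left(\frac{D_{\rho_\mu^{\pi_\alpha}}(\pi_\alpha,\pi_0)}{\eta}+C_\alpha\big(J_\mu^{\pi_\alpha}-J_\mu^{\pi_0}\big)\right),$$ for a suitable choice of the critic parameters, with probability $1-\delta$ the stochastic $\alpha$-clipped policy mirror ascent satisfies $J_\mu^{\pi_\alpha}-J_\mu^{\pi_K}\le\epsilon$ with sample complexity $$\widetilde{\mathcal{O}}\left(\frac{t_{\mathrm{tar}}^3\,\|Q^\pi\|_\infty^4\,R^9\,C_\alpha^6\left(\frac{D_{\rho_\mu^{\pi_\alpha}}(\pi_\alpha,\pi_0)}{\eta}\right)^6B_\alpha^6\,|\mathcal{S}||\mathcal{A}|}{\epsilon^{12}}\right).$$ (2) Adaptive step size. With step sizes satisfying $\eta_{k+1}(C_\alpha-1)\ge\eta_kC_\alpha>0$ and $$K=\frac{\log\left(\frac{2}{\epsilon}\Big(J_\mu^{\pi_\alpha}-J_\mu^{\pi_0}+\frac{D_{\rho_\mu^{\pi_\alpha}}(\pi_\alpha,\pi_0)}{\eta_0(C_\alpha-1)}\Big)\right)}{\log\big(C_\alpha/(C_\alpha-1)\big)},$$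 for a suitable choice of the critic parameters, with probability $1-\delta$ the stochastic $\alpha$-clipped policy mirror ascent satisfies $J_\mu^{\pi_\alpha}-J_\mu^{\pi_K}\le\epsilon$ with sample complexity $$\widetilde{\mathcal{O}}\left(\frac{t_{\mathrm{tar}}^3\,\|Q^\pi\|_\infty^4\,R^3\,C_\alpha^6\,B_\alpha^6\,|\mathcal{S}||\mathcal{A}|}{\epsilon^6}\right).$$ Here $\widetilde{\mathcal{O}}$ ignores all logarithmic factors, $\|Q^\pi\|_\infty=\max_{0\le k\le K-1}\|Q^{\pi_k}\|_\infty$ and $t_{\mathrm{tar}}=\max_{0\le k\le K-1}t_{\mathrm{tar}}^{\pi_k}$.
   Context: MDP. $(\mathcal{S},\mathcal{A},P,r)$ has finite state space $\mathcal{S}$, finite action space $\mathcal{A}$, transition kernel $P:\mathcal{S}\times\mathcal{A}\to\mathcal{M}(\mathcal{S})$ and reward $r:\mathcal{S}\times\mathcal{A}\to[-R,R]$; $\mathcal{M}(X)$ is the set of probability distributions on $X$ and $\mathcal{M}_+(X)$ those with full support. ''Multichain'' means general: no structural assumption. A generative model provides independent samples of the next state from $P(\cdot\mid s,a)$ for any given $(s,a)$. A policy is $\pi:\mathcal{S}\to\mathcal{M}(\mathcal{A})$; $\Pi$ is the set of all policies, $\Pi_+=\{\pi\in\Pi:\pi(a\mid s)>0\ \forall s,a\}$, $\Pi_\alpha=\{\pi\in\Pi:\pi(a\mid s)\ge\alpha\ \forall s,a\}$, $\mathcal{M}_\alpha(\mathcal{A})=\{p\in\mathcal{M}(\mathcal{A}):p(a)\ge\alpha\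 \forall a\}$. For a policy $\pi$: $r^\pi(s)=\sum_a\pi(a\mid s)r(s,a)$, $P^\pi(s,s')=\sum_a\pi(a\mid s)P(s'\mid s,a)$, $P^\pi_\star=\lim_{H\to\infty}\frac1H\sum_{i=0}^{H-1}(P^\pi)^i$ (exists), $(Pf)(s,a)=\sum_{s'}P(s'\mid s,a)f(s')$. Values. Average reward $J^\pi(s)=\liminf_{H\to\infty}\frac1H\mathbb{E}_\pi[\sum_{h=0}^{H-1}r(s_h,a_h)\mid s_0=s]$, i.e. $J^\pi=P^\pi_\star r^\pi$; $J^\pi_\mu=\sum_s\mu(s)J^\pi(s)$; $V^\pi=(I-P^\pi+P^\pi_\star)^{-1}(I-P^\pi_\star)r^\pi$, $K^\pi=PJ^\pi$, $Q^\pi=r+PV^\pi-K^\pi$. State classification. A state is recurrent under $\pi$ if the chain $P^\pi$ started there returns with probability $1$, transient otherwise. The decomposition of $\mathcal{S}$ into transient states $\mathcal{T}$ and recurrent classes $\mathcal{R}_1,\dots,\mathcal{R}_m$ is the same for all $\pi\in\Pi_+$; $\mathcal{T}$ and $\mathcal{R}=\bigcup_i\mathcal{R}_i$ denote these fixed sets. Visitation measures. For $\pi\in\Pi_+$: $d^\pi_\mu(s)=\sum_{s_0}\mu(s_0)P^\pi_\star(s_0,s)$; $\bar T^\pi(s_1,s_2)=P^\pi(s_1,s_2)$ if $s_1,s_2\in\mathcal{T}$, else $0$; $\delta^\pi_\mu(s)=\sum_{s_0}\mu(s_0)\big((I-\bar T^\pi)^{-1}\big)(s_0,s)$; $\rho^\pi_\mu(s)=d^\pi_\mu(s)\mathbf{1}_{\mathcal{R}}(s)+\delta^\pi_\mu(s)\mathbf{1}_{\mathcal{T}}(s)$.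 Set $B_\alpha=\max_{\pi\in\Pi_\alpha}\|\rho^\pi_\mu\|_1$ and $C_\alpha=\max_{s\in\mathcal{S},\,\pi,\pi'\in\Pi_\alpha}\rho^\pi_\mu(s)/\rho^{\pi'}_\mu(s)$; both are finite. The maximizer $\pi_\alpha$ exists. Expected target time. For $\pi\in\Pi_+$ and class $\mathcal{R}_i$ with stationary distribution $g_i^\pi$ of $P^\pi$ restricted to $\mathcal{R}_i$, $t^{\pi,i}_{\mathrm{tar}}=\sum_{s'\in\mathcal{R}_i}g_i^\pi(s')\,\mathbb{E}_\pi[t_{s'}\mid s_0=s]$, where $s\in\mathcal{R}_i$ (the value does not depend on $s$) and $t_{s'}=\inf\{t\ge0:s_t=s'\}$; $t^\pi_{\mathrm{tar}}=\max_{1\le i\le m}t^{\pi,i}_{\mathrm{tar}}$. Bregman divergence. $h:\mathcal{M}(\mathcal{A})\to\mathbb{R}$ is strictly convex and continuously differentiable on the relative interior of $\mathcal{M}(\mathcal{A})$; $D(p,p')=h(p)-h(p')-\langle\nabla h(p'),p-p'\rangle$ for $p\in\mathcal{M}(\mathcal{A})$ and $p'$ in the relative interior. For $\rho\in\mathbb{R}_+^{|\mathcal{S}|}$, $D_\rho(\pi,\pi')=\sum_s\rho(s)D(\pi(\cdot\mid s),\pi'(\cdot\mid s))$. Critic$(\pi,N,H,N',H')$. For each $j=1,\dots,N$ and each $(s_0,a_0)\in\mathcal{S}\times\mathcal{A}$, independently generate $(s_0,a_0),\dots,(s_H,a_H)$ with $s_i\sim P(\cdot\mid s_{i-1},a_{i-1})$,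 $a_i\sim\pi(\cdot\mid s_i)$, and set $K^j(s_0,a_0)=\frac{1}{H+1}\sum_{i=0}^Hr(s_i,a_i)$; $\hat K^\pi=\frac1N\sum_{j=1}^NK^j$. Then for each $j=1,\dots,N'$ and each $(s_0,a_0)$, independently generate $(s_0,a_0),\dots,(s_{H'},a_{H'})$ in the same way and set $\hat Q^j(s_0,a_0)=\frac{1}{H'+1}\sum_{h=0}^{H'}\sum_{i=0}^h\big(r(s_i,a_i)-\hat K^\pi(s_i,a_i)\big)$; $\hat Q^\pi=\frac{1}{N'}\sum_{j=1}^{N'}\hat Q^j$. Output $\hat G^\pi(s,\cdot)=\hat Q^\pi(s,\cdot)\mathbf{1}_{\mathcal{R}}(s)+\hat K^\pi(s,\cdot)\mathbf{1}_{\mathcal{T}}(s)$. Stochastic $\alpha$-clipped policy mirror ascent. Starting from $\pi_0\in\Pi_\alpha$, with step sizes $\eta_k>0$ and critic parameters $N_k,H_k,N_k',H_k'$, for $k=0,\dots,K-1$ compute $\hat G^{\pi_k}=\mathrm{Critic}(\pi_k,N_k,H_k,N'_k,H'_k)$ and, for every $s$, $$\pi_{k+1}(\cdot\mid s)=\arg\max_{p\in\mathcal{M}_\alpha(\mathcal{A})}\Big\{\eta_k\sum_a\hat G^{\pi_k}(s,a)p(a)-D\big(p,\pi_k(\cdot\mid s)\big)\Big\};$$ output $\pi_K$. The sample complexity is the total number of samples used, $\sum_{k=0}^{K-1}(N_kH_k+N'_kH'_k)|\mathcal{S}||\mathcal{A}|$. Non-integer values of $K$ are understood as rounded up to an inte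ger.
   Formalization: In the soft-O bounds, t_tar, ‖Q‖, R, 1/ε and (in part 1) D/η are read as max(1,·), since the literal bound fails e.g. when t_tar = 0; the critic parameters at step k may depend on the current policy π_k. *)

(* Defs.v *)
From HB Require Import structures.
From mathcomp Require Import all_boot all_order all_algebra.
From mathcomp Require Import all_classical all_reals all_analysis.

Set Implicit Arguments.
Unset Strict Implicit.
Unset Printing Implicit Defensive.
Import Order.TTheory GRing.Theory Num.Theory.
Import numFieldNormedType.Exports.

Local Open Scope classical_set_scope.
Local Open Scope ring_scope.

(* The states are 'I_nS and the actions 'I_nA.  A policy is the nS x nA matrix
   pi with pi s a = pi(a | s); functions on state-action pairs (r, K, Q) are
   nS x nA matrices, functions on states (J, V) are columns, and (possibly
   unnormalised) measures on a finite set are rows. *)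

(** * Distributions *)

Definition simplex {R : realType} n : set 'rV[R]_n :=
  [set p | (forall i, 0 <= p 0 i) /\ \sum_i p 0 i = 1].

(* The full-support distributions; this is also the relative interior of
   the simplex. *)
Definition simplex_pos {R : realType} n : set 'rV[R]_n :=
  [set p | simplex p /\ forall i, 0 < p 0 i].

Definition simplex_clip {R : realType} n (alpha : R) : set 'rV[R]_n :=
  [set p | simplex p /\ forall i, alpha <= p 0 i].

(** * Finite Markov chains, given by their transition matrix *)

Section MarkovChain.
Context {R : realType} {n : nat}.
Implicit Types (P : 'M[R]_n) (s : 'I_n) (C : pred 'I_n).

Definition cesaro_limit P : 'M[R]_n :=
  \matrix_(s, s') limn (fun H : nat => H%:R^-1 * \sum_(i < H) (P ^+ i) s s').

(* Probability that t_z = k when s_0 = s, where t_z = inf {t >= 0 : s_t = z}. *)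
Fixpoint first_hit P (z : 'I_n) (k : nat) (s : 'I_n) : R :=
  match k with
  | 0%N => (s == z)%:R
  | k'.+1 => if s == z then 0 else \sum_s' P s s' * first_hit P z k' s'
  end.

Definition hit_prob P z s : R := limn (series (fun k => first_hit P z k s)).

(* E[t_z | s_0 = s]; only used when z is hit almost surely from s. *)
Definition expected_hit P z s : R :=
  limn (series (fun k : nat => k%:R * first_hit P z k s)).

(* The chain started at s returns to s at some time t >= 1 with probability 1. *)
Definition recurrent P s : Prop := \sum_s' P s s' * hit_prob P s s' = 1.

Definition accessible P s s' : Prop := exists k : nat, 0 < (P ^+ k) s s'.

(* For recurrent s, the recurrent class of s. *)
Definition comm_class P s : pred 'I_n :=
  fun s' => `[< accessible P s s' /\ accessible P s' s >].

Definition stationary_on P C : 'rV[R]_n :=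
  xget 0 [set g | [/\ simplex g, forall s, ~~ C s -> g 0 s = 0 & g *m P = g]].

End MarkovChain.

(** * Average-reward Markov decision processes *)

Record mdp (R : realType) (nS nA : nat) := MDP {
  trans : 'I_nS -> 'I_nA -> 'rV[R]_nS;
  reward : 'M[R]_(nS, nA);
  reward_bound : R;
  trans_simplex : forall s a, simplex (trans s a);
  reward_in : forall s a, - reward_bound <= reward s a <= reward_bound
}.

Section Policies.
Context {R : realType} {nS nA : nat}.

Definition policies : set 'M[R]_(nS, nA) :=
  [set pi | forall s, simplex (row s pi)].
Definition policies_pos : set 'M[R]_(nS, nA) :=
  [set pi | forall s, simplex_pos (row s pi)].
Definition policies_clip (alpha : R) : set 'M[R]_(nS, nA) :=
  [set pi | forall s, simplex_clip alpha (row s pi)].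

End Policies.

Section Values.
Context {R : realType} {nS nA : nat} (M : mdp R nS nA).
Implicit Types (pi : 'M[R]_(nS, nA)) (s : 'I_nS) (a : 'I_nA)
  (mu : 'rV[R]_nS) (x : 'I_nS * 'I_nA) (w : seq ('I_nS * 'I_nA)).

Definition rew_of pi : 'cV[R]_nS := \col_s \sum_a pi s a * reward M s a.

Definition chain_of pi : 'M[R]_nS :=
  \matrix_(s, s') \sum_a pi s a * trans M s a 0 s'.

Definition chain_lim pi : 'M[R]_nS := cesaro_limit (chain_of pi).

Definition apply_trans (f : 'cV[R]_nS) : 'M[R]_(nS, nA) :=
  \matrix_(s, a) \sum_s' trans M s a 0 s' * f s' 0.

(* Probability that, from (s_0, a_0) = x, the next state-action pairs are the
   entries of w, with s_i ~ P(. | s_(i-1), a_(i-1)) and a_i ~ pi(. | s_i). *)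
Fixpoint path_prob pi x w : R :=
  match w with
  | [::] => 1
  | y :: w' => trans M x.1 x.2 0 y.1 * pi y.1 y.2 * path_prob pi y w'
  end.

(* Probability that, from s_0 = s, the first state-action pairs are the
   entries of w. *)
Definition start_prob pi s w : R :=
  match w with
  | [::] => 1
  | y :: w' => (y.1 == s)%:R * pi y.1 y.2 * path_prob pi y w'
  end.

Definition total_reward w : R := \sum_(y <- w) reward M y.1 y.2.

Definition expected_return pi (H : nat) s : R :=
  \sum_(w : H.-tuple ('I_nS * 'I_nA)) start_prob pi s w * total_reward w.

Definition avg_reward pi : 'cV[R]_nS :=
  \col_s limn_inf (fun H : nat => H%:R^-1 * expected_return pi H s).

Definition avg_reward_mu mu pi : R := \sum_s mu 0 s * avg_reward pi s 0.

Definition bias pi : 'cV[R]_nS :=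
  invmx (1%:M - chain_of pi + chain_lim pi)
    *m ((1%:M - chain_lim pi) *m rew_of pi).

Definition K_of pi : 'M[R]_(nS, nA) := apply_trans (avg_reward pi).

Definition Q_of pi : 'M[R]_(nS, nA) :=
  reward M + apply_trans (bias pi) - K_of pi.

(* Membership in the set R of recurrent states, which is the same for all
   policies of full support; its complement is the set T. *)
Definition rec_state s : bool :=
  `[< forall pi, policies_pos pi -> recurrent (chain_of pi) s >].

Definition recurrent_visit mu pi : 'rV[R]_nS := mu *m chain_lim pi.

Definition trans_block pi : 'M[R]_nS :=
  \matrix_(s, s') (if ~~ rec_state s && ~~ rec_state s'
                   then chain_of pi s s' else 0).

Definition transient_visit mu pi : 'rV[R]_nS :=
  mu *m invmx (1%:M - trans_block pi).

Definition visit mu pi : 'rV[R]_nS :=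
  \row_s (if rec_state s then recurrent_visit mu pi 0 s
          else transient_visit mu pi 0 s).

Definition B_alpha mu (alpha : R) : R :=
  sup [set \sum_s `|visit mu pi 0 s| | pi in policies_clip alpha].

Definition C_alpha mu (alpha : R) : R :=
  sup [set c | exists s pi pi', [/\ policies_clip alpha pi,
    policies_clip alpha pi' & c = visit mu pi 0 s / visit mu pi' 0 s]].

(* Target time of the recurrent class of s under a full-support policy. *)
Definition class_target_time pi s : R :=
  let P := chain_of pi in let C := comm_class P s in
  \sum_(s' | C s') stationary_on P C 0 s' * expected_hit P s' s.

(* Ranging over the recurrent states amounts to ranging over the classes, as
   class_target_time is constant on each class. *)
Definition target_time pi : R :=
  \big[Num.max/0]_(s | rec_state s) class_target_time pi s.

End Values.

(** * Bregman divergence *)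

Definition dotv {R : realType} n (u v : 'rV[R]_n) : R :=
  \sum_i u 0 i * v 0 i.

(* Only the values of [pot] on the simplex matter.  Differentiability is relative
   to the affine hull of the simplex: [grad p] represents the derivative at p
   on increments q - p with q in the simplex, and is therefore only determined
   up to a multiple of the all-ones vector, which does not affect [breg]. *)
Record mirror_map (R : realType) (nA : nat) := MirrorMap {
  pot : 'rV[R]_nA -> R;
  grad : 'rV[R]_nA -> 'rV[R]_nA;
  pot_strictly_convex : forall (p q : 'rV[R]_nA) (t : R),
    simplex_pos p -> simplex_pos q -> p != q -> 0 < t < 1 ->
    pot (t *: p + (1 - t) *: q) < t * pot p + (1 - t) * pot q;
  pot_differentiable : forall p : 'rV[R]_nA, simplex_pos p ->
    forall e : R, 0 < e -> \forall q \near p, simplex q ->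
      `|pot q - pot p - dotv (grad p) (q - p)| <= e * `|q - p|;
  grad_continuous : {within @simplex_pos R nA, continuous grad}
}.

Section Bregman.
Context {R : realType} {nS nA : nat} (h : mirror_map R nA).

Definition breg (p p' : 'rV[R]_nA) : R :=
  pot h p - pot h p' - dotv (grad h p') (p - p').

Definition breg_w (rho : 'rV[R]_nS) (pi pi' : 'M[R]_(nS, nA)) : R :=
  \sum_s rho 0 s * breg (row s pi) (row s pi').

End Bregman.

(** * Critic *)

Record critic_params := CriticParams {
  par_N : nat; par_H : nat; par_N' : nat; par_H' : nat
}.

(* The parameters used at iteration k may depend on the current policy pi_k. *)
Definition critic_schedule (R : realType) (nS nA : nat) :=
  nat -> 'M[R]_(nS, nA) -> critic_params.

Definition positive_schedule {R : realType} {nS nA : nat}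
    (cp : critic_schedule R nS nA) : Prop :=
  forall k pi, [/\ (0 < par_N (cp k pi))%N, (0 < par_H (cp k pi))%N,
                   (0 < par_N' (cp k pi))%N & (0 < par_H' (cp k pi))%N].

(* One trajectory (s_1, a_1), ..., (s_H, a_H) for each j < N and each initial
   pair (s_0, a_0). *)
Definition batch (nS nA N H : nat) : finType :=
  {ffun 'I_N * ('I_nS * 'I_nA) -> H.-tuple ('I_nS * 'I_nA)}.

Section Critic.
Context {R : realType} {nS nA : nat} (M : mdp R nS nA).
Implicit Types (pi : 'M[R]_(nS, nA)).

Definition batch_prob pi N H (w : batch nS nA N H) : R :=
  \prod_(jx : 'I_N * ('I_nS * 'I_nA)) path_prob M pi jx.2 (w jx).

Definition K_hat N H (w : batch nS nA N H) : 'M[R]_(nS, nA) :=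
  \matrix_(s, a) (N%:R^-1 * \sum_(j < N)
    (H.+1%:R^-1 * total_reward M ((s, a) :: w (j, (s, a))))).

Definition Q_hat (Kh : 'M[R]_(nS, nA)) N' H' (w : batch nS nA N' H') :
    'M[R]_(nS, nA) :=
  \matrix_(s, a) (N'%:R^-1 * \sum_(j < N')
    (H'.+1%:R^-1 * \sum_(h < H'.+1)
      \sum_(y <- take h.+1 ((s, a) :: w (j, (s, a))))
        (reward M y.1 y.2 - Kh y.1 y.2))).

Definition G_hat N H N' H'
    (w : batch nS nA N H) (w' : batch nS nA N' H') : 'M[R]_(nS, nA) :=
  \matrix_(s, a) (if rec_state M s then Q_hat (K_hat w) w' s a
                  else K_hat w s a).

End Critic.

(** * Stochastic clipped policy mirror ascent *)

Section MirrorAscent.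
Context {R : realType} {nS nA : nat} (M : mdp R nS nA) (h : mirror_map R nA).
Context (alpha : R) (eta : nat -> R) (cp : critic_schedule R nS nA).
Implicit Types (pi : 'M[R]_(nS, nA)).

(* The argmax over the clipped simplex; it exists and is unique when p is in the
   clipped simplex and 0 < alpha < 1 / nA. *)
Definition mirror_argmax (step : R) (g p : 'rV[R]_nA) : 'rV[R]_nA :=
  let obj q := step * dotv g q - breg h q p in
  xget p [set q | simplex_clip alpha q /\
                  forall q', simplex_clip alpha q' -> obj q' <= obj q].

Definition mirror_step (step : R) (G pi : 'M[R]_(nS, nA)) : 'M[R]_(nS, nA) :=
  \matrix_(s, a) mirror_argmax step (row s G) (row s pi) 0 a.

(* [run_prob k n pi E] is the probability that, started from pi_k = pi, the
   next n iterations produce a sequence [:: pi_k; ...; pi_(k+n)] satisfying E.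
   Each iteration sums over the finitely many outcomes of the critic. *)
Fixpoint run_prob (k n : nat) pi (E : seq 'M[R]_(nS, nA) -> Prop) : R :=
  match n with
  | 0%N => `[< E [:: pi] >]%:R
  | n'.+1 =>
    let c := cp k pi in
    \sum_(w : batch nS nA (par_N c) (par_H c))
      \sum_(w' : batch nS nA (par_N' c) (par_H' c))
        batch_prob M pi w * batch_prob M pi w' *
        run_prob k.+1 n' (mirror_step (eta k) (G_hat M w w') pi)
          (fun tr => E (pi :: tr))
  end.

(* With tr = [:: pi_0; ...; pi_K]. *)
Definition sample_complexity (K : nat) (tr : seq 'M[R]_(nS, nA)) : nat :=
  (\sum_(k < K) let c := cp k (nth 0%R tr k) in
    (par_N c * par_H c + par_N' c * par_H' c) * (nS * nA))%N.

Definition max_Q_norm (K : nat) (tr : seq 'M[R]_(nS, nA)) : R :=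
  \big[Num.max/0]_(k < K) `|Q_of M (nth 0 tr k)|.

Definition max_target_time (K : nat) (tr : seq 'M[R]_(nS, nA)) : R :=
  \big[Num.max/0]_(k < K) target_time M (nth 0 tr k).

End MirrorAscent.

(** * Rounding and soft-O *)

Definition nat_ceil {R : realType} (x : R) : nat := `|Num.max (0 : int)%R (Num.ceil x)|%N.

Definition max1 {R : realType} (x : R) : R := Num.max 1 x.

(* Soft-O with constant c and a logarithmic factor of degree d in the
   quantities listed in [params].  As usual for asymptotic notation in several
   parameters, quantities below 1 count as 1, both in [main] (to be written
   with max1, except for C_alpha, B_alpha, nS and nA, which are at least 1)
   and under the logarithm. *)
Definition soft_O {R : realType} (c : R) (d : nat) (params : seq R) (main : R)
    : R :=
  c * main * (1 + ln (\prod_(x <- params) max1 x)) ^+ d.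

(* Main.v *)
Require Import Defs.
From HB Require Import structures.
From mathcomp Require Import all_boot all_order all_algebra.
From mathcomp Require Import all_classical all_reals all_analysis.
From mathcomp Require Import ring lra.
Set Implicit Arguments.
Unset Strict Implicit.
Unset Printing Implicit Defensive.
Import Order.TTheory GRing.Theory Num.Theory.
Import numFieldNormedType.Exports.
Local Open Scope classical_set_scope.
Local Open Scope ring_scope.

(** The critic is only ever seen through a mirror step, and a mirror step does not
    change when a function of the state is added to the gradient estimate.  So an
    iteration is good as soon as its estimate is within 1/Y of the function equal to Q
    on recurrent states and to K on transient ones, up to such an offset
    ([accurate_up_to_offset]), and everything rests on two questions: how fast a run of
    good iterations converges, and how many samples make an iteration good.

    Convergence.  The difference of the values of two policies is a sum, weighted by the
    visitation measure of the first one, of advantages with respect to the second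
    ([performance_difference]); the proof uses Poisson's equation on the recurrent
    states, and on the transient ones the absorption of the chain, together with the
    constancy of the average reward on recurrent classes.  The three point inequality
    of mirror steps ([three_point]) shows that a good step is almost an improvement in
    every state ([step_improves]).  Changing the visitation measure of the optimal
    policy into that of the current one costs a factor C, and this gives
    [step_gap_recursion], in which the gap at step k is at most
    (D_k - D_(k+1)) / eta_k + C (gap_k - gap_(k+1)) + 4 B C / Y,
    with D_k the divergence to the optimal policy.  For a constant step size the sum of
    these inequalities telescopes ([constant_step_recursion]); for step sizes growing
    at least like (C / (C - 1))^k, the potential gap + D / (eta (C - 1)) contracts by
    1 - 1/C at each step ([adaptive_step_recursion]).  That B and C are finite suprema, over an
    infinite set of policies, comes from the fact that the transition matrix of a
    clipped policy is at least alpha times the one of any other policy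
    ([visit_lb], [sum_visit_ub]).

    Samples.  By Poisson's equation, the bias of a truncated trajectory of length H is
    of order |Q| / H for the estimate of K ([K_mean_bias]).  In the estimate of Q, an
    error on K adds up along the trajectory.  On a recurrent class this sum is a term
    that depends on the class only, hence an offset, plus a solution of Poisson's
    equation; such a solution is built from expected hitting times, and is at most the
    target time t times the error ([class_poisson], [Q_mean_bias]).  Therefore K only
    has to be known up to 1 / (t Y), trajectories of length t |Q| Y are enough for Q,
    and with Hoeffding's inequality ([batch_concentration]) an iteration
    costs about R^2 t^3 |Q|^3 Y^5 samples per state-action pair, up to a logarithm
    ([critic_choice_cost]).

    Finally Y is chosen as a multiple of B C / eps for adaptive step sizes, and of
    B (C + K) / eps for constant ones, where the last iterate is compared with the
    average one and the K small losses add up.  Multiplying by the number K of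
    iterations yields the two complexities, in fact with smaller exponents for |Q|, R, B
    and 1/eps. *)

(** * Nonnegative matrices, Cesaro limits and Poisson equations *)

Section NonnegativeMatrices.
Context {R : realType} {n : nat}.
Implicit Types (A B P : 'M[R]_n) (s : 'I_n).

Definition nonneg_mx m k (A : 'M[R]_(m, k)) := forall i j, 0 <= A i j.
Definition substoch A := nonneg_mx A /\ forall i, \sum_j A i j <= 1.
Definition stoch A := nonneg_mx A /\ forall i, \sum_j A i j = 1.

Lemma expSm A k : A ^+ k.+1 = A *m A ^+ k.
Proof. by rewrite exprS mulmxE. Qed.

Lemma expmS A k : A ^+ k.+1 = A ^+ k *m A.
Proof. by rewrite exprSr mulmxE. Qed.

Lemma nonneg_mulmx m k l (A : 'M[R]_(m, k)) (B : 'M[R]_(k, l)) :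
  nonneg_mx A -> nonneg_mx B -> nonneg_mx (A *m B).
Proof. by move=> hA hB i j; rewrite mxE; apply: sumr_ge0 => x _; exact: mulr_ge0. Qed.

Lemma nonneg_exp A k : nonneg_mx A -> nonneg_mx (A ^+ k).
Proof.
move=> hA; elim: k => [|k IH]; last by rewrite expSm; apply: nonneg_mulmx.
by move=> i j; rewrite expr0 mxE; case: (_ == _).
Qed.

Lemma stoch_mulmx A B : stoch A -> stoch B -> stoch (A *m B).
Proof.
move=> [hA sA] [hB sB]; split; first exact: nonneg_mulmx.
move=> i; under eq_bigr do rewrite mxE.
rewrite exchange_big /=; under eq_bigr do rewrite -mulr_sumr sB mulr1.
exact: sA.
Qed.

Lemma stoch1 : stoch (1 : 'M[R]_n).
Proof.
split=> [i j|i]; first by rewrite mxE; case: (_ == _).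
rewrite (bigD1 i) //= mxE eqxx big1 ?addr0 // => j /negPf ji.
by rewrite mxE eq_sym ji.
Qed.

Lemma stoch_exp A k : stoch A -> stoch (A ^+ k).
Proof.
move=> hA; elim: k => [|k IH]; last by rewrite expSm; apply: stoch_mulmx.
exact: stoch1.
Qed.

Lemma stoch_le1 A i j : stoch A -> A i j <= 1.
Proof.
move=> [hA sA]; rewrite -(sA i) (bigD1 j) //= lerDl.
by apply: sumr_ge0 => k _; exact: hA.
Qed.

Lemma subMxE m k (A B : 'M[R]_(m, k)) i j : (A - B) i j = A i j - B i j.
Proof. by rewrite !mxE. Qed.

Lemma cvgR_unique (f : nat -> R) (l l' : R) :
  f k @[k --> \oo] --> l -> f k @[k --> \oo] --> l' -> l = l'.
Proof. by move=> h h'; apply: (cvg_unique _ h h'). Qed.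

Definition mx_cvg m k (A : nat -> 'M[R]_(m, k)) (L : 'M[R]_(m, k)) :=
  forall i j, A H i j @[H --> \oo] --> L i j.

Lemma cvg_sum_fin (I : finType) (p : pred I) (f : I -> nat -> R) (l : I -> R) :
  (forall i, p i -> f i H @[H --> \oo] --> l i) ->
  (\sum_(i | p i) f i H) @[H --> \oo] --> \sum_(i | p i) l i.
Proof. by move=> h; apply: cvg_big => //; exact: add_continuous. Qed.

Lemma mx_cvg_mull m k l (B : 'M[R]_(m, k)) (A : nat -> 'M[R]_(k, l)) L :
  mx_cvg A L -> mx_cvg (fun H => B *m A H) (B *m L).
Proof.
move=> hA i j; rewrite mxE; under eq_fun do rewrite mxE.
by apply: cvg_sum_fin => x _; apply: cvgMl_tmp.
Qed.

Lemma mx_cvg_mulr m k l (B : 'M[R]_(k, l)) (A : nat -> 'M[R]_(m, k)) L :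
  mx_cvg A L -> mx_cvg (fun H => A H *m B) (L *m B).
Proof.
move=> hA i j; rewrite mxE; under eq_fun do rewrite mxE.
by apply: cvg_sum_fin => x _; apply: cvgMr_tmp.
Qed.

Lemma mx_cvg_unique m k (A : nat -> 'M[R]_(m, k)) L L' :
  mx_cvg A L -> mx_cvg A L' -> L = L'.
Proof.
move=> h h'; apply/matrixP => i j.
by apply: (cvg_unique _ (h i j) (h' i j)).
Qed.

Lemma mx_cvg_ext m k (A B : nat -> 'M[R]_(m, k)) L :
  (forall H, A H.+1 = B H.+1) -> mx_cvg B L -> mx_cvg A L.
Proof.
move=> AB h i j; have := h i j; rewrite -(cvg_shiftn 1) => h'.
rewrite -(cvg_shiftn 1); apply: cvg_trans h'.
by apply: near_eq_cvg; apply: nearW => H /=; rewrite addn1 AB.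
Qed.

Lemma mx_cvg_cst m k (L : 'M[R]_(m, k)) : mx_cvg (fun=> L) L.
Proof. by move=> i j; exact: cvg_cst. Qed.

(** Row sums of A^k: for a substochastic A, the probability of surviving k steps,
    the missing mass of each row being an exit. *)
Definition mass A k : 'cV[R]_n := A ^+ k *m const_mx 1.

Lemma massE A k s : mass A k s 0 = \sum_j (A ^+ k) s j.
Proof. by rewrite mxE; apply: eq_bigr => j _; rewrite mxE mulr1. Qed.

Lemma mass0 A s : mass A 0 s 0 = 1.
Proof. by rewrite /mass expr0 mul1mx mxE. Qed.

Lemma massS A k : mass A k.+1 = A *m mass A k.
Proof. by rewrite /mass expSm mulmxA. Qed.

Lemma massD A k l : mass A (k + l) = A ^+ k *m mass A l.
Proof. by rewrite /mass exprD mulmxA mulmxE. Qed.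

Lemma mass_ge0 A k s : nonneg_mx A -> 0 <= mass A k s 0.
Proof.
move=> hA; apply: nonneg_mulmx; first exact: nonneg_exp.
by move=> i j; rewrite mxE ler01.
Qed.

Lemma mass_decr A s : substoch A ->
  {homo (fun k => mass A k s 0) : m k / (m <= k)%N >-> k <= m}.
Proof.
move=> [hA sA]; apply/nonincreasing_seqP => k.
elim: k s => [|k IH] s.
  by rewrite massE mass0 expr1.
rewrite !massS !mxE; apply: ler_sum => j _.
by rewrite -massS; apply: ler_wpM2l; [exact: hA|rewrite massS -massS IH].
Qed.

Lemma mass_le1 A k s : substoch A -> mass A k s 0 <= 1.
Proof. by move=> hA; rewrite -(mass0 A s); exact: mass_decr. Qed.

(** The survival probabilities decrease to a limit l with l = A^k l for all k. At a
    state where l is maximal and positive, an eventual leak would make A^k l smaller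
    than l. *)
Lemma mass_cvg0 A : substoch A -> (forall s, exists k, mass A k s 0 < 1) ->
  forall s, mass A k s 0 @[k --> \oo] --> (0 : R).
Proof.
move=> hA leak.
pose l : 'cV[R]_n := \col_s limn (fun k => mass A k s 0).
have cl : mx_cvg (mass A) l.
  move=> i j; rewrite ord1 mxE.
  apply: nonincreasing_is_cvgn; first exact: mass_decr.
  by exists 0 => _ [k _ <-]; apply: mass_ge0; case: hA.
have harm k : l = A ^+ k *m l.
  apply: (mx_cvg_unique (A := fun m => mass A (k + m))).
    by move=> i j; have := cl i j; rewrite -(cvg_shiftn k); under eq_fun do rewrite addnC.
  apply: (mx_cvg_ext (B := fun m => A ^+ k *m mass A m)) => [m|]; first exact: massD.
  exact: mx_cvg_mull.
have l0 s : 0 <= l s 0.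
  rewrite mxE; apply: limr_ge; first by apply/cvg_ex; exists (l s 0); exact: cl.
  by apply: nearW => k; apply: mass_ge0; case: hA.
move=> s; suff -> : (0 : R) = l s 0 by exact: cl.
apply/eqP; rewrite eq_le l0 /=.
have [m _ lem] := @arg_maxP _ _ 'I_n s xpredT (fun s => l s 0) isT.
apply: le_trans (lem s isT) _; rewrite leNgt; apply/negP => lm.
have [k kl] := leak m.
suff : l m 0 <= l m 0 * mass A k m 0.
  by rewrite leNgt => /negP; apply; rewrite gtr_pMr.
rewrite {1}(harm k) mxE massE mulr_sumr; apply: ler_sum => j _.
rewrite mulrC; apply: ler_wpM2r; last exact: lem.
by apply: nonneg_exp; case: hA.
Qed.

Section Leaky.
Variable A : 'M[R]_n.
Hypothesis subA : substoch A.
Hypothesis massA : forall s, mass A k s 0 @[k --> \oo] --> (0 : R).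

Lemma leaky_exp_cvg0 : mx_cvg (fun k => A ^+ k) 0.
Proof.
move=> i j; rewrite mxE; apply: (squeeze_cvgr _ (cvg_cst 0) (massA i)).
have nA k := nonneg_exp k (proj1 subA).
apply: nearW => k; rewrite nA /= massE (bigD1 j) //= lerDl.
by apply: sumr_ge0 => x _; exact: nA.
Qed.

Lemma leaky_fix (x : 'rV[R]_n) : x = x *m A -> x = 0.
Proof.
move=> xA; have xk k : x = x *m A ^+ k.
  by elim: k => [|k IH]; rewrite ?expr0 ?mulmx1 // expSm mulmxA -xA.
apply: (mx_cvg_unique (A := fun=> x)); first exact: mx_cvg_cst.
rewrite -(mulmx0 _ x); apply: (mx_cvg_ext (B := fun k => x *m A ^+ k)) => //.
apply: mx_cvg_mull; exact: leaky_exp_cvg0.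
Qed.

Lemma leaky_unit : 1%:M - A \in unitmx.
Proof.
rewrite -row_free_unit -kermx_eq0; apply/eqP/row_matrixP => i.
rewrite row0; apply: leaky_fix; apply/eqP; rewrite -subr_eq0.
by rewrite -{1}[row _ _]mulmx1 -mulmxBr -row_mul mulmx_ker row0.
Qed.

(** From w >= A w follows w >= A^k w, which tends to 0. *)
Lemma leaky_ge0 (w : 'cV[R]_n) : nonneg_mx (w - A *m w) -> nonneg_mx w.
Proof.
move=> hw.
have wk k : nonneg_mx (w - A ^+ k *m w).
  elim: k => [|k IH]; first by rewrite expr0 mul1mx subrr => i j; rewrite mxE.
  have -> : w - A ^+ k.+1 *m w = (w - A ^+ k *m w) + A ^+ k *m (w - A *m w).
    by rewrite mulmxBr mulmxA -expmS addrA subrK.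
  move=> i j; rewrite mxE addr_ge0 //.
  by apply: nonneg_mulmx => //; apply: nonneg_exp; case: subA.
move=> i j.
have c : mx_cvg (fun k => A ^+ k *m w) 0.
  by rewrite -(mul0mx _ w); apply: mx_cvg_mulr; exact: leaky_exp_cvg0.
have := c i j; rewrite mxE => c'; rewrite -(cvg_lim _ c') //.
apply: limr_le; first by apply/cvg_ex; exists 0.
apply: nearW => k; have := wk k i j; by rewrite !mxE subr_ge0.
Qed.

Lemma leaky_inv_ge0 : nonneg_mx (invmx (1%:M - A)).
Proof.
move=> i j; pose w := col j (invmx (1%:M - A)).
suff /(_ i 0) : nonneg_mx w by rewrite mxE.
apply: leaky_ge0.
have -> : w - A *m w = (1%:M - A) *m w by rewrite mulmxBl mul1mx.
rewrite /w colE mulmxA mulmxV ?leaky_unit // mul1mx => x y; rewrite mxE.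
by case: (_ && _).
Qed.

End Leaky.

End NonnegativeMatrices.

Arguments mx_cvg_mull {R m k l} B {A L} _.
Arguments mx_cvg_mulr {R m k l} B {A L} _.

Section CesaroLimit.
Context {R : realType} {n : nat} (P : 'M[R]_n).
Hypothesis stP : stoch P.

Definition avg_mx (H : nat) : 'M[R]_n := H%:R^-1 *: \sum_(i < H) P ^+ i.

Lemma orbit_bounded (y : 'rV[R]_n) k j :
  `|(y *m P ^+ k) 0 j| <= \sum_i `|y 0 i|.
Proof.
rewrite mxE; apply: le_trans (ler_norm_sum _ _ _) _; apply: ler_sum => i _.
rewrite normrM ler_piMr // ger0_norm; first exact/stoch_le1/stoch_exp.
by apply: nonneg_exp; case: stP.
Qed.

Lemma bounded_over_n (f : nat -> R) (b : R) : (forall k, `|f k| <= b) ->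
  k%:R^-1 * f k @[k --> \oo] --> (0 : R).
Proof.
move=> hf; rewrite -(cvg_shiftn 1) /=.
apply: (squeeze_cvgr (f := fun k => - (b * k.+1%:R^-1)) (h := fun k => b * k.+1%:R^-1)).
- apply: nearW => k; rewrite addn1 -ler_norml normrM ger0_norm ?invr_ge0 //.
  by rewrite mulrC ler_wpM2r ?invr_ge0.
- by rewrite -oppr0 -(mulr0 b); apply: cvgN; apply: cvgMl_tmp; exact: cvg_harmonic.
- by rewrite -(mulr0 b); apply: cvgMl_tmp; exact: cvg_harmonic.
Qed.

(** A row vector x that is both fixed by P and of the form y - yP gives
    y P^m = y - m x, which can only stay bounded if x = 0. *)
Lemma fixed_range_trivial (x y : 'rV[R]_n) :
  x *m P = x -> x = y - y *m P -> x = 0.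
Proof.
move=> fx xy; have yP : y *m P = y - x by rewrite xy opprB addrC subrK.
have ym m : y *m P ^+ m = y - m%:R *: x.
  elim: m => [|m IH]; first by rewrite expr0 mulmx1 scale0r subr0.
  rewrite expmS mulmxA IH mulmxBl yP -scalemxAl fx -addrA -opprD.
  by rewrite -natr1 scalerDl scale1r [x + _]addrC.
apply/rowP => j; rewrite [RHS]mxE; apply/eqP; apply: contraT => xj0.
pose b := \sum_i `|y 0 i|.
have bnd m : m%:R * `|x 0 j| <= b + b.
  have -> : m%:R * `|x 0 j| = `|(y *m P ^+ 0) 0 j - (y *m P ^+ m) 0 j|.
    by rewrite expr0 mulmx1 ym !mxE opprB addrC subrK normrM normr_nat.
  by apply: le_trans (ler_normB _ _) _; apply: lerD; exact: orbit_bounded.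
have xj : 0 < `|x 0 j| by rewrite normr_gt0.
have [m] : exists m : nat, (b + b) / `|x 0 j| < m%:R.
  by exists (Num.truncn ((b + b) / `|x 0 j|)).+1; exact: truncnS_gt.
by rewrite ltr_pdivrMr // ltNge bnd.
Qed.

(** The kernel and the image of I - P meet in 0 only, so they span everything
    because their dimensions add up to n. *)
Lemma fixed_plus_range (x : 'rV[R]_n) :
  exists2 k : 'rV[R]_n, k *m P = k & exists y, x = k + (y - y *m P).
Proof.
pose B := 1%:M - P.
have cap0 : (kermx B :&: B)%MS = 0.
  apply/row_matrixP => i; rewrite row0.
  have: (row i (kermx B :&: B) <= kermx B :&: B)%MS by exact: row_sub.
  rewrite sub_capmx => /andP[/sub_kermxP kB /submxP[y yB]].
  apply: (fixed_range_trivial (y := y)).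
    by apply/eqP; rewrite eq_sym -subr_eq0 -{1}(mulmx1 (row _ _)) -mulmxBr kB.
  by rewrite {1}yB mulmxBr mulmx1.
have full : row_full (kermx B + B)%MS.
  have := mxrank_sum_cap (kermx B) B.
  rewrite cap0 mxrank0 addn0 mxrank_ker subnK ?rank_leq_row // => e.
  by apply/eqP.
have /sub_addsmxP[[u v] /= ->] := submx_full x full.
exists (u *m kermx B).
  apply/eqP; rewrite eq_sym -subr_eq0 -{1}(mulmx1 (u *m _)) -mulmxBr -mulmxA.
  by rewrite mulmx_ker mulmx0.
by exists v; rewrite mulmxBr mulmx1.
Qed.

Lemma telescope_range (y : 'rV[R]_n) H :
  \sum_(i < H) (y - y *m P) *m P ^+ i = y - y *m P ^+ H.
Proof.
elim: H => [|H IH]; first by rewrite big_ord0 expr0 mulmx1 subrr.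
by rewrite big_ord_recr /= IH mulmxBl -mulmxA -expSm addrA subrK.
Qed.

Lemma avg_mx_fixl m (k : 'M[R]_(m, n)) H : k *m P = k -> k *m avg_mx H.+1 = k.
Proof.
move=> kP; have kPi i : k *m P ^+ i = k.
  by elim: i => [|i IH]; rewrite ?expr0 ?mulmx1 // expSm mulmxA kP.
rewrite -scalemxAr mulmx_sumr; under eq_bigr do rewrite kPi.
by rewrite sumr_const card_ord -[k *+ _]scaler_nat scalerA mulVf ?pnatr_eq0 // scale1r.
Qed.

Lemma avg_mx_fixr m (B : 'M[R]_(n, m)) H : P *m B = B -> avg_mx H.+1 *m B = B.
Proof.
move=> PB; have PkB i : P ^+ i *m B = B.
  by elim: i => [|i IH]; rewrite ?expr0 ?mul1mx // expmS -mulmxA PB.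
rewrite -scalemxAl mulmx_suml; under eq_bigr do rewrite PkB.
by rewrite sumr_const card_ord -[B *+ _]scaler_nat scalerA mulVf ?pnatr_eq0 // scale1r.
Qed.

(** On a fixed vector the averages are constant; on y - y P they telescope to (y - y
    P^H) / H. *)
Lemma avg_mx_row_cvg (x : 'rV[R]_n) :
  exists2 k : 'rV[R]_n, k *m P = k & mx_cvg (fun H => x *m avg_mx H) k.
Proof.
have [k kP [y xE]] := fixed_plus_range x; exists k => // i j.
rewrite ord1.
pose f H := H%:R^-1 * (y - y *m P ^+ H) 0 j.
have cf : f H @[H --> \oo] --> (0 : R).
  apply: (bounded_over_n (b := \sum_i `|y 0 i| + \sum_i `|y 0 i|)) => m.
  have -> : (y - y *m P ^+ m) 0 j = y 0 j - (y *m P ^+ m) 0 j by rewrite !mxE.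
  apply: le_trans (ler_normB _ _) _; apply: lerD.
    by have := orbit_bounded y 0 j; rewrite expr0 mulmx1.
  exact: orbit_bounded.
have E H : (x *m avg_mx H.+1) 0 j = k 0 j + f H.+1.
  rewrite xE mulmxDl avg_mx_fixl // mxE; congr (_ + _).
  rewrite -scalemxAr mulmx_sumr telescope_range mxE //.
rewrite -(cvg_shiftn 1) /=; under eq_fun do rewrite addn1 E.
have -> : k 0 j = k 0 j + 0 by rewrite addr0.
apply: (@cvgD _ R _ _ _ (fun=> k 0 j + 0)); first by rewrite addr0; exact: cvg_cst.
by move: cf; rewrite -(cvg_shiftn 1) /=; under eq_fun do rewrite addn1.
Qed.

Lemma avg_mx_cvg : mx_cvg avg_mx (cesaro_limit P).
Proof.
move=> s s'; rewrite mxE.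
have E H : avg_mx H s s' = H%:R^-1 * \sum_(i < H) (P ^+ i) s s'.
  by rewrite mxE summxE.
rewrite -(eq_fun E).
have [k _ /(_ 0 s')] := avg_mx_row_cvg (delta_mx 0 s).
under eq_fun do rewrite -rowE mxE.
by move=> c; apply/cvg_ex; exists (k 0 s').
Qed.

Arguments avg_mx_cvg : clear implicits.

Lemma cesaro_mulr : cesaro_limit P *m P = cesaro_limit P.
Proof.
apply/row_matrixP => s; rewrite row_mul.
have [k kP c] := avg_mx_row_cvg (delta_mx 0 s).
suff -> : row s (cesaro_limit P) = k by [].
rewrite rowE; apply: (mx_cvg_unique _ c).
by apply: mx_cvg_mull; exact: avg_mx_cvg.
Qed.

Lemma cesaro_mull : P *m cesaro_limit P = cesaro_limit P.
Proof.
rewrite -[RHS]cesaro_mulr.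
have c := mx_cvg_mull P avg_mx_cvg.
apply: (mx_cvg_unique c).
have E H : P *m avg_mx H = avg_mx H *m P.
  rewrite -scalemxAr -scalemxAl mulmx_sumr mulmx_suml; congr (_ *: _).
  by apply: eq_bigr => i _; rewrite -expSm -expmS.
apply: (mx_cvg_ext (B := fun H => avg_mx H *m P)) => //.
by apply: mx_cvg_mulr; exact: avg_mx_cvg.
Qed.

Lemma cesaro_expr k : cesaro_limit P *m P ^+ k = cesaro_limit P.
Proof.
by elim: k => [|k IH]; rewrite ?expr0 ?mulmx1 // expSm mulmxA cesaro_mulr.
Qed.

Lemma cesaro_fix m (B : 'M[R]_(n, m)) : P *m B = B -> cesaro_limit P *m B = B.
Proof.
move=> PB; have c := mx_cvg_mulr B avg_mx_cvg.
apply: (mx_cvg_unique c).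
by apply: (mx_cvg_ext (B := fun=> B)) => [H|]; [exact: avg_mx_fixr|exact: mx_cvg_cst].
Qed.

Lemma cesaro_stoch : stoch (cesaro_limit P).
Proof.
split=> [i j|i].
  have c := avg_mx_cvg i j; rewrite -(cvg_lim _ c) //.
  apply: limr_ge; first by apply/cvg_ex; exists (cesaro_limit P i j).
  apply: nearW => H; rewrite mxE summxE mulr_ge0 ?invr_ge0 //.
  by apply: sumr_ge0 => k _; apply: nonneg_exp; case: stP.
have P1 : P *m (const_mx 1 : 'cV_n) = const_mx 1.
  apply/colP => s; rewrite !mxE -[RHS](proj2 stP s).
  by apply: eq_bigr => j _; rewrite mxE mulr1.
have /colP/(_ i) := cesaro_fix P1; rewrite !mxE => <-.
by apply: eq_bigr => j _; rewrite [const_mx _ _ _]mxE mulr1.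
Qed.

(** Multiplying x (I - P + P_star) = 0 by P_star gives x P_star = 0, hence
    x = x P and x = x P_star = 0. *)
Lemma fundamental_unit : 1%:M - P + cesaro_limit P \in unitmx.
Proof.
set L := cesaro_limit P; set Z := 1%:M - P + L.
rewrite -row_free_unit -kermx_eq0; apply/eqP/row_matrixP => i; rewrite row0.
set x := row i _.
have xZ : x *m Z = 0 by rewrite /x -row_mul mulmx_ker row0.
have ZL : Z *m L = L.
  by rewrite /Z mulmxDl mulmxBl mul1mx cesaro_mull subrr add0r (cesaro_fix cesaro_mull).
have xL : x *m L = 0 by rewrite -ZL mulmxA xZ mul0mx.
have xP : x *m P = x.
  move: xZ; rewrite /Z mulmxDr xL addr0 mulmxBr mulmx1 => /eqP.
  by rewrite subr_eq0 => /eqP <-.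
rewrite -xL; apply: (mx_cvg_unique (A := fun H => x *m avg_mx H)); last first.
  by apply: mx_cvg_mull; exact: avg_mx_cvg.
by apply: (mx_cvg_ext (B := fun=> x)) => [H|]; [exact: avg_mx_fixl|exact: mx_cvg_cst].
Qed.

(** Since P_star annihilates v, the equation (I - P + P_star) v = (I - P_star) r
    loses its last term. *)
Lemma poisson_solution (r : 'cV[R]_n) :
  let L := cesaro_limit P in
  let v := invmx (1%:M - P + L) *m ((1%:M - L) *m r) in
  v - P *m v = r - L *m r.
Proof.
move=> L v.
have Zv : (1%:M - P + L) *m v = r - L *m r.
  by rewrite /v mulKVmx ?fundamental_unit // mulmxBl mul1mx.
have Lv : L *m v = 0.
  have LL : L *m L = L := cesaro_fix cesaro_mull.
  have := congr1 (fun w => L *m w) Zv.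
  rewrite mulmxA mulmxDr mulmxBr mulmx1 cesaro_mulr subrr add0r.
  by rewrite LL mulmxBr (mulmxA L L r) LL subrr.
by move: Zv; rewrite mulmxDl Lv addr0 mulmxBl mul1mx.
Qed.

End CesaroLimit.

Arguments avg_mx_cvg {R n P} _ _ _.
Arguments leaky_exp_cvg0 {R n A} _ _ _ _.

(** * Hitting times and recurrence of a finite chain *)

Section Accessibility.
Context {R : realType} {n : nat} (P : 'M[R]_n).
Hypothesis stP : stoch P.

Lemma accessible_refl s : accessible P s s.
Proof. by exists 0%N; rewrite expr0 mxE eqxx ltr01. Qed.

Lemma accessible_trans s1 s2 s3 :
  accessible P s1 s2 -> accessible P s2 s3 -> accessible P s1 s3.
Proof.
move=> [k hk] [l hl]; exists (k + l)%N; rewrite exprD -mulmxE mxE (bigD1 s2) //=.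
apply: ltr_wpDr; last exact: mulr_gt0.
by apply: sumr_ge0 => x _; apply: mulr_ge0; apply: nonneg_exp; case: stP.
Qed.

Lemma accessible1 s s' : 0 < P s s' -> accessible P s s'.
Proof. by move=> h; exists 1%N; rewrite expr1. Qed.

Lemma not_accessible s s' k : ~ accessible P s s' -> (P ^+ k) s s' = 0.
Proof.
move=> na; apply/eqP; rewrite eq_le nonneg_exp ?andbT; last by case: stP.
by rewrite leNgt; apply/negP => h; apply: na; exists k.
Qed.

Definition closed_class (C : pred 'I_n) := forall s s', C s -> 0 < P s s' -> C s'.

Lemma closed_class_exp C k s s' : closed_class C -> C s -> 0 < (P ^+ k) s s' -> C s'.
Proof.
move=> clC; elim: k s => [|k IH] s Cs.
  by rewrite expr0 mxE; case: eqP => [<-|]; rewrite ?ltxx.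
rewrite expSm mxE => h.
have [j jP] : exists j, 0 < P s j * (P ^+ k) j s'.
  apply: contrapT => /forallNP nj; move: h; rewrite ltNge => /negP; apply.
  by apply: sumr_le0 => j _; rewrite leNgt; apply/negP; exact: nj.
have Pge : 0 <= P s j by apply: (proj1 stP).
have Pkge : 0 <= (P ^+ k) j s' by apply: nonneg_exp; case: stP.
have Psj : 0 < P s j.
  by rewrite lt_def Pge andbT; apply/eqP => e; move: jP; rewrite e mul0r ltxx.
apply: (IH j); first exact: clC Cs Psj.
by rewrite lt_def Pkge andbT; apply/eqP => e; move: jP; rewrite e mulr0 ltxx.
Qed.

Lemma closed_class_acc C s s' : closed_class C -> C s -> accessible P s s' -> C s'.
Proof. by move=> clC Cs [k]; exact: closed_class_exp. Qed.

Lemma sum_closed_class C s (f : 'I_n -> R) : closed_class C -> C s ->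
  \sum_s' P s s' * f s' = \sum_(s' | C s') P s s' * f s'.
Proof.
move=> clC Cs; rewrite (bigID C) /= [X in _ + X]big1 ?addr0 // => s' nC.
suff -> : P s s' = 0 by rewrite mul0r.
apply/eqP; rewrite eq_le (proj1 stP) andbT leNgt; apply/negP => h.
by move: nC; rewrite (clC s s').
Qed.

(** Maximum principle: where u is maximal on the class, it is an average of values
    of u that do not exceed it, so these are all equal to it, and irreducibility
    reaches every state of the class. *)
Lemma harmonic_const (C : pred 'I_n) (u : 'cV[R]_n) : closed_class C ->
  (forall s s', C s -> C s' -> accessible P s s') ->
  (forall s, C s -> u s 0 = \sum_s' P s s' * u s' 0) ->
  forall s s', C s -> C s' -> u s 0 = u s' 0.
Proof.
move=> clC irr harm.
have harmk k s : C s -> u s 0 = \sum_s' (P ^+ k) s s' * u s' 0.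
  elim: k s => [|k IH] s Cs.
    rewrite expr0 (bigD1 s) //= mxE eqxx mul1r big1 ?addr0 // => j /negPf js.
    by rewrite mxE eq_sym js mul0r.
  rewrite harm // (sum_closed_class _ clC Cs).
  under eq_bigr => j Cj do rewrite (IH j Cj).
  rewrite -(sum_closed_class (fun s' => \sum_j (P ^+ k) s' j * u j 0) clC Cs).
  under eq_bigr do rewrite mulr_sumr.
  rewrite exchange_big; apply: eq_bigr => j _.
  by rewrite expSm mxE mulr_suml; apply: eq_bigr => i _; rewrite mulrA.
move=> s s' Cs Cs'.
have [m Cm lem] := @arg_maxP _ _ 'I_n s C (fun s => u s 0) Cs.
have {}lem j : C j -> u j 0 <= u m 0 := lem j.
suff H x : C x -> u x 0 = u m 0 by rewrite !H.
move=> Cx; have [k hk] := irr _ _ Cm Cx.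
apply/eqP; rewrite eq_le lem //=; rewrite leNgt; apply/negP => lt.
have [Pk0 Pk1] := stoch_exp k stP.
have : u m 0 < \sum_s' (P ^+ k) m s' * u m 0.
  rewrite {1}(harmk k m Cm) (bigD1 x) //= [X in _ < X](bigD1 x) //=.
  apply: ltr_leD; first by rewrite ltr_pM2l.
  apply: ler_sum => j _; have [Cj|nCj] := boolP (C j).
    by apply: ler_wpM2l => //; exact: lem.
  suff -> : (P ^+ k) m j = 0 by rewrite !mul0r.
  apply/eqP; rewrite eq_le Pk0 andbT leNgt; apply/negP => h.
  by move: nCj; rewrite (closed_class_exp clC Cm h).
by rewrite -mulr_suml Pk1 mul1r ltxx.
Qed.

(** The chain killed when it leaves D. *)
Definition restrict_mx (D : pred 'I_n) : 'M[R]_n :=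
  \matrix_(s, s') (if D s && D s' then P s s' else 0).

Lemma restrict_mx_ge0 D : nonneg_mx (restrict_mx D).
Proof. by move=> i j; rewrite mxE; case: ifP => // _; exact: (proj1 stP). Qed.

Lemma restrict_mx_le D i j : restrict_mx D i j <= P i j.
Proof. by rewrite mxE; case: ifP => // _; exact: (proj1 stP). Qed.

Lemma restrict_substoch D : substoch (restrict_mx D).
Proof.
split=> [|i]; first exact: restrict_mx_ge0.
by rewrite -(proj2 stP i); apply: ler_sum => j _; exact: restrict_mx_le.
Qed.

Lemma restrict_exp_le D k i j : (restrict_mx D ^+ k) i j <= (P ^+ k) i j.
Proof.
elim: k i => [|k IH] i; first by rewrite !expr0.
rewrite !expSm !mxE; apply: ler_sum => x _; apply: ler_pM => //.
- exact: restrict_mx_ge0.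
- exact/nonneg_exp/restrict_mx_ge0.
- exact: restrict_mx_le.
Qed.

Lemma restrict_exp_out D k i j : ~~ D j -> (restrict_mx D ^+ k.+1) i j = 0.
Proof.
move=> /negPf nD; rewrite expmS mxE big1 // => x _.
by rewrite [restrict_mx _ _ _]mxE nD andbF mulr0.
Qed.

(** A path that leaves D has positive probability, which is what the chain killed
    outside D loses. *)
Lemma restrict_mass_cvg0 (D : pred 'I_n) :
  (forall s, D s -> exists2 s', ~~ D s' & accessible P s s') ->
  forall s, mass (restrict_mx D) k s 0 @[k --> \oo] --> (0 : R).
Proof.
move=> exitD; apply: mass_cvg0; first exact: restrict_substoch.
move=> s; have [Ds|/negPf nDs] := boolP (D s); last first.
  exists 1%N; rewrite massE big1 ?ltr01 // => j _.
  by rewrite expr1 mxE nDs.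
have [s' nD [[|k] hk]] := exitD s Ds.
  by move: hk nD; rewrite expr0 mxE; case: eqP => [<-|]; rewrite ?Ds // ltxx.
exists k.+1; rewrite massE.
have [Pk0 Pk1] := stoch_exp k.+1 stP.
rewrite -(Pk1 s) (bigD1 s') //= [X in _ < X](bigD1 s') //= restrict_exp_out //.
by apply: ltr_leD => //; apply: ler_sum => j _; exact: restrict_exp_le.
Qed.

Lemma cesaro_accessible s s' : ~ accessible P s s' -> cesaro_limit P s s' = 0.
Proof.
move=> na; have c := avg_mx_cvg stP s s'.
suff c' : avg_mx P H s s' @[H --> \oo] --> (0 : R) by apply: (cvgR_unique c c').
have -> : (fun H => avg_mx P H s s') = fun=> 0.
  apply/funext => H; rewrite mxE summxE big1 ?mulr0 // => i _.
  exact: not_accessible.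
exact: cvg_cst.
Qed.

Lemma comm_class_closed s :
  (forall s', accessible P s s' -> accessible P s' s) -> closed_class (comm_class P s).
Proof.
move=> rec s1 s2 /asboolP[h1 _] h2; apply/asboolP.
have h : accessible P s s2 by apply: accessible_trans h1 _; exact: accessible1.
by split=> //; exact: rec.
Qed.

Lemma comm_class_irr s s1 s2 : comm_class P s s1 -> comm_class P s s2 ->
  accessible P s1 s2.
Proof. by move=> /asboolP[_ h1] /asboolP[h2 _]; exact: accessible_trans h1 h2. Qed.

Lemma comm_class_refl s : comm_class P s s.
Proof. by apply/asboolP; split; exact: accessible_refl. Qed.

(** A row of P_star provides such a distribution. *)
Lemma stationary_onP s :
  (forall s', accessible P s s' -> accessible P s' s) ->
  let C := comm_class P s in let g := stationary_on P C in
  [/\ simplex g, forall s', ~~ C s' -> g 0 s' = 0 & g *m P = g].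
Proof.
move=> rec C g; apply: (@xgetPex _ 0 [set g | [/\ simplex g, forall s', ~~ C s' -> g 0 s' = 0 & g *m P = g]]).
have [L0 L1] := cesaro_stoch stP.
exists (row s (cesaro_limit P)); split.
- split=> [i|]; first by rewrite mxE.
  by under eq_bigr do rewrite mxE; exact: L1.
- move=> s' nC; rewrite mxE; apply: cesaro_accessible => h.
  move: nC => /negP; apply; apply/asboolP; split=> //; exact: rec.
- by rewrite -row_mul cesaro_mulr.
Qed.

End Accessibility.

Section HittingTimes.
Context {R : realType} {n : nat} (P : 'M[R]_n).
Hypothesis stP : stoch P.
Variable z : 'I_n.

Lemma first_hit_ge0 k s : 0 <= first_hit P z k s.
Proof.
elim: k s => [|k IH] s /=; first by case: (_ == _).
by case: ifP => // _; apply: sumr_ge0 => x _; apply: mulr_ge0 => //; exact: (proj1 stP).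
Qed.

Lemma first_hit_accessible k s : ~ accessible P s z -> first_hit P z k s = 0.
Proof.
elim: k s => [|k IH] s na /=.
  by case: eqP => // e; case: na; rewrite e; exact: accessible_refl.
case: ifP => // _; apply: big1 => x _.
have [e|ne] := eqVneq (P s x) 0; first by rewrite e mul0r.
rewrite IH ?mulr0 // => acc; apply: na; apply: (accessible_trans stP _ acc).
by apply: accessible1; rewrite lt_def ne; exact: (proj1 stP).
Qed.

Definition hit_before k s : R := series (fun k => first_hit P z k s) k.

Lemma hit_beforeS k s :
  hit_before k.+1 s = if s == z then 1 else \sum_s' P s s' * hit_before k s'.
Proof.
rewrite /hit_before /series /= big_nat_recl //=; case: ifP => [_|_].
  by rewrite big1 ?addr0.
by rewrite add0r exchange_big; apply: eq_bigr => x _; rewrite mulr_sumr.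
Qed.

Lemma hit_before_le1 k s : hit_before k s <= 1.
Proof.
elim: k s => [|k IH] s; first by rewrite /hit_before /series /= big_nil ler01.
rewrite hit_beforeS; case: ifP => // _; rewrite -(proj2 stP s).
by apply: ler_sum => x _; rewrite ler_piMr //; exact: (proj1 stP).
Qed.

Lemma hit_before_cvg s : hit_before k s @[k --> \oo] --> hit_prob P z s.
Proof.
apply: nondecreasing_is_cvgn.
  by apply: nondecreasing_series => k _ _; exact: first_hit_ge0.
by exists 1 => _ [k _ <-]; exact: hit_before_le1.
Qed.

Lemma hit_prob_le1 s : hit_prob P z s <= 1.
Proof.
rewrite -(cvg_lim _ (hit_before_cvg (s := s))) //.
apply: limr_le; first by apply/cvg_ex; exists (hit_prob P z s); exact: hit_before_cvg.
by apply: nearW => k; exact: hit_before_le1.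
Qed.

Lemma hit_probE s :
  hit_prob P z s = if s == z then 1 else \sum_s' P s s' * hit_prob P z s'.
Proof.
have c := @hit_before_cvg s; rewrite -(cvg_shiftn 1) /= in c.
apply: (cvgR_unique c); under eq_fun do rewrite addn1 hit_beforeS.
case: ifP => _; first exact: cvg_cst.
by apply: cvg_sum_fin => x _; apply: cvgMl_tmp; exact: hit_before_cvg.
Qed.

Lemma hit_prob_accessible s : ~ accessible P s z -> hit_prob P z s = 0.
Proof.
move=> na; have c := @hit_before_cvg s; apply: (cvgR_unique c).
suff -> : (fun k => hit_before k s) = fun=> 0 by exact: cvg_cst.
by apply/funext => k; rewrite /hit_before /series /= big1 // => i _; exact: first_hit_accessible.
Qed.

Section InClass.
Variable C : pred 'I_n.
Hypothesis clC : closed_class P C.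
Hypothesis accC : forall s, C s -> accessible P s z.

Let D : pred 'I_n := fun s => C s && (s != z).
Let A := restrict_mx P D.
Let one : 'cV[R]_n := \col_s (D s)%:R.
(** The distribution of the hitting time of z, restricted to the states of D: from
    time 1 on it is obtained by iterating A. *)
Let F k : 'cV[R]_n := \col_s (if D s then first_hit P z k s else 0).

Let subA : substoch A. Proof. exact: restrict_substoch. Qed.

Let massA s : mass A k s 0 @[k --> \oo] --> (0 : R).
Proof.
apply: restrict_mass_cvg0 => // x /andP[Cx _]; exists z; last exact: accC.
by rewrite /D eqxx andbF.
Qed.

Let sumD s (f : 'I_n -> R) : D s -> f z = 0 ->
  \sum_s' P s s' * f s' = \sum_s' A s s' * f s'.
Proof.
move=> Ds fz; have /andP[Cs _] := Ds.
rewrite (sum_closed_class stP f clC Cs) big_mkcond; apply: eq_bigr => x _.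
rewrite mxE Ds /= /D; case: (C x) => /=; last by rewrite mul0r.
by case: eqP => [->|_] /=; rewrite ?fz ?mulr0.
Qed.

Let AF (f : 'cV[R]_n) s : ~~ D s -> (A *m f) s 0 = 0.
Proof. by move=> /negPf nD; rewrite mxE big1 // => x _; rewrite mxE nD mul0r. Qed.

Let F1 : F 1 = one - A *m one.
Proof.
apply/colP => s; rewrite [LHS]mxE subMxE [one _ _]mxE.
case: ifP => [Ds|nD]; last by rewrite AF ?nD // subrr.
have /andP[Cs nz] := Ds; rewrite /= (negPf nz).
apply/eqP; rewrite eq_sym subr_eq eq_sym; apply/eqP.
have -> : (A *m one) s 0 = \sum_s' P s s' * (s' != z)%:R.
  rewrite (sumD Ds) ?eqxx // mxE; apply: eq_bigr => x _.
  by rewrite [A _ _]mxE [one _ _]mxE Ds /= /D; case: (C x); rewrite /= ?mul0r.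
rewrite -big_split /= -[RHS](proj2 stP s); apply: eq_bigr => x _.
by rewrite -mulrDr; case: eqP; rewrite ?addr0 ?add0r mulr1.
Qed.

Let FS k : F k.+2 = A *m F k.+1.
Proof.
apply/colP => s; rewrite [LHS]mxE; case: ifP => [Ds|nD]; last by rewrite AF ?nD.
have /andP[Cs nz] := Ds.
have -> : first_hit P z k.+2 s = \sum_s' P s s' * first_hit P z k.+1 s'.
  by rewrite /= (negPf nz).
rewrite (sumD Ds); last by rewrite /= eqxx.
rewrite [RHS]mxE; apply: eq_bigr => x _.
by rewrite mxE [F _ _ _]mxE Ds /=; case: ifP; rewrite ?mul0r.
Qed.

Let sumF m : \sum_(k < m) F k.+1 = one - A ^+ m *m one.
Proof.
elim: m => [|m IH]; first by rewrite big_ord0 expr0 mul1mx subrr.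
have Fm : F m.+1 = A ^+ m *m one - A ^+ m.+1 *m one.
  elim: m {IH} => [|m IH]; first by rewrite F1 expr0 mul1mx expr1.
  by rewrite FS IH mulmxBr !mulmxA -!expSm.
by rewrite big_ord_recr /= IH Fm addrA subrK.
Qed.

Let S m : 'cV[R]_n := \sum_(k < m) k%:R *: F k.

Let S_rec m : S m.+1 = A *m S m + (one - A ^+ m *m one).
Proof.
rewrite /S big_ord_recl scale0r add0r -sumF mulmx_sumr -big_split /=.
apply: eq_bigr => k _; rewrite -scalemxAr /bump /= add1n -natr1 scalerDl scale1r.
by congr (_ + _); case: (k : nat) => [|j]; rewrite ?scale0r // FS.
Qed.

(** The expected hitting times of z, which bound the partial sums S of the series
    defining them. *)
Let w := invmx (1%:M - A) *m one.

Let w_fix : w = A *m w + one.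
Proof.
have : (1%:M - A) *m w = one by rewrite mulKVmx // leaky_unit.
by rewrite mulmxBl mul1mx => <-; rewrite addrC subrK.
Qed.

Let one_ge0 : nonneg_mx one. Proof. by move=> i j; rewrite mxE; case: (D i). Qed.

Let S_le m s : S m s 0 <= w s 0.
Proof.
elim: m s => [|m IH] s.
  rewrite /S big_ord0 mxE; apply: nonneg_mulmx => //; exact: leaky_inv_ge0.
rewrite S_rec w_fix mxE [X in _ <= X]mxE; apply: lerD.
  by rewrite !mxE; apply: ler_sum => x _; apply: ler_wpM2l => //; case: subA.
rewrite subMxE gerDl oppr_le0.
by apply: nonneg_mulmx => //; apply: nonneg_exp; case: subA.
Qed.

Let SE m s : D s -> S m s 0 = series (fun k => k%:R * first_hit P z k s) m.
Proof.
move=> Ds; rewrite /S summxE /series /= big_mkord; apply: eq_bigr => k _.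
by rewrite mxE [F _ _ _]mxE Ds.
Qed.

Let cvgS s : D s -> S m s 0 @[m --> \oo] --> expected_hit P z s.
Proof.
move=> Ds; under eq_fun do rewrite SE //.
apply: nondecreasing_is_cvgn.
  by apply: nondecreasing_series => k _ _; rewrite mulr_ge0 //; exact: first_hit_ge0.
by exists (w s 0) => _ [m _ <-]; rewrite -SE //; exact: S_le.
Qed.

Lemma expected_hit_self : expected_hit P z z = 0.
Proof.
rewrite /expected_hit; suff -> : series (fun k => k%:R * first_hit P z k z) = fun=> 0.
  by rewrite lim_cst.
apply/funext => m; rewrite /series /= big1 // => -[|k] _; first by rewrite mul0r.
by rewrite /= eqxx mulr0.
Qed.

Lemma expected_hit_ge0 s : C s -> 0 <= expected_hit P z s.
Proof.
have [->|nz] := eqVneq s z; first by rewrite expected_hit_self.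
move=> Cs; have Ds : D s by rewrite /D Cs.
rewrite -(cvg_lim _ (cvgS Ds)) //; apply: limr_ge.
  by apply/cvg_ex; exists (expected_hit P z s); exact: cvgS.
apply: nearW => m; rewrite SE //; apply: sumr_ge0 => k _.
by rewrite mulr_ge0 //; exact: first_hit_ge0.
Qed.

Let cvg_one s : (one - A ^+ m *m one) s 0 @[m --> \oo] --> one s 0.
Proof.
have c := mx_cvg_mulr one (leaky_exp_cvg0 subA massA) s 0.
under eq_fun do rewrite subMxE.
suff : one s 0 - (A ^+ m *m one) s 0 @[m --> \oo] --> one s 0 - ((0 : 'M[R]_n) *m one) s 0.
  by rewrite mul0mx [(0 : 'cV[R]_n) s 0]mxE subr0.
by apply: cvgB; [exact: cvg_cst|exact: c].
Qed.

Lemma hit_prob_class s : C s -> hit_prob P z s = 1.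
Proof.
move=> Cs; have [->|nz] := eqVneq s z; first by rewrite hit_probE eqxx.
have Ds : D s by rewrite /D Cs.
have c := @hit_before_cvg s; rewrite -(cvg_shiftn 1) /= in c.
apply: (cvgR_unique c); have := @cvg_one s; rewrite [one s 0]mxE Ds.
suff -> : (fun m => (one - A ^+ m *m one) s 0) = (fun k => hit_before (k + 1) s) by [].
apply/funext => m; rewrite -sumF summxE /hit_before /series /= addn1 big_nat_recl //=.
rewrite (negPf nz) add0r big_mkord; apply: eq_bigr => k _.
by rewrite mxE Ds /= (negPf nz).
Qed.

Lemma expected_hit_step s : C s -> s != z ->
  expected_hit P z s = 1 + \sum_s' P s s' * expected_hit P z s'.
Proof.
move=> Cs nz; have Ds : D s by rewrite /D Cs.
have c := @cvgS s Ds; rewrite -(cvg_shiftn 1) /= in c.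
apply: (cvgR_unique c).
rewrite (sumD Ds expected_hit_self) addrC.
under eq_fun do rewrite addn1 S_rec mxE.
apply: cvgD; last by have := @cvg_one s; rewrite [one s 0]mxE Ds.
under eq_fun do rewrite mxE.
apply: cvg_sum_fin => x _; rewrite mxE; case: ifP => [/andP[_ Dx]|_].
  by apply: cvgMl_tmp; exact: cvgS.
rewrite mul0r; under eq_fun do rewrite mul0r.
exact: cvg_cst.
Qed.

End InClass.
End HittingTimes.

Section ClassPoisson.
Context {R : realType} {n : nat} (P : 'M[R]_n).
Hypothesis stP : stoch P.

(** Hitting probabilities of s are harmonic except at s; recurrence removes the
    exception, and then they are 1 wherever s leads. *)
Lemma recurrentP s :
  recurrent P s <-> (forall s', accessible P s s' -> accessible P s' s).
Proof.
split=> [rec s' [k hk]|rec]; last first.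
  have clC := comm_class_closed stP rec.
  rewrite /recurrent (sum_closed_class stP _ clC (comm_class_refl P s)).
  rewrite (eq_bigr (fun s' => P s s' * 1)).
    rewrite -(sum_closed_class stP (fun=> 1) clC (comm_class_refl P s)).
    by rewrite -[RHS](proj2 stP s); apply: eq_bigr => x _; rewrite mulr1.
  move=> s' Cs'; rewrite (hit_prob_class stP clC) //.
  by move=> x /asboolP[].
apply: contrapT => na.
pose h : 'cV[R]_n := \col_x hit_prob P s x.
have Ph : P *m h = h.
  apply/colP => x; rewrite !mxE; under eq_bigr do rewrite mxE.
  rewrite [RHS]hit_probE //; case: eqP => [->|//].
  by rewrite [LHS]rec.
have Pkh : P ^+ k *m h = h.
  by elim: k {hk} => [|k IH]; rewrite ?expr0 ?mul1mx // expmS -mulmxA Ph.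
have [Pk0 Pk1] := stoch_exp k stP.
have : (P ^+ k *m h) s 0 < 1.
  rewrite mxE -(Pk1 s) (bigD1 s') //= [X in _ < X](bigD1 s') //=.
  apply: ltr_leD; first by rewrite mxE hit_prob_accessible // mulr0.
  by apply: ler_sum => j _; rewrite ler_piMr // mxE; exact: hit_prob_le1.
by rewrite Pkh mxE hit_probE // eqxx ltxx.
Qed.

(** With h_z the expected hitting times of z, h_z - P h_z is 1 off z, and 1 -
    1/g_z at z (Kac's formula, from integrating this against g); summing against
    g_z f_z yields a solution of Poisson's equation for f. *)
Lemma class_poisson s (f : 'cV[R]_n) (b : R) :
  (forall s', accessible P s s' -> accessible P s' s) ->
  (forall s', `|f s' 0| <= b) ->
  let C := comm_class P s in
  exists (c : R) (u : 'cV[R]_n),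
    [/\ forall s', C s' -> f s' 0 - c = u s' 0 - \sum_x P s' x * u x 0 &
        forall s', C s' ->
          `|u s' 0| <= b * \sum_(z | C z) stationary_on P C 0 z * expected_hit P z s'].
Proof.
move=> rec fb C; have [[g0 g1] gC gP] := stationary_onP stP rec.
set g := stationary_on P C in g0 g1 gC gP *.
have clC : closed_class P C := comm_class_closed stP rec.
have accC z : C z -> forall x, C x -> accessible P x z.
  by move=> Cz x Cx; exact: (comm_class_irr stP Cx Cz).
have g1C : \sum_(z | C z) g 0 z = 1.
  by rewrite -[RHS]g1 [RHS](bigID C) /= [X in _ + X]big1 ?addr0 // => z; exact: gC.
pose h z x := expected_hit P z x.
pose Ph z x := \sum_y P x y * h z y.
have kac z : C z -> g 0 z * (1 + Ph z z) = 1.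
  move=> Cz.
  have E : \sum_x g 0 x * Ph z x = \sum_x g 0 x * h z x.
    under eq_bigr do rewrite mulr_sumr.
    rewrite exchange_big; apply: eq_bigr => y _; rewrite -{2}gP mxE mulr_suml.
    by apply: eq_bigr => x _; rewrite mulrA.
  have gsum (k : 'I_n -> R) : \sum_x g 0 x * k x = \sum_(x | C x) g 0 x * k x.
    rewrite (bigID C) /= [X in _ + X]big1 ?addr0 // => x nC.
    by rewrite gC // mul0r.
  rewrite !gsum (bigD1 z) //= [RHS](bigD1 z) //= /h expected_hit_self mulr0 add0r in E.
  have E2 : \sum_(x | C x && (x != z)) g 0 x * h z x =
     \sum_(x | C x && (x != z)) g 0 x + \sum_(x | C x && (x != z)) g 0 x * Ph z x.
    rewrite -big_split; apply: eq_bigr => x /andP[Cx xz].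
    by rewrite /h (expected_hit_step stP clC (accC _ Cz) Cx xz) mulrDr mulr1.
  have := g1C; rewrite (bigD1 z) //=; move: E; rewrite -/(h _) E2 => E.
  by rewrite mulrDr mulr1; lra.
exists (\sum_(z | C z) g 0 z * f z 0).
exists (\col_x - \sum_(z | C z) g 0 z * f z 0 * h z x); split=> x Cx.
  have -> : \sum_y P x y * (\col_x0 - \sum_(z | C z) g 0 z * f z 0 * h z x0) y 0
     = - \sum_(z | C z) g 0 z * f z 0 * Ph z x.
    under eq_bigr do rewrite mxE mulrN mulr_sumr.
    rewrite sumrN exchange_big; congr (- _); apply: eq_bigr => z _.
    by rewrite mulr_sumr; apply: eq_bigr => y _; ring.
  rewrite mxE opprK [RHS]addrC -sumrB [in RHS](bigD1 x) //= [in LHS](bigD1 x) //=.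
  have -> : h x x = 0 by exact: expected_hit_self.
  have -> : \sum_(i | C i && (i != x)) (g 0 i * f i 0 * Ph i x - g 0 i * f i 0 * h i x)
       = - \sum_(i | C i && (i != x)) g 0 i * f i 0.
    rewrite -sumrN; apply: eq_bigr => z /andP[Cz zx].
    rewrite /h (expected_hit_step stP clC (accC _ Cz) Cx) 1?eq_sym //.
    by rewrite -/(h _) -/(Ph z x); ring.
  have := kac x Cx; set q := Ph x x; set S := \sum_(_ | _) _ => k.
  have : g 0 x * f x 0 * q = f x 0 - g 0 x * f x 0.
    have E : g 0 x * q = 1 - g 0 x by lra.
    by rewrite mulrAC E; ring.
  by rewrite mulr0 subr0 => ->; ring.
rewrite mxE normrN; apply: le_trans (ler_norm_sum _ _ _) _; rewrite mulr_sumr.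
apply: ler_sum => z Cz; rewrite !normrM (ger0_norm (g0 z)).
rewrite (ger0_norm (expected_hit_ge0 stP clC (accC _ Cz) Cx)).
rewrite mulrAC mulrC ler_wpM2r // mulr_ge0 //.
exact: (expected_hit_ge0 stP clC (accC _ Cz) Cx).
Qed.

End ClassPoisson.

(** * Values of a policy and the performance difference lemma *)

Section Classification.
Context {R : realType} {nS nA : nat} (M : mdp R nS nA).
Implicit Types (pi : 'M[R]_(nS, nA)) (s : 'I_nS) (a : 'I_nA).

Lemma policies_clipW (alpha : R) pi : 0 < alpha ->
  policies_clip alpha pi -> policies_pos pi.
Proof.
move=> a0 h s; have [h1 h2] := h s; split=> // a.
exact: lt_le_trans a0 (h2 a).
Qed.

Lemma policies_posW pi : policies_pos pi -> policies pi.
Proof. by move=> h s; have [] := h s. Qed.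

Lemma policy_ge0 pi s a : policies pi -> 0 <= pi s a.
Proof. by move=> h; have [+ _] := h s; move=> /(_ a); rewrite mxE. Qed.

Lemma policy_sum1 pi s : policies pi -> \sum_a pi s a = 1.
Proof.
by move=> h; have [_ <-] := h s; apply: eq_bigr => a _; rewrite mxE.
Qed.

Lemma policy_gt0 pi s a : policies_pos pi -> 0 < pi s a.
Proof. by move=> h; have [_ +] := h s; move=> /(_ a); rewrite mxE. Qed.

Lemma policy_clip_ge (alpha : R) pi s a : policies_clip alpha pi -> alpha <= pi s a.
Proof. by move=> h; have [_ +] := h s; move=> /(_ a); rewrite mxE. Qed.

Lemma trans_ge0 s a s' : 0 <= trans M s a 0 s'.
Proof. by have [+ _] := trans_simplex M s a; exact. Qed.

Lemma trans_sum1 s a : \sum_s' trans M s a 0 s' = 1.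
Proof. by have [] := trans_simplex M s a. Qed.

Lemma chain_stoch pi : policies pi -> stoch (chain_of M pi).
Proof.
move=> polpi; split=> [s s'|s].
  rewrite mxE; apply: sumr_ge0 => a _; apply: mulr_ge0; last exact: trans_ge0.
  exact: policy_ge0.
under eq_bigr do rewrite mxE.
rewrite exchange_big -(policy_sum1 s polpi); apply: eq_bigr => a _.
by rewrite -mulr_sumr trans_sum1 mulr1.
Qed.

Definition mdp_edge : rel 'I_nS := fun s s' => [exists a, 0 < trans M s a 0 s'].

Lemma chain_gt0 pi s s' : policies_pos pi ->
  (0 < chain_of M pi s s') = mdp_edge s s'.
Proof.
move=> pos; have pol := policies_posW pos.
apply/idP/existsP => [|[a ha]]; rewrite mxE.
  move=> h; apply: contrapT => /forallNP na; move: h; rewrite ltNge => /negP; apply.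
  apply: sumr_le0 => a _; apply: mulr_ge0_le0; first exact: policy_ge0.
  by rewrite leNgt; apply/negP; exact: na.
rewrite (bigD1 a) //=; apply: ltr_wpDr; last by apply: mulr_gt0; rewrite ?policy_gt0.
by apply: sumr_ge0 => x _; apply: mulr_ge0; [exact: policy_ge0|exact: trans_ge0].
Qed.

Lemma accessible_connect pi s s' : policies_pos pi ->
  accessible (chain_of M pi) s s' <-> connect mdp_edge s s'.
Proof.
move=> pos; have stP := chain_stoch (policies_posW pos); split=> [acc|].
  apply: (@closed_class_acc _ _ _ stP (connect mdp_edge s) s s') acc => //.
  move=> x y; rewrite /in_mem /= => sx xy; apply: connect_trans sx _.
  by apply: connect1; rewrite -(chain_gt0 _ _ pos).
move/connectP => [p pth ->] {s'}.
elim: p s pth => [|y p IH] s /=; first by move=> _; exact: accessible_refl.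
move=> /andP[sy /IH h]; apply: (accessible_trans stP _ h).
by apply: accessible1; rewrite chain_gt0.
Qed.

Section Recurrent.
Variable pi0 : 'M[R]_(nS, nA).
Hypothesis pos0 : policies_pos pi0.

(** The edges of the chain of a policy of full support are those of the process, so
    recurrence is a property of [mdp_edge]. The policy pi0 excludes the case where
    the definition of [rec_state] quantifies over an empty set. *)
Lemma rec_stateP s :
  rec_state M s <-> (forall s', connect mdp_edge s s' -> connect mdp_edge s' s).
Proof.
split=> [/asboolP/(_ pi0 pos0)|h].
  have stP := chain_stoch (policies_posW pos0).
  move=> /(recurrentP stP) h s' /(accessible_connect _ _ pos0) /h.
  by move/(accessible_connect _ _ pos0).
apply/asboolP => pi pos; apply/(recurrentP (chain_stoch (policies_posW pos))) => s'.
by move=> /(accessible_connect _ _ pos) /h /(accessible_connect _ _ pos).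
Qed.

Lemma rec_state_connect s s' : rec_state M s -> connect mdp_edge s s' -> rec_state M s'.
Proof.
move=> /rec_stateP h ss'; apply/rec_stateP => x s'x.
by apply: connect_trans (h _ (connect_trans ss' s'x)) _.
Qed.

Lemma rec_state_edge s s' : rec_state M s -> mdp_edge s s' -> rec_state M s'.
Proof. by move=> rs e; apply: rec_state_connect rs (connect1 e). Qed.

(** A state that leads to as few states as possible is recurrent. *)
Lemma reach_rec_state s : exists2 s', connect mdp_edge s s' & rec_state M s'.
Proof.
have [m [sm mmin]] : exists m, connect mdp_edge s m /\ forall x, connect mdp_edge s x ->
    (#|connect mdp_edge m| <= #|connect mdp_edge x|)%N.
  case: (@arg_minnP _ s (connect mdp_edge s) (fun x => #|connect mdp_edge x|)) => [|m sm h].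
    exact: connect0.
  by exists m.
exists m => //; apply/rec_stateP => x mx.
have sub : connect mdp_edge x \subset connect mdp_edge m.
  by apply/fintype.subsetP => y; rewrite !unfold_in; exact: connect_trans.
have le : #|connect mdp_edge x| = #|connect mdp_edge m|.
  by apply/eqP; rewrite eqn_leq (subset_leq_card sub) mmin // (connect_trans sm mx).
by have /(_ m) := subset_cardP le sub; rewrite -!topredE /= connect0.
Qed.

End Recurrent.
End Classification.

Section PathSums.
Context {R : realType} {nS nA : nat} (M : mdp R nS nA) (pi : 'M[R]_(nS, nA)).
Hypothesis polpi : policies pi.
Implicit Types (x y : 'I_nS * 'I_nA) (q g : 'M[R]_(nS, nA)) (u : 'cV[R]_nS).
Let P := chain_of M pi.
Let stP : stoch P. Proof. exact: chain_stoch. Qed.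

Lemma sum_tupleS (T : finType) n (F : seq T -> R) :
  \sum_(w : n.+1.-tuple T) F w = \sum_y \sum_(w : n.-tuple T) F (y :: w).
Proof.
rewrite pair_big /= (reindex (fun p : T * n.-tuple T => [tuple of p.1 :: p.2])) //=.
exists (fun t : n.+1.-tuple T => (thead t, [tuple of behead t])) => [[a t] _|t _] /=.
  by rewrite theadE; congr pair; apply: val_inj.
by rewrite [RHS]tuple_eta; apply: val_inj.
Qed.

Definition act_mean q : 'cV[R]_nS := \col_s \sum_a pi s a * q s a.

Lemma act_meanB q g : act_mean (q - g) = act_mean q - act_mean g.
Proof.
apply/colP => s; rewrite !mxE -sumrB; apply: eq_bigr => a _.
by rewrite !mxE mulrBr.
Qed.

Lemma act_meanD q g : act_mean (q + g) = act_mean q + act_mean g.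
Proof.
apply/colP => s; rewrite !mxE -big_split; apply: eq_bigr => a _.
by rewrite !mxE mulrDr.
Qed.

Lemma act_mean_le q s b : (forall a, `|q s a| <= b) -> `|act_mean q s 0| <= b.
Proof.
move=> qb; rewrite mxE; apply: le_trans (ler_norm_sum _ _ _) _.
rewrite -[b]mul1r -(policy_sum1 s polpi) mulr_suml; apply: ler_sum => a _.
by rewrite normrM ger0_norm ?policy_ge0 // ler_wpM2l // policy_ge0.
Qed.

Lemma apply_transD u v : apply_trans M (u + v) = apply_trans M u + apply_trans M v.
Proof.
apply/matrixP => s a; rewrite !mxE -big_split; apply: eq_bigr => s' _.
by rewrite mxE mulrDr.
Qed.

Lemma apply_transB u v : apply_trans M (u - v) = apply_trans M u - apply_trans M v.
Proof.
apply/matrixP => s a; rewrite !mxE -sumrB; apply: eq_bigr => s' _.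
by rewrite !mxE mulrBr.
Qed.

Lemma apply_trans0 : apply_trans M 0 = 0.
Proof. by apply/matrixP => s a; rewrite !mxE big1 // => x _; rewrite mxE mulr0. Qed.

Lemma act_mean_apply u : act_mean (apply_trans M u) = P *m u.
Proof.
apply/colP => s; rewrite !mxE; under eq_bigr do rewrite mxE mulr_sumr.
rewrite exchange_big; apply: eq_bigr => s' _; rewrite mxE mulr_suml.
by apply: eq_bigr => a _; rewrite mulrA.
Qed.

Lemma sum_next x (q : 'I_nS * 'I_nA -> R) :
  \sum_y trans M x.1 x.2 0 y.1 * pi y.1 y.2 * q y =
  apply_trans M (act_mean (\matrix_(s, a) q (s, a))) x.1 x.2.
Proof.
rewrite mxE; under [RHS]eq_bigr do rewrite mxE mulr_sumr.
rewrite pair_big /=; apply: eq_bigr => -[s a] _ /=.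
by rewrite mxE mulrA.
Qed.

Lemma path_prob_ge0 x w : 0 <= path_prob M pi x w.
Proof.
elim: w x => [|y w IH] x //=; apply: mulr_ge0 => //; apply: mulr_ge0.
  exact: trans_ge0.
exact: policy_ge0.
Qed.

Lemma sum_pathS H x (F : seq ('I_nS * 'I_nA) -> R) :
  \sum_(w : H.+1.-tuple _) path_prob M pi x w * F w =
  \sum_y trans M x.1 x.2 0 y.1 * pi y.1 y.2 *
    \sum_(w : H.-tuple _) path_prob M pi y w * F (y :: w).
Proof.
rewrite (sum_tupleS H (fun w => path_prob M pi x w * F w)); apply: eq_bigr => y _.
by rewrite mulr_sumr; apply: eq_bigr => w _ /=; rewrite mulrA.
Qed.

Lemma sum_path0 x (F : seq ('I_nS * 'I_nA) -> R) :
  \sum_(w : 0.-tuple _) path_prob M pi x w * F w = F [::].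
Proof.
rewrite (eq_bigr (fun=> F [::])); last by move=> w _; rewrite tuple0 mul1r.
by rewrite sumr_const card_tuple expn0.
Qed.

Lemma sum_path1 H x : \sum_(w : H.-tuple _) path_prob M pi x w = 1.
Proof.
transitivity (\sum_(w : H.-tuple _) path_prob M pi x w * 1).
  by apply: eq_bigr => w _; rewrite mulr1.
elim: H x => [|H IH] x; first exact: (sum_path0 x (fun=> 1)).
rewrite (sum_pathS H x (fun=> 1)); under eq_bigr do rewrite IH.
rewrite (sum_next x (fun=> 1)) mxE -[RHS](trans_sum1 M x.1 x.2).
apply: eq_bigr => s _; rewrite mxE; under eq_bigr do rewrite mxE mulr1.
by rewrite policy_sum1 // mulr1.
Qed.

(** The partial sums in the estimate of Q all read the same trajectory; this gives
    each of them its own law. *)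
Lemma sum_path_take H h x (F : seq ('I_nS * 'I_nA) -> R) : (h <= H)%N ->
  \sum_(w : H.-tuple _) path_prob M pi x w * F (take h w) =
  \sum_(w : h.-tuple _) path_prob M pi x w * F w.
Proof.
elim: H h x F => [|H IH] [|h] x F // hH.
- by rewrite (sum_path0 x (fun w => F (take 0 w))) sum_path0.
- rewrite sum_path0 -[RHS]mul1r -(sum_path1 H.+1 x) mulr_suml.
  by apply: eq_bigr => w _; rewrite take0.
- rewrite (sum_pathS H x (fun w => F (take h.+1 w))) sum_pathS.
  apply: eq_bigr => y _; congr (_ * _).
  by rewrite -(IH h y (fun w => F (y :: w))).
Qed.

Definition path_sum g H x : R :=
  \sum_(w : H.-tuple _) path_prob M pi x w * \sum_(y <- x :: w) g y.1 y.2.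

Lemma path_sumE g H x :
  path_sum g H x = g x.1 x.2 + \sum_(i < H) apply_trans M (P ^+ i *m act_mean g) x.1 x.2.
Proof.
elim: H x => [|H IH] x.
  by rewrite /path_sum (sum_path0 x (fun w => \sum_(y <- x :: w) g y.1 y.2)) big_ord0 big_seq1 addr0.
rewrite /path_sum.
transitivity (g x.1 x.2 * \sum_(w : H.+1.-tuple _) path_prob M pi x w +
   \sum_(w : H.+1.-tuple _) path_prob M pi x w * \sum_(y <- w) g y.1 y.2).
  rewrite mulr_sumr -big_split; apply: eq_bigr => w _.
  by rewrite big_cons mulrDr [g _ _ * _]mulrC.
rewrite sum_path1 mulr1 (sum_pathS H x (fun w => \sum_(y <- w) g y.1 y.2)).
congr (_ + _); under eq_bigr => y _ do rewrite -/(path_sum g H y) IH.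
rewrite (sum_next x (fun y => g y.1 y.2 + \sum_(i < H) apply_trans M (P ^+ i *m act_mean g) y.1 y.2)).
have -> : \matrix_(s, a) (g s a + \sum_(i < H) apply_trans M (P ^+ i *m act_mean g) s a) =
   g + \sum_(i < H) apply_trans M (P ^+ i *m act_mean g).
  by apply/matrixP => s a; rewrite !mxE summxE.
rewrite act_meanD; have -> : act_mean (\sum_(i < H) apply_trans M (P ^+ i *m act_mean g))
    = \sum_(i < H) P ^+ i.+1 *m act_mean g.
  elim: H {IH} => [|H IH].
    by rewrite !big_ord0; apply/colP => s; rewrite !mxE big1 // => a _; rewrite mxE mulr0.
  by rewrite !big_ord_recr /= act_meanD IH act_mean_apply mulmxA -expSm.
rewrite big_ord_recl expr0 mul1mx /= apply_transD mxE; congr (_ + _).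
elim: H {IH} => [|H IH]; first by rewrite !big_ord0 apply_trans0 mxE.
by rewrite !big_ord_recr /= apply_transD mxE IH.
Qed.

Lemma expected_returnE H s :
  expected_return M pi H s = \sum_(i < H) (P ^+ i *m rew_of M pi) s 0.
Proof.
rewrite /expected_return; case: H => [|H].
  by rewrite big_ord0 big1 // => w _; rewrite tuple0 /total_reward /= big_nil mulr0.
rewrite (sum_tupleS H (fun w => start_prob M pi s w * total_reward M w)).
under eq_bigr => y _ do under eq_bigr => w _ do rewrite /= -mulrA.
under eq_bigr => y _ do rewrite -mulr_sumr -/(path_sum (reward M) H y).
transitivity (\sum_s' \sum_a (s' == s)%:R * pi s' a * path_sum (reward M) H (s', a)).
  by rewrite pair_big /=; apply: eq_bigr => -[? ?].
rewrite (bigD1 s) //= [X in _ + X]big1 ?addr0; last first.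
  by move=> s' /negPf ss'; rewrite big1 // => a _; rewrite ss' !mul0r.
under eq_bigr do rewrite eqxx mul1r path_sumE /= mulrDr.
rewrite big_split big_ord_recl /= expr0 mul1mx mxE; congr (_ + _).
under eq_bigr do rewrite mulr_sumr.
rewrite exchange_big; apply: eq_bigr => i _.
rewrite /bump /= add1n expSm -mulmxA.
by rewrite -[in RHS]act_mean_apply [RHS]mxE.
Qed.

(** The expected averages converge, so their inferior limit is their limit. *)
Lemma avg_rewardE : avg_reward M pi = chain_lim M pi *m rew_of M pi.
Proof.
apply/colP => s; rewrite mxE.
have c : (fun H => H%:R^-1 * expected_return M pi H s) @ \oo -->
    (chain_lim M pi *m rew_of M pi) s 0.
  have -> : (fun H => H%:R^-1 * expected_return M pi H s) =
            (fun H => (avg_mx P H *m rew_of M pi) s 0).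
    apply/funext => H; rewrite expected_returnE -scalemxAl mulmx_suml mxE summxE.
    by [].
  exact: (mx_cvg_mulr _ (avg_mx_cvg stP)).
by rewrite (cvg_limn_inf_sup c).
Qed.

Lemma avg_reward_fix : P *m avg_reward M pi = avg_reward M pi.
Proof. by rewrite avg_rewardE mulmxA cesaro_mull. Qed.

Lemma bias_poisson :
  bias M pi - P *m bias M pi = rew_of M pi - avg_reward M pi.
Proof. by rewrite avg_rewardE; exact: poisson_solution. Qed.

Lemma act_mean_Q : act_mean (Q_of M pi) = bias M pi.
Proof.
rewrite /Q_of act_meanB act_meanD !act_mean_apply avg_reward_fix.
have -> : act_mean (reward M) = rew_of M pi by [].
by apply/eqP; rewrite addrAC -bias_poisson subrK.
Qed.

Lemma mx_entry_le m n (A : 'M[R]_(m, n)) i j : `|A i j| <= `|A|.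
Proof. by rewrite [X in _ <= X]mx_normrE (bigD1 (i, j)) //= le_max lexx. Qed.

(** The bias is the average of Q over the actions. *)
Lemma bias_le s : `|bias M pi s 0| <= `|Q_of M pi|.
Proof. by rewrite -act_mean_Q; apply: act_mean_le => a; exact: mx_entry_le. Qed.

End PathSums.

Section PerformanceDifference.
Context {R : realType} {nS nA : nat} (M : mdp R nS nA).
Implicit Types (pi : 'M[R]_(nS, nA)) (mu : 'rV[R]_nS).

(** The function that the critic estimates. *)
Definition mixed_value pi : 'M[R]_(nS, nA) :=
  \matrix_(s, a) (if rec_state M s then Q_of M pi s a else K_of M pi s a).

Lemma rec_class_facts pi s : policies_pos pi -> rec_state M s ->
  forall s', accessible (chain_of M pi) s s' -> accessible (chain_of M pi) s' s.
Proof.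
by move=> pos /asboolP/(_ pi pos)/(recurrentP (chain_stoch M (policies_posW pos))).
Qed.

Lemma avg_reward_connect pi s s' : policies_pos pi -> rec_state M s ->
  connect (mdp_edge M) s s' -> avg_reward M pi s' 0 = avg_reward M pi s 0.
Proof.
move=> pos rs ss'; have pol := policies_posW pos.
have stP := chain_stoch M pol.
have rec := rec_class_facts pos rs.
have clC := comm_class_closed stP rec.
apply: (harmonic_const stP clC).
- by move=> x y; exact: comm_class_irr.
- by move=> x _; rewrite -{1}(avg_reward_fix M pol) mxE.
- have acc := (accessible_connect M s s' pos).2 ss'.
  by apply/asboolP; split=> //; exact: rec.
- exact: comm_class_refl.
Qed.

(** The transient part of a row of P_star is invariant under the chain killed
    outside the transient states, whose powers tend to 0. *)
Lemma chain_lim_transient pi s0 s : policies_pos pi -> ~~ rec_state M s ->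
  chain_lim M pi s0 s = 0.
Proof.
move=> pos nrs; have stP := chain_stoch M (policies_posW pos).
pose D : pred 'I_nS := fun s => ~~ rec_state M s.
pose x : 'rV[R]_nS := \row_s' (if D s' then chain_lim M pi s0 s' else 0).
suff : x = 0 by move/rowP/(_ s); rewrite !mxE /D nrs.
have subA := restrict_substoch stP D.
apply: (leaky_fix subA).
  apply: restrict_mass_cvg0 => // s1 _.
  have [s' ss' rs'] := reach_rec_state M pos s1.
  by exists s'; [rewrite /D rs'|apply/(accessible_connect M _ _ pos)].
apply/rowP => j; rewrite [LHS]mxE [RHS]mxE; case: ifP => [Dj|nDj]; last first.
  by rewrite big1 // => i _; rewrite [restrict_mx _ _ _ _]mxE nDj andbF mulr0.
rewrite /chain_lim -{1}(cesaro_mulr stP) mxE; apply: eq_bigr => i _.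
rewrite [x 0 i]mxE [restrict_mx _ _ _ _]mxE Dj andbT; case: ifP => // nDi.
rewrite mul0r; suff -> : chain_of M pi i j = 0 by rewrite mulr0.
apply/eqP; rewrite eq_le (proj1 stP) andbT leNgt chain_gt0 //.
apply/negP => e; move: Dj; rewrite /D (rec_state_edge pos _ e) //.
exact/negPn/negbT.
Qed.

Lemma trans_blockE pi :
  trans_block M pi = restrict_mx (chain_of M pi) (fun s => ~~ rec_state M s).
Proof. by []. Qed.

Lemma trans_block_mass_cvg0 pi : policies_pos pi ->
  forall s, mass (trans_block M pi) k s 0 @[k --> \oo] --> (0 : R).
Proof.
move=> pos; rewrite trans_blockE.
apply: restrict_mass_cvg0; first exact/chain_stoch/policies_posW.
move=> s _; have [s' ss' rs'] := reach_rec_state M pos s.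
by exists s'; [rewrite rs'|apply/(accessible_connect M _ _ pos)].
Qed.

Lemma trans_block_substoch pi : policies pi -> substoch (trans_block M pi).
Proof. by move=> pol; apply: restrict_substoch; exact: chain_stoch. Qed.

Lemma transient_visitE mu pi : policies_pos pi ->
  transient_visit M mu pi = mu + transient_visit M mu pi *m trans_block M pi.
Proof.
move=> pos; have U := leaky_unit (trans_block_substoch (policies_posW pos))
                        (trans_block_mass_cvg0 pos).
have E : transient_visit M mu pi *m (1%:M - trans_block M pi) = mu.
  by rewrite /transient_visit mulmxKV.
by apply/eqP; rewrite -subr_eq -[X in X - _]mulmx1 -mulmxBr E.
Qed.

(** Let D = J - L' J, where L' is the Cesaro limit of the new policy.  It vanishes
    on recurrent states, where J is constant on classes; and P' J - J = P' D - D,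
    so the transient part of the sum is - mu D, and the discrepancy mu L' J cancels
    against the one left by the recurrent part. *)
Lemma performance_difference mu pi pi' : policies_pos pi -> policies_pos pi' ->
  \sum_s visit M mu pi' 0 s *
    \sum_a mixed_value pi s a * (pi' s a - pi s a) =
  avg_reward_mu M mu pi' - avg_reward_mu M mu pi.
Proof.
move=> pos pos'; have pol := policies_posW pos; have pol' := policies_posW pos'.
have stP' := chain_stoch M pol'.
set P' := chain_of M pi' in stP' *; set L' := chain_lim M pi'.
set J := avg_reward M pi; set V := bias M pi; set r' := rew_of M pi'.
have adv s : \sum_a mixed_value pi s a * (pi' s a - pi s a) =
   if rec_state M s then (r' + P' *m V - P' *m J - V) s 0 else (P' *m J - J) s 0.
  have -> : \sum_a mixed_value pi s a * (pi' s a - pi s a) =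
     act_mean pi' (mixed_value pi) s 0 - act_mean pi (mixed_value pi) s 0.
    by rewrite [act_mean pi' _ _ _]mxE [act_mean pi _ _ _]mxE -sumrB; apply: eq_bigr => a _; ring.
  have E p : act_mean p (mixed_value pi) s 0 = (if rec_state M s
      then act_mean p (Q_of M pi) s 0 else act_mean p (K_of M pi) s 0).
    by rewrite mxE; case: ifP => rs; rewrite mxE; apply: eq_bigr => a _; rewrite mxE rs.
  rewrite !E; case: ifP => rs.
    rewrite (act_mean_Q M pol) /Q_of act_meanB act_meanD !act_mean_apply.
    by rewrite [RHS]subMxE.
  by rewrite !act_mean_apply (avg_reward_fix M pol) [RHS]subMxE.
under eq_bigr do rewrite adv.
pose d := mu *m L'; pose y := transient_visit M mu pi'.
have d0 s : ~~ rec_state M s -> d 0 s = 0.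
  by move=> nrs; rewrite mxE big1 // => i _; rewrite chain_lim_transient ?mulr0.
have recpart : \sum_(s | rec_state M s) visit M mu pi' 0 s *
    (r' + P' *m V - P' *m J - V) s 0 = (mu *m avg_reward M pi') 0 0 - (d *m J) 0 0.
  transitivity ((d *m (r' + P' *m V - P' *m J - V)) 0 0).
    rewrite [RHS]mxE [RHS](bigID (rec_state M)) /= [X in _ = _ + X]big1 ?addr0.
      by apply: eq_bigr => s rs; rewrite [visit _ _ _ _ _]mxE rs.
    by move=> s nrs; rewrite d0 // mul0r.
  have dP : d *m P' = d by rewrite /d -mulmxA cesaro_mulr.
  rewrite !(mulmxBr, mulmxDr) !mulmxA dP -[RHS]subMxE; congr (fun_of_matrix _ 0 0).
  by rewrite (avg_rewardE M pol') mulmxA -/d addrAC addrK.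
pose D := J - L' *m J.
have D0 s : rec_state M s -> D s 0 = 0.
  move=> rs; rewrite subMxE [(L' *m J) s 0]mxE; apply/eqP; rewrite subr_eq0; apply/eqP.
  have [L0 L1] := cesaro_stoch stP'.
  rewrite -[LHS]mul1r -(L1 s) mulr_suml; apply: eq_bigr => s' _.
  have [acc|nacc] := pselect (accessible P' s s').
    by congr (_ * _); rewrite -(avg_reward_connect (s' := s') pos rs) //; apply/(accessible_connect M _ _ pos').
  by rewrite /L' /chain_lim (cesaro_accessible stP' nacc) !mul0r.
have PD : P' *m J - J = P' *m D - D.
  by rewrite /D mulmxBr mulmxA (cesaro_mull stP') opprB addrA subrK.
have trpart : \sum_(s | ~~ rec_state M s) visit M mu pi' 0 s * (P' *m J - J) s 0 =
    (d *m J) 0 0 - (mu *m J) 0 0.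
  transitivity ((y *m (trans_block M pi' *m D - D)) 0 0).
    rewrite [RHS]mxE [RHS](bigID (rec_state M)) /= [X in _ = X + _]big1 ?add0r.
      apply: eq_bigr => s nrs; rewrite [visit _ _ _ _ _]mxE (negPf nrs) PD.
      congr (_ * _); rewrite !subMxE; congr (_ - _).
      rewrite [LHS]mxE [RHS]mxE; apply: eq_bigr => s' _.
      rewrite [trans_block _ _ _ _]mxE nrs /=; case: ifP => // /negbFE rs'.
      by rewrite D0 // !mulr0.
    move=> s rs; rewrite subMxE (D0 _ rs) subr0 [X in _ * X]mxE big1 ?mulr0 // => i _.
    by rewrite mxE rs mul0r.
  have E : y = mu + y *m trans_block M pi' by exact: transient_visitE.
  rewrite mulmxBr mulmxA {2}E mulmxDl opprD addrC addrNK.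
  by rewrite -mulmxN /D opprB mulmxBr mulmxA subMxE.
rewrite (bigID (rec_state M)) /=.
rewrite (eq_bigr (fun s => visit M mu pi' 0 s * (r' + P' *m V - P' *m J - V) s 0)); last first.
  by move=> s ->.
rewrite recpart (eq_bigr (fun s => visit M mu pi' 0 s * (P' *m J - J) s 0)); last first.
  by move=> s /negPf ->.
rewrite trpart addrA subrK.
by rewrite !mxE.
Qed.

End PerformanceDifference.

(** * Bounds on the visitation measures *)

Section VisitationBounds.
Context {R : realType} {nS nA : nat} (M : mdp R nS nA).
Variables (mu : 'rV[R]_nS) (alpha : R) (pi0 : 'M[R]_(nS, nA)).
Hypothesis alpha_gt0 : 0 < alpha.
Hypothesis mu_pos : simplex_pos mu.
Hypothesis clip0 : policies_clip alpha pi0.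
Implicit Types (pi : 'M[R]_(nS, nA)).

Let pos pi (h : policies_clip alpha pi) : policies_pos pi := policies_clipW alpha_gt0 h.
Let pol pi (h : policies_clip alpha pi) : policies pi := policies_posW (pos h).

Let mu0 s : 0 < mu 0 s. Proof. by case: mu_pos. Qed.
Let mu1 : \sum_s mu 0 s = 1. Proof. by case: mu_pos => -[]. Qed.

Lemma policy_le1 pi s a : policies pi -> pi s a <= 1.
Proof.
move=> p; rewrite -(policy_sum1 s p) (bigD1 a) //= lerDl.
by apply: sumr_ge0 => x _; exact: policy_ge0.
Qed.

(** Any clipped policy plays each action at least alpha times as often as pi0,
    which makes the bounds below uniform without a compactness argument. *)
Lemma chain_clip_ge pi s s' : policies_clip alpha pi ->
  alpha * chain_of M pi0 s s' <= chain_of M pi s s'.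
Proof.
move=> h; rewrite !mxE mulr_sumr; apply: ler_sum => a _; rewrite mulrA.
apply: ler_wpM2r; first exact: trans_ge0.
apply: le_trans (policy_clip_ge s a h).
by rewrite ler_piMr ?(ltW alpha_gt0) // policy_le1 //; exact: pol.
Qed.

Lemma chain_clip_exp_ge pi k s s' : policies_clip alpha pi ->
  alpha ^+ k * (chain_of M pi0 ^+ k) s s' <= (chain_of M pi ^+ k) s s'.
Proof.
move=> h; have P0 := proj1 (chain_stoch M (pol clip0)).
elim: k s => [|k IH] s; first by rewrite !expr0 mul1r.
rewrite !expSm !mxE mulr_sumr; apply: ler_sum => x _.
rewrite exprS mulrACA; apply: ler_pM.
- by rewrite mulr_ge0 ?(ltW alpha_gt0).
- by rewrite mulr_ge0 ?exprn_ge0 ?(ltW alpha_gt0) //; apply: nonneg_exp.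
- exact: chain_clip_ge.
- exact: IH.
Qed.

Lemma finite_positive_lb (T : finType) (f : T -> R) :
  (forall x, 0 < f x) -> exists2 m, 0 < m & forall x, m <= f x.
Proof.
move=> f0; exists (\big[Num.min/1]_x f x).
  by elim/big_ind: _ => // x y x0 y0; rewrite lt_min x0.
by move=> x; rewrite (bigD1 x) //= ge_min lexx.
Qed.

(** Some P_star(s, s') is at least 1/|S|. As s' leads back to s, the identity P_star
    P^k = P_star transports this bound to P_star(s, s), with a loss controlled by
    [chain_clip_exp_ge]. *)
Lemma recurrent_visit_lb : exists2 b : R, 0 < b &
  forall pi, policies_clip alpha pi -> forall s, rec_state M s ->
    b <= recurrent_visit M mu pi 0 s.
Proof.
have pos0 := pos clip0.
have [c c0 cP] : exists2 c : R, 0 < c & forall s s', connect (mdp_edge M) s s' ->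
    exists k, c <= alpha ^+ k * (chain_of M pi0 ^+ k) s s'.
  have H (p : 'I_nS * 'I_nS) : exists m : R, 0 < m /\
     (connect (mdp_edge M) p.1 p.2 -> exists k, m <= alpha ^+ k * (chain_of M pi0 ^+ k) p.1 p.2).
    have [co|nco] := boolP (connect (mdp_edge M) p.1 p.2); last by exists 1; split.
    have [k hk] := (accessible_connect M _ _ pos0).2 co.
    exists (alpha ^+ k * (chain_of M pi0 ^+ k) p.1 p.2); split; last by exists k.
    by rewrite mulr_gt0 // exprn_gt0.
  have [f fP] := choice H.
  have [m m0 mf] := finite_positive_lb (fun p => (fP p).1).
  exists m => // s s' /(fP (s, s')).2[k hk]; exists k.
  exact: le_trans (mf _) hk.
have [m m0 mP] := finite_positive_lb mu0.
exists (m * (nS%:R^-1 * c)) => [|pi clip s rs].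
  have : exists s : 'I_nS, True.
    apply: contrapT => /forallNP n; have := mu1; rewrite big1 => [/eqP|i]; last by have := n i.
    by rewrite eq_sym oner_eq0.
  move=> [s _]; rewrite !mulr_gt0 // invr_gt0 ltr0n.
  exact: leq_ltn_trans (ltn_ord s).
have stP := chain_stoch M (pol clip).
have [L0 L1] := cesaro_stoch stP.
have [s' hs'] : exists s', nS%:R^-1 <= chain_lim M pi s s'.
  apply: contrapT => /forallNP n.
  have : \sum_s' chain_lim M pi s s' < \sum_(s' < nS) nS%:R^-1.
    apply: ltr_sum; last by move=> x _; rewrite ltNge; apply/negP; exact: n.
    by apply/hasP; exists s; rewrite ?mem_index_enum.
  rewrite (L1 s) sumr_const card_ord -[_ *+ _]mulr_natr mulVf ?ltxx //.
  by rewrite pnatr_eq0 -lt0n; exact: leq_ltn_trans (ltn_ord s).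
have n0 : 0 < nS%:R^-1 :> R.
  by rewrite invr_gt0 ltr0n; exact: leq_ltn_trans (ltn_ord s).
have ss' : connect (mdp_edge M) s s'.
  apply/(accessible_connect M _ _ (pos clip)); apply: contrapT => na.
  by move: hs'; rewrite leNgt /chain_lim (cesaro_accessible stP na) n0.
have s's : connect (mdp_edge M) s' s.
  by have /rec_stateP := rs; apply => //; exact: (pos clip).
have [k hk] := cP _ _ s's.
have Lss : nS%:R^-1 * c <= chain_lim M pi s s.
  rewrite {1}/chain_lim -(cesaro_expr stP k) mxE (bigD1 s') //=; apply: ler_wpDr.
    by apply: sumr_ge0 => x _; apply: mulr_ge0 => //; apply: nonneg_exp; case: stP.
  apply: ler_pM => //; first exact: ltW.
  exact: le_trans hk (chain_clip_exp_ge _ _ _ clip).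
rewrite mxE (bigD1 s) //=; apply: ler_wpDr.
  by apply: sumr_ge0 => x _; apply: mulr_ge0; [exact: ltW|exact: L0].
by apply: ler_pM => //; [exact: ltW|rewrite mulr_ge0 // ltW].
Qed.

Lemma transient_visit_lb pi s : policies_clip alpha pi ->
  mu 0 s <= transient_visit M mu pi 0 s.
Proof.
move=> clip; rewrite (transient_visitE M mu (pos clip)) mxE lerDl.
have subA := trans_block_substoch M (pol clip).
apply: nonneg_mulmx; last by case: subA.
apply: nonneg_mulmx; first by move=> i j; rewrite ord1 ltW.
exact/leaky_inv_ge0/trans_block_mass_cvg0/pos.
Qed.

Lemma alpha_le1 (s : 'I_nS) : alpha <= 1.
Proof.
have [[h1 h2] h3] := clip0 s.
have [a _] : exists a : 'I_nA, True.
  apply: contrapT => /forallNP n; move: h2; rewrite big1 => [/eqP|i]; last by have := n i.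
  by rewrite eq_sym oner_eq0.
apply: le_trans (h3 a) _; rewrite mxE; exact/policy_le1/pol.
Qed.

(** In terms of the probability 1 - mass of having left the transient states, each
    step under pi loses at most a factor alpha with respect to pi0. *)
Lemma trans_block_mass_compare pi k s : policies_clip alpha pi ->
  ~~ rec_state M s ->
  alpha ^+ k * (1 - mass (trans_block M pi0) k s 0) <= 1 - mass (trans_block M pi) k s 0.
Proof.
move=> clip; elim: k s => [|k IH] s nrs; first by rewrite !mass0 subrr mulr0.
have a1 := alpha_le1 s.
have E p : policies p -> 1 - mass (trans_block M p) k.+1 s 0 =
    \sum_s' chain_of M p s s' * (if rec_state M s' then 1 else 1 - mass (trans_block M p) k s' 0).
  move=> polp; rewrite massS mxE -{1}(proj2 (chain_stoch M polp) s) -sumrB.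
  apply: eq_bigr => s' _; rewrite [trans_block _ _ _ _]mxE nrs /=.
  by case: (rec_state M s') => /=; rewrite ?mul0r ?subr0 ?mulr1 // mulrBr mulr1.
rewrite (E _ (pol clip0)) (E _ (pol clip)) mulr_sumr; apply: ler_sum => s' _.
have m0 : 0 <= (if rec_state M s' then 1 else 1 - mass (trans_block M pi0) k s' 0).
  case: ifP => // _; rewrite subr_ge0 mass_le1 //; exact/trans_block_substoch/pol.
have P0 := proj1 (chain_stoch M (pol clip0)) s s'.
rewrite exprS mulrACA; apply: ler_pM.
- by rewrite mulr_ge0 ?(ltW alpha_gt0).
- by rewrite mulr_ge0 ?exprn_ge0 ?(ltW alpha_gt0).
- exact: chain_clip_ge.
- case: ifP => [_|/negbT nrs']; last exact: IH.
  by rewrite mulr1 exprn_ile1 ?(ltW alpha_gt0).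
Qed.

(** Under any clipped policy the chain leaves the transient states within n steps
    with probability at least kap. So the largest expected time w spent there
    satisfies w <= n + (1 - kap) w. *)
Lemma transient_visit_ub : exists b : R, forall pi, policies_clip alpha pi ->
  \sum_s transient_visit M mu pi 0 s <= b.
Proof.
have [n nP] : exists n, forall s, mass (trans_block M pi0) n s 0 <= 2^-1.
  have c : (\sum_s mass (trans_block M pi0) n s 0) @[n --> \oo] --> (\sum_(s < nS) 0 : R).
    by apply: cvg_sum_fin => s _; exact: trans_block_mass_cvg0 (pos clip0) s.
  rewrite big1 // in c.
  have [n _ h] : \forall n \near \oo, `|\sum_s mass (trans_block M pi0) n s 0| < 2^-1.
    by apply: cvgr0_norm_lt => //; rewrite invr_gt0.
  exists n => s; have := h n (leqnn n) => /= /ltW; apply: le_trans.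
  have subA := trans_block_substoch M (pol clip0).
  rewrite ger0_norm; last by apply: sumr_ge0 => x _; apply: mass_ge0; case: subA.
  rewrite [X in _ <= X](bigD1 s) //= lerDl.
  by apply: sumr_ge0 => x _; apply: mass_ge0; case: subA.
pose kap := alpha ^+ n / 2.
have kap0 : 0 < kap by rewrite divr_gt0 ?exprn_gt0.
exists ((n.+1%:R + 1) / kap) => pi clip.
have subA := trans_block_substoch M (pol clip).
have massA := trans_block_mass_cvg0 M (pos clip).
set A := trans_block M pi in subA massA *.
pose w : 'cV[R]_nS := invmx (1%:M - A) *m const_mx 1.
have U := leaky_unit subA massA.
have w_fix : w = const_mx 1 + A *m w.
  have : (1%:M - A) *m w = const_mx 1 by rewrite mulKVmx.
  by rewrite mulmxBl mul1mx => <-; rewrite subrK.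
have w0 : nonneg_mx w.
  by apply: nonneg_mulmx; [exact: leaky_inv_ge0|move=> i j; rewrite mxE ler01].
have w_iter k : w = \sum_(i < k) mass A i + A ^+ k *m w.
  elim: k => [|k IH]; first by rewrite big_ord0 add0r expr0 mul1mx.
  have E : A ^+ k *m w = mass A k + A ^+ k.+1 *m w.
    by rewrite expmS -mulmxA -mulmxDr -w_fix.
  by rewrite big_ord_recr /= -addrA -E.
set b := (n.+1%:R + 1) / kap.
suff wle s : w s 0 <= b.
  have -> : \sum_s transient_visit M mu pi 0 s = \sum_s mu 0 s * w s 0.
    transitivity ((transient_visit M mu pi *m const_mx 1 : 'M[R]_1) 0 0).
      by rewrite mxE; apply: eq_bigr => s _; rewrite [const_mx _ _ _]mxE mulr1.
    by rewrite /transient_visit -mulmxA mxE.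
  rewrite -[X in _ <= X]mul1r -mu1 mulr_suml; apply: ler_sum => s _.
  by apply: ler_wpM2l; rewrite ?wle // ltW.
have [m _ lem] := @arg_maxP _ _ 'I_nS s xpredT (fun s => w s 0) isT.
apply: le_trans (lem s isT) _ => {s}.
rewrite /b ler_pdivlMr //.
have wm := w0 m 0.
have k1 : kap <= 1.
  have : alpha ^+ n <= 1 by rewrite exprn_ile1 ?(ltW alpha_gt0) // (alpha_le1 m).
  by rewrite /kap; lra.
have [rs|nrs] := boolP (rec_state M m).
  have -> : w m 0 = 1.
    rewrite w_fix mxE mxE [X in _ + X]mxE big1 ?addr0 // => i _.
    by rewrite [A _ _]mxE rs mul0r.
  by rewrite mul1r (le_trans k1) // lerDr.
have h1 : mass A n m 0 <= 1 - kap.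
  have := trans_block_mass_compare n clip nrs; rewrite -/A => h.
  have h' : alpha ^+ n * 2^-1 <= alpha ^+ n * (1 - mass (trans_block M pi0) n m 0).
    apply: ler_wpM2l; first by rewrite exprn_ge0 ?(ltW alpha_gt0).
    by have := nP m; lra.
  by rewrite /kap; lra.
have h2 : w m 0 <= n%:R + w m 0 * mass A n m 0.
  rewrite {1}(w_iter n) mxE; apply: lerD.
    rewrite summxE; apply: le_trans (ler_sum _ (G := fun=> 1) _) _.
      by move=> i _; exact: mass_le1.
    by rewrite sumr_const card_ord.
  rewrite mxE massE mulr_sumr; apply: ler_sum => j _; rewrite mulrC.
  apply: ler_wpM2r; last exact: lem.
  by apply: nonneg_exp; case: subA.
have h3 := ler_wpM2l wm h1.
rewrite -natr1; nra.
Qed.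

Lemma visit_lb : exists2 b : R, 0 < b &
  forall pi, policies_clip alpha pi -> forall s, b <= visit M mu pi 0 s.
Proof.
have [b b0 bP] := recurrent_visit_lb; have [m m0 mP] := finite_positive_lb mu0.
exists (Num.min b m) => [|pi clip s]; first by rewrite lt_min b0.
rewrite mxE ge_min; case: ifP => rs; first by rewrite bP.
by rewrite (le_trans (mP s)) ?orbT //; exact: transient_visit_lb.
Qed.

Lemma visit_gt0 pi s : policies_clip alpha pi -> 0 < visit M mu pi 0 s.
Proof. by have [b b0 bP] := visit_lb => clip; exact: lt_le_trans b0 (bP _ clip s). Qed.

Lemma sum_recurrent_visit pi : policies_clip alpha pi ->
  \sum_s recurrent_visit M mu pi 0 s = 1.
Proof.
move=> clip; have [L0 L1] := cesaro_stoch (chain_stoch M (pol clip)).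
under eq_bigr do rewrite mxE.
rewrite exchange_big /= -[RHS]mu1; apply: eq_bigr => s _.
by rewrite -mulr_sumr L1 mulr1.
Qed.

Lemma recurrent_visit_ge0 pi s : policies_clip alpha pi ->
  0 <= recurrent_visit M mu pi 0 s.
Proof.
move=> clip; have [L0 L1] := cesaro_stoch (chain_stoch M (pol clip)).
by apply: nonneg_mulmx => // i j; rewrite ord1 ltW.
Qed.

Lemma transient_visit_ge0 pi s : policies_clip alpha pi ->
  0 <= transient_visit M mu pi 0 s.
Proof. by move=> clip; apply: le_trans (ltW (mu0 s)) (transient_visit_lb _ clip). Qed.

Lemma sum_visit_ub : exists b : R, forall pi, policies_clip alpha pi ->
  \sum_s visit M mu pi 0 s <= b.
Proof.
have [b bP] := transient_visit_ub; exists (1 + b) => pi clip.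
apply: le_trans (lerD (lexx _) (bP _ clip)); rewrite -(sum_recurrent_visit clip).
rewrite -big_split; apply: ler_sum => s _ /=; rewrite [visit _ _ _ _ _]mxE.
by case: ifP => _; rewrite ?lerDl ?lerDr ?transient_visit_ge0 ?recurrent_visit_ge0.
Qed.

Lemma visit_le_B pi : policies_clip alpha pi ->
  \sum_s visit M mu pi 0 s <= B_alpha M mu alpha.
Proof.
move=> clip; have [b bP] := sum_visit_ub.
have abs p : policies_clip alpha p -> \sum_s `|visit M mu p 0 s| = \sum_s visit M mu p 0 s.
  by move=> cp; apply: eq_bigr => s _; rewrite gtr0_norm // visit_gt0.
rewrite -abs //; apply: ub_le_sup; last by exists pi.
by exists b => _ [p cp <-]; rewrite abs // bP.
Qed.

Lemma B_alpha_ge1 : 1 <= B_alpha M mu alpha.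
Proof.
apply: le_trans (visit_le_B clip0); rewrite -(sum_recurrent_visit clip0).
apply: ler_sum => s _; rewrite [visit _ _ _ _ _]mxE; case: ifP => // /negbT nrs.
rewrite mxE big1 ?transient_visit_ge0 // => i _.
by rewrite (chain_lim_transient _ (pos clip0)) // mulr0.
Qed.

Lemma visit_ratio_ub pi pi' s : policies_clip alpha pi -> policies_clip alpha pi' ->
  visit M mu pi 0 s / visit M mu pi' 0 s <= C_alpha M mu alpha.
Proof.
move=> cp cp'; apply: ub_le_sup; last by exists s, pi, pi'.
have [c c0 cP] := visit_lb; have [b bP] := sum_visit_ub.
exists (b / c) => _ [x [p [p' [clp clp' ->]]]].
apply: ler_pM; rewrite ?invr_ge0 ?(ltW (visit_gt0 _ _)) //.
  apply: le_trans (bP _ clp); rewrite (bigD1 x) //= lerDl.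
  by apply: sumr_ge0 => y _; rewrite ltW // visit_gt0.
by rewrite lef_pV2 ?posrE ?visit_gt0 // cP.
Qed.

Lemma visit_le_C pi pi' s : policies_clip alpha pi -> policies_clip alpha pi' ->
  visit M mu pi 0 s <= C_alpha M mu alpha * visit M mu pi' 0 s.
Proof.
by move=> cp cp'; rewrite -ler_pdivrMr ?visit_gt0 // visit_ratio_ub.
Qed.

Lemma C_alpha_ge1 : 1 <= C_alpha M mu alpha.
Proof.
have [s _] : exists s : 'I_nS, True.
  apply: contrapT => /forallNP n; have := mu1; rewrite big1 => [/eqP|i]; last by have := n i.
  by rewrite eq_sym oner_eq0.
by have := visit_ratio_ub s clip0 clip0; rewrite divff // gt_eqF // visit_gt0.
Qed.

End VisitationBounds.

(** * Bregman divergence and the mirror step *)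

Section BregmanGeometry.
Context {R : realType} {nA : nat} (h : mirror_map R nA).
Implicit Types (p q u v : 'rV[R]_nA) (t : R).

Lemma dotvDl u v q : dotv (u + v) q = dotv u q + dotv v q.
Proof. by rewrite -big_split; apply: eq_bigr => i _; rewrite mxE mulrDl. Qed.

Lemma dotvBl u v q : dotv (u - v) q = dotv u q - dotv v q.
Proof. by rewrite -sumrB; apply: eq_bigr => i _; rewrite subMxE mulrBl. Qed.

Lemma dotvDr u v q : dotv q (u + v) = dotv q u + dotv q v.
Proof. by rewrite -big_split; apply: eq_bigr => i _; rewrite mxE mulrDr. Qed.

Lemma dotvBr u v q : dotv q (u - v) = dotv q u - dotv q v.
Proof. by rewrite -sumrB; apply: eq_bigr => i _; rewrite subMxE mulrBr. Qed.

Lemma dotvZl t u q : dotv (t *: u) q = t * dotv u q.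
Proof. by rewrite mulr_sumr; apply: eq_bigr => i _; rewrite mxE mulrA. Qed.

Lemma dotvZr t u q : dotv q (t *: u) = t * dotv q u.
Proof. by rewrite mulr_sumr; apply: eq_bigr => i _; rewrite mxE mulrCA. Qed.

Lemma dotv_le u v : `|dotv u v| <= (\sum_i `|u 0 i|) * `|v|.
Proof.
rewrite mulr_suml; apply: le_trans (ler_norm_sum _ _ _) _; apply: ler_sum => i _.
by rewrite normrM ler_wpM2l // mx_entry_le.
Qed.

Lemma segmentE p q t i : (p + t *: (q - p)) 0 i = p 0 i + t * (q 0 i - p 0 i).
Proof. by rewrite !mxE. Qed.

Lemma simplex_convex p q t : simplex p -> simplex q -> 0 <= t <= 1 ->
  simplex (p + t *: (q - p)).
Proof.
move=> [p0 p1] [q0 q1] /andP[t0 t1]; split=> [i|].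
  rewrite segmentE.
  have -> : p 0 i + t * (q 0 i - p 0 i) = (1 - t) * p 0 i + t * q 0 i by ring.
  by rewrite addr_ge0 ?mulr_ge0 ?subr_ge0.
under eq_bigr do rewrite segmentE.
by rewrite big_split /= -mulr_sumr sumrB p1 q1 subrr mulr0 addr0.
Qed.

Lemma simplex_clip_convex (alpha : R) p q t :
  simplex_clip alpha p -> simplex_clip alpha q -> 0 <= t <= 1 ->
  simplex_clip alpha (p + t *: (q - p)).
Proof.
move=> [sp pa] [sq qa] t01; split=> [|i]; first exact: simplex_convex.
move: t01 => /andP[t0 t1].
rewrite segmentE; have := pa i; have := qa i; nra.
Qed.

Lemma simplex_clipW (alpha : R) p : 0 < alpha -> simplex_clip alpha p -> simplex_pos p.
Proof. by move=> a0 [sp pa]; split=> // i; exact: lt_le_trans (pa i). Qed.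

(** First-order expansion at one point of the segment, as near to p as necessary:
    this suffices to contradict a strict inequality between slopes. *)
Lemma pot_directional p q (e : R) : simplex_pos p -> simplex q -> 0 < e ->
  exists2 t, 0 < t <= 1 &
    `|pot h (p + t *: (q - p)) - pot h p - t * dotv (grad h p) (q - p)| <= e * t.
Proof.
move=> pp sq e0; set d := q - p.
have d0 : 0 < `|d| + 1 by rewrite ltr_wpDl.
have /nbhs_ballP[r /= r0 br] := pot_differentiable h pp (divr_gt0 e0 d0).
pose t := Num.min 1 (r / (`|d| + 1) / 2).
have t0 : 0 < t by rewrite lt_min ltr01 !divr_gt0.
have t1 : t <= 1 by rewrite ge_min lexx.
exists t; first by rewrite t0.
have tr : t * (`|d| + 1) <= r / 2.
  have : t <= r / (`|d| + 1) / 2 by rewrite ge_min lexx orbT.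
  move=> /(ler_wpM2r (ltW d0)) /le_trans; apply.
  by rewrite mulrAC divfK // gt_eqF.
have bt : ball p r (p + t *: d).
  rewrite -ball_normE /= opprD addNKr normrN normrZ gtr0_norm //.
  by have := normr_ge0 d; nra.
have := br _ bt (simplex_convex pp.1 sq _); rewrite ltW // t1 => /(_ isT).
have -> : p + t *: d - p = t *: d by rewrite addrC addKr.
rewrite dotvZr normrZ gtr0_norm // => /le_trans; apply.
by rewrite mulrAC -mulrA ler_pM2l // ler_pdivrMr // ler_pM2l // lerDl.
Qed.

(** Along the segment from p to q, the potential is below its chord by convexity,
    and tangent to the linear function given by the gradient. *)
Lemma breg_ge0 p q : simplex_pos p -> simplex_pos q -> 0 <= breg h q p.
Proof.
move=> pp qq; have [->|npq] := eqVneq p q.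
  by rewrite /breg !subrr /dotv big1 ?subrr // => i _; rewrite mxE mulr0.
rewrite leNgt; apply/negP => neg; set c := - breg h q p.
have c0 : 0 < c / 2 by rewrite divr_gt0 // oppr_gt0.
have [t /andP[t0 t1]] := pot_directional pp qq.1 c0.
have conv : pot h (p + t *: (q - p)) <= t * pot h q + (1 - t) * pot h p.
  move: t1; rewrite le_eqVlt => /orP[/eqP->|t1].
    by rewrite scale1r addrC subrK mul1r subrr mul0r addr0.
  have -> : p + t *: (q - p) = t *: q + (1 - t) *: p.
    by apply/rowP => i; rewrite !mxE; ring.
  by apply/ltW/pot_strictly_convex => //; rewrite ?t0 // eq_sym.
rewrite ler_norml => /andP[low _].
have : breg h q p = - c by rewrite /c opprK.
rewrite /breg => E; nra.
Qed.

Lemma compact_simplex_clip (alpha : R) : 0 < alpha -> compact (@simplex_clip R nA alpha).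
Proof.
move=> a0; apply: bounded_closed_compact.
  exists 1; split=> // B B1 p [[p0 p1] _] /=; apply: le_trans (ltW B1).
  rewrite [X in X <= _]mx_normrE; apply: bigmax_le => // -[i j] _ /=.
  rewrite ord1 ger0_norm // -p1 (bigD1 j) //= lerDl.
  by apply: sumr_ge0.
have -> : @simplex_clip R nA alpha =
    (\bigcap_(i in [set: 'I_nA]) ((fun p => p 0 i) @^-1` [set x | alpha <= x]))
    `&` ((fun p => \sum_i p 0 i) @^-1` [set x | x = 1]).
  apply/seteqP; split=> [p [[p0 p1] pa]|p [pa p1]]; split=> //.
  - by move=> i _; exact: pa.
  - by split=> // i; apply: le_trans (ltW a0) (pa i I).
  - by move=> i; exact: pa i I.
apply: closedI.
  apply: closed_bigI => i _; apply: preimage_closed; last exact: closed_ge.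
  by move=> p _; exact: coord_continuous.
apply: preimage_closed; last exact: closed_eq.
move=> p _; apply: (@cvg_big _ _ _ _ _ _ _ (nbhs p)) => [|i _]; first exact: add_continuous.
exact: coord_continuous.
Qed.

Lemma within_cvg_lipschitz (A : set 'rV[R]_nA) (f : 'rV[R]_nA -> R) p (k : R) :
  (\forall q \near p, A q -> `|f q - f p| <= k * `|q - p|) ->
  f q @[q --> within A (nbhs p)] --> f p.
Proof.
move=> hk; apply/cvgrPdist_le => e e0.
have k0 : 0 < `|k| + 1 by rewrite ltr_wpDl.
have near_p : \forall q \near p, `|q - p| <= e / (`|k| + 1).
  apply/nbhs_ballP; exists (e / (`|k| + 1)) => /=; first by rewrite divr_gt0.
  by move=> q; rewrite -ball_normE /= distrC => /ltW.
rewrite near_withinE; apply: filterS2 hk near_p => q hq h2 /hq h1.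
rewrite distrC; apply: le_trans h1 _; apply: le_trans (ler_wpM2r _ (ler_norm k)) _ => //.
apply: le_trans (ler_wpM2l _ h2) _ => //.
by rewrite mulrCA ler_piMr ?(ltW e0) // ler_pdivrMr // mul1r lerDl.
Qed.

Section Argmax.
Variables (alpha step : R) (g p : 'rV[R]_nA).
Hypothesis alpha_gt0 : 0 < alpha.
Hypothesis clip_p : simplex_clip alpha p.

Let obj q := step * dotv g q - breg h q p.
Let qs := mirror_argmax h alpha step g p.

(** Clipping keeps away from the boundary of the simplex, so the potential is
    differentiable, hence continuous. *)
Lemma mirror_obj_continuous : {within @simplex_clip R nA alpha, continuous obj}.
Proof.
apply/subspace_continuousP => x cx.
pose c := step *: g + grad h p.
pose k : R := \sum_i `|c 0 i| + (\sum_i `|grad h x 0 i| + 1).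
apply: (@within_cvg_lipschitz _ _ _ k).
have := pot_differentiable h (simplex_clipW alpha_gt0 cx) (ltr01 : 0 < 1 :> R).
apply: filterS => q hq cq; have {}hq := hq cq.1; rewrite mul1r in hq.
have -> : obj q - obj x = dotv c (q - x) -
    (dotv (grad h x) (q - x) + (pot h q - pot h x - dotv (grad h x) (q - x))).
  by rewrite /obj /breg /c dotvDl dotvZl !dotvBr; ring.
apply: le_trans (ler_normB _ _) _; rewrite mulrDl; apply: lerD; first exact: dotv_le.
apply: le_trans (ler_normD _ _) _; rewrite mulrDl mul1r; apply: lerD => //.
exact: dotv_le.
Qed.

Lemma mirror_argmaxP : simplex_clip alpha qs /\
  forall q, simplex_clip alpha q -> obj q <= obj qs.
Proof.
apply: (@xgetPex _ p [set q | simplex_clip alpha q /\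
                  forall q', simplex_clip alpha q' -> obj q' <= obj q]).
have ne : @simplex_clip R nA alpha !=set0 by exists p.
have [c cA cmax] := EVT_max_rV ne (compact_simplex_clip alpha_gt0) mirror_obj_continuous.
exists c; split; first by rewrite inE in cA.
by move=> q cq; apply: cmax; rewrite inE.
Qed.

(** If this failed, a short move from the maximizer towards q would increase the
    objective. *)
Lemma mirror_first_order q : simplex_clip alpha q ->
  dotv (step *: g + grad h p - grad h qs) (q - qs) <= 0.
Proof.
move=> cq; have [cs smax] := mirror_argmaxP.
set c := dotv _ _; rewrite leNgt; apply/negP => c0.
have c2 : 0 < c / 2 by rewrite divr_gt0.
have [t /andP[t0 t1]] := pot_directional (simplex_clipW alpha_gt0 cs) cq.1 c2.
rewrite ler_norml => /andP[_ up].
have ct : simplex_clip alpha (qs + t *: (q - qs)).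
  by apply: simplex_clip_convex => //; rewrite (ltW t0).
have := smax _ ct; rewrite /obj /breg !dotvBr !dotvDr !dotvZr => hs.
have cE : c = step * dotv g (q - qs) + dotv (grad h p) (q - qs) - dotv (grad h qs) (q - qs).
  by rewrite /c dotvBl dotvDl dotvZl.
move: hs cE up; rewrite !dotvBr => hs cE up.
nra.
Qed.

(** The first-order condition, with the gradients of the potential absorbed in
    divergences. *)
Lemma three_point q : simplex_clip alpha q ->
  step * dotv g (q - qs) <= breg h q p - breg h q qs - breg h qs p.
Proof.
move=> /mirror_first_order; rewrite dotvBl dotvDl dotvZl /breg !dotvBr; lra.
Qed.

End Argmax.
End BregmanGeometry.

Section MirrorStepPolicies.
Context {R : realType} {nS nA : nat} (h : mirror_map R nA) (alpha step : R).
Variables (G pi : 'M[R]_(nS, nA)).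
Hypothesis alpha_gt0 : 0 < alpha.
Hypothesis clip_pi : policies_clip alpha pi.

Lemma row_mirror_step s :
  row s (mirror_step h alpha step G pi) = mirror_argmax h alpha step (row s G) (row s pi).
Proof. by apply/rowP => a; rewrite !mxE. Qed.

Lemma mirror_step_clip : policies_clip alpha (mirror_step h alpha step G pi).
Proof. by move=> s; rewrite row_mirror_step; case: (mirror_argmaxP h step (row s G) alpha_gt0 (clip_pi s)). Qed.

End MirrorStepPolicies.

(** * Concentration of the critic samples *)

Section Concentration.
Context {R : realType}.

Lemma eq_ler (x y : R) : x = y -> x <= y.
Proof. by move->. Qed.

Lemma ler_norm_sum_seq (T : Type) (s : seq T) (f : T -> R) (b : R) :
  (forall y, `|f y| <= b) -> `|\sum_(y <- s) f y| <= (size s)%:R * b.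
Proof.
move=> fb; elim: s => [|y s IH]; first by rewrite big_nil normr0 mul0r.
rewrite big_cons /= -natr1 mulrDl mul1r addrC.
by apply: le_trans (ler_normD _ _) _; exact: lerD.
Qed.

(** From 1 - x <= exp (- x). *)
Lemma expR_le_quadratic (x : R) : x <= 2^-1 -> expR x <= 1 + x + 2 * x ^+ 2.
Proof.
move=> x2; have h := expR_ge1Dx (- x); rewrite expRN in h.
have e0 := expR_gt0 x.
have h' : (1 - x) * expR x <= 1.
  by rewrite -ler_pdivlMr // div1r.
rewrite -[X in X <= _]mul1r.
have q0 : 0 <= x ^+ 2 := sqr_ge0 x.
have h1 : 1 <= (1 + x + 2 * x ^+ 2) * (1 - x).
  have : 0 <= x ^+ 2 * (1 - 2 * x) by rewrite mulr_ge0 //; lra.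
  by rewrite !expr2; lra.
apply: le_trans (ler_wpM2r (ltW e0) h1) _.
rewrite -mulrA -[X in _ <= X]mulr1; apply: ler_wpM2l => //.
by rewrite expr2; nra.
Qed.

(** The linear term of the exponential averages to 0 as X - m is centred. *)
Lemma mgf_bound (T : finType) (q X : T -> R) (m b lam : R) :
  (forall t, 0 <= q t) -> \sum_t q t = 1 -> \sum_t q t * X t = m ->
  (forall t, `|X t| <= b) -> 0 <= lam -> lam * (2 * b) <= 2^-1 ->
  \sum_t q t * expR (lam * (X t - m)) <= expR (8 * lam ^+ 2 * b ^+ 2).
Proof.
move=> q0 q1 qm Xb l0 lb.
have mb : `|m| <= b.
  rewrite -qm -[b]mul1r -q1 mulr_suml; apply: le_trans (ler_norm_sum _ _ _) _.
  by apply: ler_sum => t _; rewrite normrM ger0_norm // ler_wpM2l.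
apply: le_trans (expR_ge1Dx _).
have -> : 1 + 8 * lam ^+ 2 * b ^+ 2 =
    \sum_t q t * (1 + lam * (X t - m) + 8 * lam ^+ 2 * b ^+ 2).
  transitivity (\sum_t (q t * (1 - lam * m + 8 * lam ^+ 2 * b ^+ 2) + lam * (q t * X t))).
    by rewrite big_split /= -mulr_suml -mulr_sumr q1 qm; ring.
  by apply: eq_bigr => t _; ring.
apply: ler_sum => t _; apply: ler_wpM2l => //.
have Xm : `|X t - m| <= 2 * b.
  by apply: le_trans (ler_normB _ _) _; have := Xb t; lra.
have b0 : 0 <= b by exact: le_trans (normr_ge0 _) mb.
have Xm' : `|lam * (X t - m)| <= lam * (2 * b) by rewrite normrM ger0_norm // ler_wpM2l.
apply: le_trans (expR_le_quadratic _) _.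
  by apply: le_trans (ler_norm _) _; exact: le_trans Xm' lb.
rewrite lerD2l; have : (lam * (X t - m)) ^+ 2 <= (lam * (2 * b)) ^+ 2.
  by rewrite -real_normK ?num_real // ler_sqr ?nnegrE ?mulr_ge0.
rewrite !exprMn; lra.
Qed.

Section ProductMeasure.
Variables (I T : finType) (p : I -> T -> R) (S : pred I) (X : T -> R) (m b : R).
Hypothesis p0 : forall i t, 0 <= p i t.
Hypothesis p1 : forall i, \sum_t p i t = 1.
Hypothesis Xb : forall t, `|X t| <= b.

Lemma product_measure_ge0 (w : {ffun I -> T}) : 0 <= \prod_i p i (w i).
Proof. by apply: prodr_ge0. Qed.

Lemma product_measure1 : \sum_(w : {ffun I -> T}) \prod_i p i (w i) = 1.
Proof. by rewrite -bigA_distr_bigA /= big1. Qed.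

(** Chernoff's method; lam = eps / (16 b^2) minimizes 8 lam^2 b^2 - lam eps. *)
Lemma upper_tail (eps : R) : (forall i, S i -> \sum_t p i t * X t = m) ->
  0 < eps -> eps <= 4 * b ->
  \sum_(w : {ffun I -> T} | #|S|%:R * eps <= \sum_(i | S i) (X (w i) - m))
     \prod_i p i (w i) <= expR (- (#|S|%:R * eps ^+ 2 / (32 * b ^+ 2))).
Proof.
move=> pm e0 eb; have b0 : 0 < b by lra.
pose lam := eps / (16 * b ^+ 2).
have d0 : 0 < 16 * b ^+ 2 by rewrite mulr_gt0 // exprn_gt0.
have l0 : 0 < lam by rewrite divr_gt0.
have lb : lam * (2 * b) <= 2^-1.
  by rewrite /lam mulrAC ler_pdivrMr // expr2; nra.
pose F i t := if S i then expR (lam * (X t - m)) else 1.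
have step : \sum_(w : {ffun I -> T} | #|S|%:R * eps <= \sum_(i | S i) (X (w i) - m))
     \prod_i p i (w i) <=
   \sum_(w : {ffun I -> T}) (\prod_i (p i (w i) * F i (w i))) * expR (- (lam * (#|S|%:R * eps))).
  rewrite big_mkcond; apply: ler_sum => w _.
  have -> : \prod_i (p i (w i) * F i (w i)) =
      \prod_i p i (w i) * expR (lam * \sum_(i | S i) (X (w i) - m)).
    by rewrite big_split /= mulr_sumr expR_sum /F -big_mkcond.
  case: ifP => [h|_]; last by rewrite !mulr_ge0 ?product_measure_ge0 ?expR_ge0.
  rewrite -mulrA -expRD ler_peMr ?product_measure_ge0 // -[X in X <= _]expR0 ler_expR.
  by rewrite -mulrBr mulr_ge0 ?(ltW l0) // subr_ge0.
apply: le_trans step _; rewrite -mulr_suml.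
rewrite -(bigA_distr_bigA (fun i t => p i t * F i t)) /=.
apply: (@le_trans _ _ (expR (8 * lam ^+ 2 * b ^+ 2) ^+ #|S| * expR (- (lam * (#|S|%:R * eps))))).
  apply: ler_wpM2r; first exact: expR_ge0.
  rewrite -prodr_const [X in _ <= X]big_mkcond /=.
  apply: ler_prod => i _; apply/andP; split.
    by apply: sumr_ge0 => t _; rewrite mulr_ge0 // /F; case: ifP; rewrite ?expR_ge0.
  rewrite /F -topredE /=; case: ifP => Si; last by under eq_bigr do rewrite mulr1; rewrite p1.
  by apply: mgf_bound => //; [exact: pm|exact: ltW].
rewrite -expRM_natl -expRD ler_expR le_eqVlt; apply/orP; left; apply/eqP.
rewrite /lam; field; lra.
Qed.

End ProductMeasure.

Lemma two_sided_tail (I T : finType) (p : I -> T -> R) (S : pred I) (X : T -> R) (m b eps : R) :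
  (forall i t, 0 <= p i t) -> (forall i, \sum_t p i t = 1) ->
  (forall t, `|X t| <= b) -> (forall i, S i -> \sum_t p i t * X t = m) ->
  0 < eps -> eps <= 4 * b ->
  \sum_(w : {ffun I -> T} | #|S|%:R * eps <= `|\sum_(i | S i) (X (w i) - m)|)
     \prod_i p i (w i) <= 2 * expR (- (#|S|%:R * eps ^+ 2 / (32 * b ^+ 2))).
Proof.
move=> p0 p1 Xb pm e0 eb.
have up := upper_tail p0 p1 Xb pm e0 eb.
have Xb' t : `|- X t| <= b by rewrite normrN.
have pm' i : S i -> \sum_t p i t * - X t = - m.
  by move=> Si; under eq_bigr do rewrite mulrN; rewrite sumrN pm.
have lo := upper_tail p0 p1 Xb' pm' e0 eb.
rewrite mulrDl mul1r; apply: le_trans (lerD up lo).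
rewrite [X in _ <= X + _]big_mkcond [X in _ <= _ + X]big_mkcond [X in X <= _]big_mkcond.
rewrite -big_split; apply: ler_sum => w _ /=.
have -> : \sum_(i | S i) (- X (w i) - - m) = - \sum_(i | S i) (X (w i) - m).
  by rewrite -sumrN; apply: eq_bigr => i _; ring.
set s := \sum_(i | S i) _; set k := #|S|%:R * eps.
have pw := product_measure_ge0 p0 w.
case: (lerP k `|s|) => [|_]; last by rewrite addr_ge0 //; case: ifP.
rewrite ler_normr => /orP[->|->]; first by rewrite lerDl; case: ifP.
by rewrite lerDr; case: ifP.
Qed.

End Concentration.

Section BatchConcentration.
Context {R : realType} {nS nA : nat} (M : mdp R nS nA) (pi : 'M[R]_(nS, nA)).
Hypothesis polpi : policies pi.
Implicit Types (x : 'I_nS * 'I_nA).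

Lemma batch_prob_ge0 N H (w : batch nS nA N H) : 0 <= batch_prob M pi w.
Proof. by apply: prodr_ge0 => i _; exact: path_prob_ge0. Qed.

Lemma batch_prob_sum1 N H : \sum_(w : batch nS nA N H) batch_prob M pi w = 1.
Proof.
apply: (product_measure1 (p := fun (jx : 'I_N * ('I_nS * 'I_nA)) (w : H.-tuple _) => path_prob M pi jx.2 w)).
by move=> i; exact: sum_path1.
Qed.

(** Hoeffding's inequality and a union bound over the starting pairs. *)
Lemma batch_concentration N H (X : 'I_nS * 'I_nA -> seq ('I_nS * 'I_nA) -> R) (b eps : R) :
  (0 < N)%N -> (forall x (w : H.-tuple _), `|X x w| <= b) -> 0 < eps -> eps <= 4 * b ->
  1 - (nS * nA)%:R * (2 * expR (- (N%:R * eps ^+ 2 / (32 * b ^+ 2)))) <=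
  \sum_(w : batch nS nA N H | [forall x,
      `|N%:R^-1 * \sum_(j < N) X x (w (j, x)) -
        \sum_(t : H.-tuple _) path_prob M pi x t * X x t| <= eps]) batch_prob M pi w.
Proof.
move=> N0 Xb e0 eb.
set tail := 2 * _; pose mean x := \sum_(t : H.-tuple _) path_prob M pi x t * X x t.
pose bad x (w : batch nS nA N H) := eps < `|N%:R^-1 * \sum_(j < N) X x (w (j, x)) - mean x|.
have one x : \sum_(w | bad x w) batch_prob M pi w <= tail.
  pose S : pred ('I_N * ('I_nS * 'I_nA)) := fun jx => jx.2 == x.
  have cS : #|S| = N.
    rewrite -sum1_card (reindex (fun j : 'I_N => (j, x))) /=; last first.
      by exists fst => [j _|[j y] /eqP /= ->].
    rewrite -[RHS](card_ord N) -sum1_card; apply: eq_bigl => j.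
    by rewrite -topredE /= /S eqxx.
  have sumS (F : 'I_N * ('I_nS * 'I_nA) -> R) : \sum_(i | S i) F i = \sum_(j < N) F (j, x).
    rewrite (reindex (fun j : 'I_N => (j, x))) /=; last first.
      by exists fst => [j _|[j y] /eqP /= ->].
    by apply: eq_bigl => j; rewrite /S eqxx.
  have := @two_sided_tail R _ _ (fun (jx : 'I_N * ('I_nS * 'I_nA)) (w : H.-tuple _) =>
    path_prob M pi jx.2 w) S (X x) (mean x) b eps.
  rewrite cS -/tail => /(_ _ _ _ _ e0 eb) h; apply: le_trans (h _ _ _ _).
  - rewrite big_mkcond [X in _ <= X]big_mkcond; apply: ler_sum => w _.
    have pw := batch_prob_ge0 w.
    case: ifP => [bw|_]; last by case: ifP.
    rewrite ifT // sumS sumrB sumr_const card_ord -[mean x *+ N]mulr_natl.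
    have n0 : (N%:R : R) != 0 by rewrite pnatr_eq0 -lt0n.
    have -> : \sum_(j < N) X x (w (j, x)) - N%:R * mean x =
        N%:R * (N%:R^-1 * \sum_(j < N) X x (w (j, x)) - mean x).
      by rewrite mulrBr mulrA mulfV // mul1r.
    by rewrite normrM normr_nat ler_wpM2l // ltW.
  - by move=> i t; exact: path_prob_ge0.
  - by move=> i; exact: sum_path1.
  - by move=> t; exact: Xb.
  - by move=> i /eqP ->.
rewrite lerBlDr -[X in X <= _](batch_prob_sum1 N H).
rewrite (bigID (fun w : batch nS nA N H => [forall x,
      `|N%:R^-1 * \sum_(j < N) X x (w (j, x)) - mean x| <= eps])) /= lerD2l.
apply: (@le_trans _ _ (\sum_(x : 'I_nS * 'I_nA) \sum_(w | bad x w) batch_prob M pi w)).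
  under [X in _ <= X]eq_bigr do rewrite big_mkcond.
  rewrite exchange_big big_mkcond; apply: ler_sum => w _.
  have pw := batch_prob_ge0 w.
  case: ifP => [|_]; last by apply: sumr_ge0 => x _; case: ifP.
  rewrite negb_forall => /existsP[x]; rewrite -ltNge => bx.
  rewrite (bigD1 x) //= [bad x w]bx lerDl.
  by apply: sumr_ge0 => y _; case: ifP.
apply: le_trans (ler_sum _ (fun x _ => one x)) _.
by rewrite sumr_const card_prod !card_ord mulr_natl.
Qed.

End BatchConcentration.

(** * Bias of the critic *)

Section CriticBias.
Context {R : realType} {nS nA : nat} (M : mdp R nS nA) (pi : 'M[R]_(nS, nA)).
Hypothesis pos : policies_pos pi.
Implicit Types (x : 'I_nS * 'I_nA) (u f g : 'cV[R]_nS).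
Let pol : policies pi := policies_posW pos.
Let P := chain_of M pi.
Let stP : stoch P := chain_stoch M pol.
Let J := avg_reward M pi.
Let V := bias M pi.

Lemma stoch_apply_le k u (b : R) : (forall s, `|u s 0| <= b) ->
  forall s, `|(P ^+ k *m u) s 0| <= b.
Proof.
move=> ub s; have [Pk0 Pk1] := stoch_exp k stP.
rewrite mxE -[b]mul1r -(Pk1 s) mulr_suml; apply: le_trans (ler_norm_sum _ _ _) _.
by apply: ler_sum => i _; rewrite normrM ger0_norm // ler_wpM2l.
Qed.

Lemma apply_trans_le u (b : R) : (forall s, `|u s 0| <= b) ->
  forall s a, `|apply_trans M u s a| <= b.
Proof.
move=> ub s a; rewrite mxE -[b]mul1r -(trans_sum1 M s a) mulr_suml.
apply: le_trans (ler_norm_sum _ _ _) _; apply: ler_sum => i _.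
by rewrite normrM ger0_norm ?trans_ge0 // ler_wpM2l // trans_ge0.
Qed.

Lemma apply_trans_const (c : R) s a : apply_trans M (const_mx c) s a = c.
Proof.
rewrite mxE; under eq_bigr do rewrite mxE.
by rewrite -mulr_suml trans_sum1 mul1r.
Qed.

Lemma stoch_const k (c : R) : P ^+ k *m const_mx c = const_mx c :> 'cV[R]_nS.
Proof.
apply/colP => s; rewrite [LHS]mxE [RHS]mxE; under eq_bigr do rewrite mxE.
by rewrite -mulr_suml (proj2 (stoch_exp k stP)) mul1r.
Qed.

Lemma sum_coboundary u h : \sum_(i < h) P ^+ i *m (u - P *m u) = u - P ^+ h *m u.
Proof.
elim: h => [|h IH]; first by rewrite big_ord0 expr0 mul1mx subrr.
by rewrite big_ord_recr /= IH mulmxBr mulmxA -expmS addrA subrK.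
Qed.

Lemma apply_trans_sum h (F : nat -> 'cV[R]_nS) s a :
  apply_trans M (\sum_(i < h) F i) s a = \sum_(i < h) apply_trans M (F i) s a.
Proof.
elim: h => [|h IH]; first by rewrite !big_ord0 apply_trans0 mxE.
by rewrite !big_ord_recr /= apply_transD mxE IH.
Qed.

Lemma reward_abs_le s a : `|reward M s a| <= reward_bound M.
Proof. by rewrite ler_norml; exact: reward_in. Qed.

(** By Poisson's equation for the bias V, the expected sum of rewards is (H + 1) K +
    Q minus a boundary term, the mean of V after the last step. *)
Lemma K_mean_bias H x :
  `|H.+1%:R^-1 * path_sum M pi (reward M) H x - K_of M pi x.1 x.2| <=
  2 * `|Q_of M pi| / H.+1%:R.
Proof.
have E : path_sum M pi (reward M) H x = Q_of M pi x.1 x.2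
    - apply_trans M (P ^+ H *m V) x.1 x.2 + H.+1%:R * K_of M pi x.1 x.2.
  rewrite path_sumE // -(apply_trans_sum H (fun i => P ^+ i *m act_mean pi (reward M))).
  have -> : act_mean pi (reward M) = (V - P *m V) + J.
    by rewrite (bias_poisson M pol) subrK.
  under eq_bigr do rewrite mulmxDr.
  rewrite big_split /= sum_coboundary.
  have -> : \sum_(i < H) P ^+ i *m J = H%:R *: J.
    rewrite scaler_nat -[X in _ *+ X]card_ord -sumr_const; apply: eq_bigr => i _.
    elim: (i : nat) => [|k IH]; first by rewrite expr0 mul1mx.
    by rewrite expmS -mulmxA (avg_reward_fix M pol).
  have -> : apply_trans M (V - P ^+ H *m V + H%:R *: J) =
      apply_trans M V - apply_trans M (P ^+ H *m V) + H%:R *: K_of M pi.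
    rewrite apply_transD apply_transB; congr (_ + _).
    apply/matrixP => s a; rewrite !mxE mulr_sumr; apply: eq_bigr => s' _.
    by rewrite mxE mulrCA.
  rewrite /Q_of -natr1 -/V; rewrite !mxE; ring.
have n0 : 0 < H.+1%:R :> R by rewrite ltr0n.
rewrite E mulrDr mulrA mulVf ?gt_eqF // mul1r addrK normrM gtr0_norm ?invr_gt0 //.
rewrite mulrC ler_pM2r ?invr_gt0 //; apply: le_trans (ler_normB _ _) _.
rewrite mulrDl mul1r; apply: lerD; first exact: mx_entry_le.
by apply: apply_trans_le; apply: stoch_apply_le; exact: bias_le.
Qed.

Lemma target_time_ge0 : 0 <= target_time M pi.
Proof. by rewrite /target_time; elim/big_rec: _ => // s x _ x0; rewrite le_max x0 orbT. Qed.

(** The solution given by [class_poisson], extended by 0 outside the class to be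
    bounded everywhere. *)
Lemma rec_poisson s f (b : R) : rec_state M s -> (forall s', `|f s' 0| <= b) ->
  exists (c : R) (u : 'cV[R]_nS),
    (forall s', comm_class P s s' -> f s' 0 = (const_mx c + (u - P *m u)) s' 0) /\
    (forall s', `|u s' 0| <= b * target_time M pi).
Proof.
move=> rs fb; have rec := rec_class_facts pos rs.
have [c [u [eq_u le_u]]] := class_poisson stP rec fb.
have clC := comm_class_closed stP rec.
set C := comm_class P s in eq_u le_u clC *.
have b0 : 0 <= b by apply: le_trans (fb s).
exists c, (\col_s' (if C s' then u s' 0 else 0)); split=> s' => [Cs'|]; last first.
  rewrite mxE; case: ifPn => [Cs'|_]; last by rewrite normr0 mulr_ge0 // target_time_ge0.
  apply: le_trans (le_u _ Cs') _; apply: ler_wpM2l => //.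
  have EC : comm_class P s' = C.
    have /asboolP[a1 a2] := Cs'.
    by apply/funext => y; apply/asboolP/asboolP => -[h1 h2]; split;
       apply: (accessible_trans stP); eassumption.
  have rs' : rec_state M s'.
    have /asboolP[a1 _] := Cs'; apply: (rec_state_connect pos rs).
    exact/(accessible_connect M _ _ pos).
  rewrite -[X in X <= _]/(\sum_(z | C z) stationary_on P C 0 z * expected_hit P z s').
  rewrite -EC -[X in X <= _]/(class_target_time M pi s').
  exact: le_bigmax_cond.
rewrite mxE subMxE [const_mx _ _ _]mxE [(P *m _) _ _]mxE.
rewrite (sum_closed_class stP _ clC Cs') mxE Cs'.
have := eq_u _ Cs'; rewrite (sum_closed_class stP _ clC Cs') => E.
under eq_bigr => y Cy do rewrite [X in _ * X]mxE Cy.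
by rewrite -E addrC subrK.
Qed.

Lemma apply_trans_class k s a f g : rec_state M s ->
  (forall s', comm_class P s s' -> f s' 0 = g s' 0) ->
  apply_trans M (P ^+ k *m f) s a = apply_trans M (P ^+ k *m g) s a.
Proof.
move=> rs fg; have rec := rec_class_facts pos rs.
have clC := comm_class_closed stP rec.
rewrite !mxE; apply: eq_bigr => s' _.
have [->|ne] := eqVneq (trans M s a 0 s') 0; first by rewrite !mul0r.
have Cs' : comm_class P s s'.
  apply: (clC s); first exact: comm_class_refl.
  by rewrite chain_gt0 //; apply/existsP; exists a; rewrite lt_def ne trans_ge0.
congr (_ * _); rewrite !mxE; apply: eq_bigr => y _.
have [->|ne'] := eqVneq ((P ^+ k) s' y) 0; first by rewrite !mul0r.
congr (_ * _); apply: fg; apply: (closed_class_exp stP clC Cs' (k := k)).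
by rewrite lt_def ne' nonneg_exp //; case: stP.
Qed.

(** After the constant of Poisson's equation has been removed, the sum telescopes to
    two boundary terms. *)
Lemma rec_sum_apply s f (b : R) : rec_state M s -> (forall s', `|f s' 0| <= b) ->
  exists c : R, forall a h,
    `|\sum_(i < h) apply_trans M (P ^+ i *m f) s a - h%:R * c| <= 2 * (b * target_time M pi).
Proof.
move=> rs fb; have [c [u [fE ub]]] := rec_poisson rs fb.
exists c => a' h.
have -> : \sum_(i < h) apply_trans M (P ^+ i *m f) s a' =
   h%:R * c + (apply_trans M u s a' - apply_trans M (P ^+ h *m u) s a').
  under eq_bigr do rewrite (apply_trans_class _ _ rs fE).
  rewrite -(apply_trans_sum h (fun i => P ^+ i *m (const_mx c + (u - P *m u)))).
  under eq_bigr do rewrite mulmxDr stoch_const.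
  rewrite big_split /= sum_coboundary apply_transD mxE apply_transB subMxE; congr (_ + _).
  by rewrite (apply_trans_sum h (fun=> const_mx c)); under eq_bigr do rewrite apply_trans_const;
     rewrite sumr_const card_ord mulr_natl.
rewrite addrC addKr; apply: le_trans (ler_normB _ _) _; rewrite mulrDl mul1r.
by apply: lerD; apply: apply_trans_le => //; exact: stoch_apply_le.
Qed.

(** An error Kh - K accumulates along a trajectory of length h as h times its class
    average, which does not depend on the first action, plus at most 2 t + 1 times
    its size; the former is absorbed in c, to which a mirror step is blind. *)
Lemma Q_mean_bias H s (Kh : 'M[R]_(nS, nA)) (e : R) : rec_state M s ->
  (forall s a, `|Kh s a - K_of M pi s a| <= e) ->
  exists c : R, forall a,
    `|H.+1%:R^-1 * \sum_(h < H.+1) path_sum M pi (reward M - Kh) h (s, a)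
      - Q_of M pi s a - c| <=
    2 * (`|Q_of M pi| * target_time M pi) / H.+1%:R + e * (1 + 2 * target_time M pi).
Proof.
move=> rs Ke; pose D : 'M[R]_(nS, nA) := K_of M pi - Kh.
have De s' a' : `|D s' a'| <= e by rewrite subMxE distrC.
have fe s' : `|act_mean pi D s' 0| <= e by apply: act_mean_le.
have [cf hf] := rec_sum_apply rs fe.
have [cv hv] := rec_sum_apply rs (bias_le M pol).
have n0 : 0 < H.+1%:R :> R by rewrite ltr0n.
have E h a : path_sum M pi (reward M - Kh) h (s, a) = Q_of M pi s a + D s a
   - apply_trans M (P ^+ h *m V) s a + \sum_(i < h) apply_trans M (P ^+ i *m act_mean pi D) s a.
  have -> : reward M - Kh = (reward M - K_of M pi) + D by rewrite /D addrA subrK.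
  rewrite path_sumE // act_meanD act_meanB act_mean_apply (avg_reward_fix M pol).
  have -> : act_mean pi (reward M) - avg_reward M pi = V - P *m V.
    by rewrite (bias_poisson M pol).
  under eq_bigr do rewrite mulmxDr apply_transD mxE.
  rewrite big_split /= -(apply_trans_sum h (fun i => P ^+ i *m (V - P *m V))).
  rewrite sum_coboundary apply_transB subMxE.
  have -> : (reward M - K_of M pi + D) s a = reward M s a - K_of M pi s a + D s a.
    by rewrite mxE subMxE.
  have -> : Q_of M pi s a = reward M s a + apply_trans M V s a - K_of M pi s a.
    by rewrite /Q_of subMxE mxE.
  ring.
exists (H.+1%:R^-1 * (\sum_(h < H.+1) h%:R * cf) - cv) => a.
pose g (h : nat) := \sum_(i < h) apply_trans M (P ^+ i *m act_mean pi D) s a - h%:R * cf.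
have -> : H.+1%:R^-1 * \sum_(h < H.+1) path_sum M pi (reward M - Kh) h (s, a)
      - Q_of M pi s a - (H.+1%:R^-1 * (\sum_(h < H.+1) h%:R * cf) - cv) =
   - H.+1%:R^-1 * (\sum_(h < H.+1) apply_trans M (P ^+ h *m V) s a - H.+1%:R * cv)
   + (D s a + H.+1%:R^-1 * \sum_(h < H.+1) g h).
  rewrite (eq_bigr (fun h : 'I_H.+1 => (Q_of M pi s a + D s a) + ((- apply_trans M (P ^+ h *m V) s a) + (g h + h%:R * cf)))); last first.
    by move=> h _; rewrite E /g; ring.
  rewrite !big_split /= !sumr_const card_ord sumrN.
  rewrite -[Q_of M pi s a *+ _]mulr_natl -[D s a *+ _]mulr_natl.
  by field; rewrite gt_eqF.
apply: le_trans (ler_normD _ _) _; apply: lerD.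
  have i0 : 0 < H.+1%:R^-1 :> R by rewrite invr_gt0.
  by rewrite normrM normrN (gtr0_norm i0) mulrC ler_pM2r.
apply: le_trans (ler_normD _ _) _; rewrite mulrDr mulr1; apply: lerD => //.
rewrite normrM gtr0_norm ?invr_gt0 // mulrC ler_pdivrMr //.
apply: le_trans (ler_norm_sum _ _ _) _.
apply: (@le_trans _ _ (\sum_(h < H.+1) (2 * (e * target_time M pi)))).
  by apply: ler_sum => h _; exact: hf.
rewrite sumr_const card_ord -mulr_natl mulrC; apply: eq_ler; ring.
Qed.

End CriticBias.

Section CriticAccuracy.
Context {R : realType} {nS nA : nat} (M : mdp R nS nA) (pi : 'M[R]_(nS, nA)).
Hypothesis pos : policies_pos pi.
Let pol : policies pi := policies_posW pos.

(** A mirror step does not change when a function of the state is added to its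
    gradient estimate. *)
Definition accurate_up_to_offset (e : R) (G : 'M[R]_(nS, nA)) :=
  forall s, exists c : R, forall a, `|G s a - mixed_value M pi s a - c| <= e.

Lemma Q_hat_mean (Kh : 'M[R]_(nS, nA)) H x :
  \sum_(t : H.-tuple ('I_nS * 'I_nA)) path_prob M pi x t *
    (H.+1%:R^-1 * \sum_(h < H.+1) \sum_(y <- take h.+1 (x :: t))
       (reward M y.1 y.2 - Kh y.1 y.2)) =
  H.+1%:R^-1 * \sum_(h < H.+1) path_sum M pi (reward M - Kh) h x.
Proof.
under eq_bigr do rewrite mulrCA.
rewrite -mulr_sumr; congr (_ * _); under eq_bigr do rewrite mulr_sumr.
rewrite exchange_big; apply: eq_bigr => h _ /=.
rewrite (sum_path_take M pol x (fun t => \sum_(y <- x :: t) (reward M y.1 y.2 - Kh y.1 y.2))); last first.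
  by rewrite -ltnS ltn_ord.
by apply: eq_bigr => t _; congr (_ * _); apply: eq_bigr => y _; rewrite subMxE.
Qed.

(** The error 1/Y is the sum of 1/(2 Y) from sampling Q, 1/(4 Y) from truncation,
    and 1/(4 Y) from the estimate of K. For the last one K is needed up to 1/(12 t1
    Y), since 1 + 2 t <= 3 t1; half of this comes from sampling K, and half from
    truncation. *)
Variables (N H N' H' : nat) (Y L : R).
Let t1 := max1 (target_time M pi).
Let Q1 := max1 `|Q_of M pi|.
Let Rm := max1 (reward_bound M).
Hypothesis Y1 : 1 <= Y.
Hypothesis hH : 48 * Q1 * t1 * Y <= H.+1%:R.
Hypothesis hN : 32 * Rm ^+ 2 * (24 * t1 * Y) ^+ 2 * L <= N%:R.
Hypothesis hH' : 8 * t1 * Q1 * Y <= H'.+1%:R.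
Hypothesis hN' : 32 * (2 * Rm * H'.+1%:R) ^+ 2 * (2 * Y) ^+ 2 * L <= N'%:R.
Hypothesis N0 : (0 < N)%N.
Hypothesis N'0 : (0 < N')%N.

Let t1_ge1 : 1 <= t1. Proof. by rewrite /t1 /max1 le_max lexx. Qed.
Let Q1_ge1 : 1 <= Q1. Proof. by rewrite /Q1 /max1 le_max lexx. Qed.
Let Rm_ge1 : 1 <= Rm. Proof. by rewrite /Rm /max1 le_max lexx. Qed.
Let t_le : target_time M pi <= t1. Proof. by rewrite /t1 /max1 le_max lexx orbT. Qed.
Let Q_le : `|Q_of M pi| <= Q1. Proof. by rewrite /Q1 /max1 le_max lexx orbT. Qed.
Let R_le s a : `|reward M s a| <= Rm.
Proof. by apply: le_trans (reward_abs_le M s a) _; rewrite /Rm /max1 le_max lexx orbT. Qed.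

Let tail := 2 * expR (- L).

Let tail_le n (b e D : R) : 0 < b -> 0 < D -> e = D^-1 -> 32 * b ^+ 2 * D ^+ 2 * L <= n%:R ->
  2 * expR (- (n%:R * e ^+ 2 / (32 * b ^+ 2))) <= tail.
Proof.
move=> b0 D0 -> h; rewrite ler_pM2l // ler_expR lerN2.
rewrite ler_pdivlMr ?mulr_gt0 ?exprn_gt0 // -ler_pdivrMr ?exprn_gt0 ?invr_gt0 //.
by apply: le_trans h; rewrite exprVn invrK; apply: eq_ler; ring.
Qed.

Let e1 := (24 * t1 * Y)^-1.

Let good1 (w : batch nS nA N H) := [forall x : 'I_nS * 'I_nA,
   `|K_hat M w x.1 x.2 - H.+1%:R^-1 * path_sum M pi (reward M) H x| <= e1].

Let good1_prob : 1 - (nS * nA)%:R * tail <=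
  \sum_(w : batch nS nA N H | good1 w) batch_prob M pi w.
Proof.
have tY : 1 <= t1 * Y by apply: le_trans t1_ge1 _; rewrite ler_peMr // (le_trans ler01).
have D0 : 0 < 24 * t1 * Y by rewrite -mulrA mulr_gt0 // (lt_le_trans ltr01).
have R0 : 0 < Rm by exact: lt_le_trans Rm_ge1.
pose X x t := H.+1%:R^-1 * total_reward M (x :: t).
have Xb x (t : H.-tuple ('I_nS * 'I_nA)) : `|X x t| <= Rm.
  rewrite /X /total_reward normrM ger0_norm ?invr_ge0 // mulrC ler_pdivrMr ?ltr0n //.
  apply: le_trans (ler_norm_sum_seq _ (fun y => R_le y.1 y.2)) _.
  by rewrite /= size_tuple mulrC.
have e0 : 0 < e1 by rewrite invr_gt0.
have e4 : e1 <= 4 * Rm.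
  apply: (@le_trans _ _ 1); last by have := Rm_ge1; lra.
  by rewrite invf_le1 // -mulrA; lra.
have := batch_concentration M pol N0 Xb e0 e4.
have T := tail_le (b := Rm) (n := N) R0 D0 (erefl e1) hN.
move=> h; apply: le_trans (le_trans _ h) _.
  by rewrite lerD2l lerN2 ler_wpM2l.
apply/eq_ler/eq_bigl => w; apply: eq_forallb => -[s a] /=.
rewrite /K_hat mxE; congr (`|_ - _| <= _); rewrite mulr_sumr.
by apply: eq_bigr => t _; rewrite mulrCA.
Qed.

Let good1_K w : good1 w -> forall s a, `|K_hat M w s a - K_of M pi s a| <= (12 * t1 * Y)^-1.
Proof.
move=> /forallP g s a; have /= g' := g (s, a).
have b := K_mean_bias M pos H (s, a); rewrite /= in b.
have -> : K_hat M w s a - K_of M pi s a = (K_hat M w s a - H.+1%:R^-1 * path_sum M pi (reward M) H (s, a))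
   + (H.+1%:R^-1 * path_sum M pi (reward M) H (s, a) - K_of M pi s a) by ring.
apply: le_trans (ler_normD _ _) _.
have tY : 0 < t1 * Y by rewrite mulr_gt0 // (lt_le_trans ltr01).
have Q0 : 0 < Q1 by exact: lt_le_trans Q1_ge1.
have b' : 2 * `|Q_of M pi| / H.+1%:R <= e1.
  rewrite ler_pdivrMr ?ltr0n // /e1 [_^-1 * _]mulrC ler_pdivlMr; last by rewrite -mulrA mulr_gt0.
  apply: le_trans hH; rewrite -!mulrA.
  have -> : 2 * (`|Q_of M pi| * (24 * (t1 * Y))) = `|Q_of M pi| * (48 * (t1 * Y)) by ring.
  have -> : 48 * (Q1 * (t1 * Y)) = Q1 * (48 * (t1 * Y)) by ring.
  by apply: ler_wpM2r => //; rewrite mulr_ge0 // ltW.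
apply: le_trans (lerD g' (le_trans b b')) _.
apply: eq_ler; rewrite /e1; field; rewrite !gt_eqF //; exact: lt_le_trans ltr01 _.
Qed.

Let e2 := (2 * Y)^-1.

Let good2 (Kh : 'M[R]_(nS, nA)) (w : batch nS nA N' H') := [forall x : 'I_nS * 'I_nA,
   `|Q_hat M Kh w x.1 x.2 -
     H'.+1%:R^-1 * \sum_(h < H'.+1) path_sum M pi (reward M - Kh) h x| <= e2].

Let K_hat_le (w : batch nS nA N H) s a : `|K_hat M w s a| <= Rm.
Proof.
rewrite mxE normrM ger0_norm ?invr_ge0 // mulrC ler_pdivrMr ?ltr0n //.
apply: le_trans (ler_norm_sum _ _ _) _.
apply: le_trans (ler_sum _ (G := fun=> Rm) _) _; last first.
  by rewrite sumr_const card_ord mulr_natr.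
move=> j _; rewrite normrM ger0_norm ?invr_ge0 // mulrC ler_pdivrMr ?ltr0n //.
apply: le_trans (ler_norm_sum_seq _ (fun y => R_le y.1 y.2)) _.
by rewrite /= size_tuple mulrC.
Qed.

Let good2_prob (w : batch nS nA N H) : 1 - (nS * nA)%:R * tail <=
  \sum_(w' : batch nS nA N' H' | good2 (K_hat M w) w') batch_prob M pi w'.
Proof.
set Kh := K_hat M w.
have Y0 : 0 < Y by exact: lt_le_trans ltr01 Y1.
have D0 : 0 < 2 * Y by rewrite mulr_gt0.
have R0 : 0 < Rm by exact: lt_le_trans ltr01 Rm_ge1.
have h0 : 1 <= H'.+1%:R :> R by rewrite ler1n.
pose X x t : R := H'.+1%:R^-1 * \sum_(h < H'.+1) \sum_(y <- take h.+1 (x :: t))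
       (reward M y.1 y.2 - Kh y.1 y.2).
have b0 : 0 < 2 * Rm * H'.+1%:R by rewrite !mulr_gt0.
have Xb x (t : H'.-tuple ('I_nS * 'I_nA)) : `|X x t| <= 2 * Rm * H'.+1%:R.
  rewrite /X normrM ger0_norm ?invr_ge0 // mulrC ler_pdivrMr ?ltr0n //.
  apply: le_trans (ler_norm_sum _ _ _) _.
  apply: le_trans (ler_sum _ (G := fun=> 2 * Rm * H'.+1%:R) _) _; last first.
    by rewrite sumr_const card_ord -[X in X <= _]mulr_natr.
  move=> h _.
  have Db (y : 'I_nS * 'I_nA) : `|reward M y.1 y.2 - Kh y.1 y.2| <= 2 * Rm.
    apply: le_trans (ler_normB _ _) _.
    by have := R_le y.1 y.2; have := K_hat_le w y.1 y.2; rewrite -/Kh; lra.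
  apply: le_trans (ler_norm_sum_seq _ Db) _.
  rewrite mulrC ler_wpM2l ?mulr_ge0 ?(ltW R0) // ler_nat size_take /= size_tuple.
  by case: ifP => _ //; exact: ltn_ord.
have e0 : 0 < e2 by rewrite invr_gt0.
have e4 : e2 <= 4 * (2 * Rm * H'.+1%:R).
  apply: (@le_trans _ _ 1); first by rewrite invf_le1 //; have := Y1; lra.
  have : 1 * 1 <= Rm * H'.+1%:R by apply: ler_pM.
  by rewrite -mulrA; lra.
have := batch_concentration M pol N'0 Xb e0 e4.
have T := tail_le (n := N') b0 D0 (erefl e2) hN'.
move=> h; apply: le_trans (le_trans _ h) _.
  by rewrite lerD2l lerN2 ler_wpM2l.
apply/eq_ler/eq_bigl => w'; apply: eq_forallb => -[s a] /=.
by rewrite Q_hat_mean /Q_hat mxE.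
Qed.

Let good_accurate w w' : good1 w -> good2 (K_hat M w) w' ->
  accurate_up_to_offset Y^-1 (G_hat M w w').
Proof.
move=> g1 /forallP g2 s.
have Y0 : 0 < Y by exact: lt_le_trans ltr01 Y1.
have t0 : 0 < t1 by exact: lt_le_trans ltr01 t1_ge1.
have gK := good1_K g1.
have [rs|nrs] := boolP (rec_state M s); last first.
  exists 0 => a; rewrite subr0 !mxE (negPf nrs); have := gK s a.
  rewrite [K_hat M w s a]mxE [K_of M pi s a]mxE => h; apply: le_trans h _.
  rewrite lef_pV2 ?posrE ?mulr_gt0 // ler_peMl ?(ltW Y0) //.
  by have := t1_ge1; lra.
have [c hc] := Q_mean_bias pos H' rs gK.
exists c => a; rewrite [G_hat _ _ _ _ _]mxE [mixed_value _ _ _ _]mxE rs.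
have := hc a; have /= := g2 (s, a).
set q := Q_hat _ _ _ _ _; set m := _ * \sum_(_ < _) _; set B := _ / _ + _ => h1 h2.
have -> : q - Q_of M pi s a - c = (q - m) + (m - Q_of M pi s a - c) by ring.
apply: le_trans (ler_normD _ _) _; apply: le_trans (lerD h1 h2) _.
have hB1 : 2 * (`|Q_of M pi| * target_time M pi) / H'.+1%:R <= (4 * Y)^-1.
  rewrite ler_pdivrMr ?ltr0n // [_^-1 * _]mulrC ler_pdivlMr ?mulr_gt0 //.
  apply: le_trans hH'.
  have : `|Q_of M pi| * target_time M pi <= Q1 * t1.
    by apply: ler_pM => //; exact: target_time_ge0.
  by move=> /(ler_wpM2r (ltW Y0)); lra.
have hB2 : (12 * t1 * Y)^-1 * (1 + 2 * target_time M pi) <= (4 * Y)^-1.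
  rewrite mulrC ler_pdivrMr ?mulr_gt0 //.
  have -> : (4 * Y)^-1 * (12 * t1 * Y) = 3 * t1 by field; rewrite gt_eqF.
  by have := t_le; have := t1_ge1; lra.
apply: le_trans (lerD (lexx _) (lerD hB1 hB2)) _.
by apply: eq_ler; rewrite /e2; field; rewrite gt_eqF.
Qed.

Lemma critic_accuracy :
  1 - 2 * ((nS * nA)%:R * (2 * expR (- L))) <=
  \sum_(w : batch nS nA N H) \sum_(w' : batch nS nA N' H')
    batch_prob M pi w * batch_prob M pi w' *
    `[< accurate_up_to_offset Y^-1 (G_hat M w w') >]%:R.
Proof.
set d := (nS * nA)%:R * _.
have d0 : 0 <= d by rewrite !mulr_ge0 ?expR_ge0.
apply: (@le_trans _ _ (\sum_(w : batch nS nA N H | good1 w) batch_prob M pi w * (1 - d))).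
  rewrite -mulr_suml; have g := good1_prob; rewrite -/d in g.
  set S := \sum_(_ | _) _ in g *.
  have S1 : S <= 1.
    rewrite -(batch_prob_sum1 M pol N H) /S big_mkcond; apply: ler_sum => w _.
    by case: ifP => // _; exact: batch_prob_ge0.
  by nra.
rewrite big_mkcond; apply: ler_sum => w _.
have pw := batch_prob_ge0 M pol w.
case: ifP => [g1|_]; last first.
  by apply: sumr_ge0 => w' _; rewrite !mulr_ge0 // batch_prob_ge0.
under eq_bigr do rewrite -mulrA.
rewrite -mulr_sumr ler_wpM2l //; apply: le_trans (good2_prob w) _.
rewrite big_mkcond; apply: ler_sum => w' _; case: ifP => [g2|_]; last first.
  by rewrite mulr_ge0 // batch_prob_ge0.
by rewrite asboolT ?mulr1 //; exact: good_accurate.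
Qed.

End CriticAccuracy.

(** * One step of clipped mirror ascent *)

Section OneStep.
Context {R : realType} {nS nA : nat} (M : mdp R nS nA) (h : mirror_map R nA).
Variables (alpha : R) (mu : 'rV[R]_nS) (pia : 'M[R]_(nS, nA)).
Hypothesis alpha_gt0 : 0 < alpha.
Hypothesis mu_pos : simplex_pos mu.
Hypothesis clip_a : policies_clip alpha pia.
Implicit Types (pi : 'M[R]_(nS, nA)).

Let C := C_alpha M mu alpha.
Let B := B_alpha M mu alpha.
Let gap pi := avg_reward_mu M mu pia - avg_reward_mu M mu pi.
Let D pi := breg_w h (visit M mu pia) pia pi.

Variables (eta e : R) (G pi : 'M[R]_(nS, nA)).
Hypothesis eta_gt0 : 0 < eta.
Hypothesis e_ge0 : 0 <= e.
Hypothesis clip_pi : policies_clip alpha pi.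
Hypothesis accG : accurate_up_to_offset M pi e G.
Let pi' := mirror_step h alpha eta G pi.

Let clip_pi' : policies_clip alpha pi'. Proof. exact: mirror_step_clip. Qed.
Let posW (p : 'M[R]_(nS, nA)) (cp : policies_clip alpha p) : policies_pos p := policies_clipW alpha_gt0 cp.

Let adv (p p' : 'M[R]_(nS, nA)) s := \sum_a mixed_value M pi s a * (p s a - p' s a).

(** The offset c disappears because the two policies have the same total mass in
    each state. *)
Lemma adv_estimate p p' s : policies p -> policies p' ->
  `|adv p p' s - dotv (row s G) (row s p - row s p')| <= 2 * e.
Proof.
move=> polp polp'; have [c hc] := accG s.
have -> : adv p p' s - dotv (row s G) (row s p - row s p') =
    - \sum_a (G s a - mixed_value M pi s a - c) * (p s a - p' s a).
  rewrite /adv /dotv -sumrB -sumrN.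
  have z : \sum_a c * (p s a - p' s a) = 0.
    by rewrite -mulr_sumr sumrB !policy_sum1 // subrr mulr0.
  rewrite -[LHS](addr0) -[X in _ + X]z -big_split; apply: eq_bigr => a _.
  by rewrite /= !mxE; ring.
rewrite normrN; apply: le_trans (ler_norm_sum _ _ _) _.
apply: (@le_trans _ _ (\sum_a e * (p s a + p' s a))).
  apply: ler_sum => a _; rewrite normrM; apply: ler_pM => //.
  apply: le_trans (ler_normB _ _) _.
  by rewrite !ger0_norm // policy_ge0.
by rewrite -mulr_sumr big_split /= !policy_sum1 // mulrC.
Qed.

Lemma step_improves s : - (2 * e) <= adv pi' pi s.
Proof.
have tp := three_point h eta (row s G) alpha_gt0 (clip_pi s) (clip_pi s).
have b1 := breg_ge0 h (simplex_clipW alpha_gt0 (clip_pi' s)) (simplex_clipW alpha_gt0 (clip_pi s)).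
have b2 := breg_ge0 h (simplex_clipW alpha_gt0 (clip_pi s)) (simplex_clipW alpha_gt0 (clip_pi' s)).
rewrite -row_mirror_step -/pi' in tp.
have b0 : breg h (row s pi) (row s pi) = 0.
  by rewrite /breg !subrr sub0r /dotv big1 ?oppr0 // => i _; rewrite mxE mulr0.
have : eta * dotv (row s G) (row s pi - row s pi') <= 0 by lra.
rewrite pmulr_rle0 // => dot.
have := adv_estimate s (policies_posW (posW clip_pi')) (policies_posW (posW clip_pi)).
have -> : dotv (row s G) (row s pi' - row s pi) = - dotv (row s G) (row s pi - row s pi').
  by rewrite !dotvBr opprB.
rewrite ler_norml => /andP[? _]; lra.
Qed.

Lemma step_towards s : adv pia pi' s <=
  (breg h (row s pia) (row s pi) - breg h (row s pia) (row s pi')) / eta + 2 * e.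
Proof.
have tp := three_point h eta (row s G) alpha_gt0 (clip_pi s) (clip_a s).
have b1 := breg_ge0 h (simplex_clipW alpha_gt0 (clip_pi s)) (simplex_clipW alpha_gt0 (clip_pi' s)).
rewrite -row_mirror_step -/pi' in tp.
have dot : dotv (row s G) (row s pia - row s pi') <=
    (breg h (row s pia) (row s pi) - breg h (row s pia) (row s pi')) / eta.
  by rewrite ler_pdivlMr // mulrC; lra.
have := adv_estimate s (policies_posW (posW clip_a)) (policies_posW (posW clip_pi')).
rewrite ler_norml => /andP[_ ?]; lra.
Qed.

Let vis0 p s (cp : policies_clip alpha p) : 0 <= visit M mu p 0 s.
Proof. exact/ltW/(visit_gt0 M alpha_gt0 mu_pos cp s cp). Qed.

Let value_diff p (cp : policies_clip alpha p) :
  avg_reward_mu M mu p - avg_reward_mu M mu pi = \sum_s visit M mu p 0 s * adv p pi s.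
Proof. by rewrite -performance_difference //; exact: posW. Qed.

Lemma step_gap_le : gap pi' <= gap pi + 2 * e * B.
Proof.
have : avg_reward_mu M mu pi' - avg_reward_mu M mu pi >= - (2 * e * B).
  rewrite value_diff //.
  apply: (@le_trans _ _ (\sum_s visit M mu pi' 0 s * - (2 * e))).
    rewrite -mulr_suml mulrN lerN2 mulrC ler_wpM2l ?mulr_ge0 //.
    exact: visit_le_B.
  by apply: ler_sum => s _; apply: ler_wpM2l; [exact: vis0|exact: step_improves].
rewrite /gap; have E (x y z k : R) : - k <= y - x -> z - y <= z - x + k by lra.
exact: E.
Qed.

(** The advantage of pia over pi splits at pi': the first part is what the three
    point inequality controls, and the second, being almost nonnegative, can be moved
    from the visitation measure of pia to that of pi' at the price of C. *)
Lemma step_gap_recursion :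
  gap pi <= (D pi - D pi') / eta + C * (gap pi - gap pi') + 4 * e * B * C.
Proof.
have C1 : 1 <= C := C_alpha_ge1 M alpha_gt0 mu_pos clip_a.
have B0 : 0 <= B := le_trans ler01 (B_alpha_ge1 M alpha_gt0 mu_pos clip_a).
have sumBa := visit_le_B M alpha_gt0 mu_pos clip_a clip_a.
have sumB' := visit_le_B M alpha_gt0 mu_pos clip_a clip_pi'.
have E1 : gap pi = \sum_s visit M mu pia 0 s * adv pia pi' s +
    \sum_s visit M mu pia 0 s * adv pi' pi s.
  rewrite /gap value_diff // -big_split; apply: eq_bigr => s _ /=.
  rewrite -mulrDr; congr (_ * _); rewrite -big_split; apply: eq_bigr => a _ /=.
  by ring.
have h1 : \sum_s visit M mu pia 0 s * adv pia pi' s <= (D pi - D pi') / eta + 2 * e * B.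
  apply: (@le_trans _ _ (\sum_s visit M mu pia 0 s * ((breg h (row s pia) (row s pi) -
      breg h (row s pia) (row s pi')) / eta + 2 * e))).
    by apply: ler_sum => s _; apply: ler_wpM2l; [exact: vis0|exact: step_towards].
  under eq_bigr do rewrite mulrDr mulrA mulrBr.
  rewrite big_split /= -!mulr_suml sumrB lerD2l mulrC ler_wpM2l ?mulr_ge0 //.
have h2 : \sum_s visit M mu pia 0 s * adv pi' pi s <= C * (gap pi - gap pi') + 2 * e * B * C.
  have -> : gap pi - gap pi' = \sum_s visit M mu pi' 0 s * adv pi' pi s.
    have E (x y z : R) : z - x - (z - y) = y - x by ring.
    by rewrite -value_diff // /gap E.
  apply: (@le_trans _ _ (\sum_s visit M mu pia 0 s * (adv pi' pi s + 2 * e))).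
    by apply: ler_sum => s _; rewrite ler_wpM2l ?vis0 // lerDl mulr_ge0.
  apply: (@le_trans _ _ (\sum_s C * visit M mu pi' 0 s * (adv pi' pi s + 2 * e))).
    apply: ler_sum => s _; apply: ler_wpM2r; first by have := step_improves s; lra.
    exact: visit_le_C.
  under eq_bigr do rewrite -mulrA mulrDr.
  rewrite -mulr_sumr big_split /= -mulr_suml mulrDr lerD2l.
  have eC : 0 <= 2 * e * C by rewrite !mulr_ge0 // (le_trans ler01).
  have := ler_wpM2l eC sumB'; rewrite -/B; lra.
have : 2 * e * B <= 2 * e * B * C by rewrite ler_peMr // !mulr_ge0.
move=> hB; rewrite [X in X <= _]E1.
have combine (x y u v w z : R) : x <= u + w -> y <= v + z -> w <= z -> x + y <= u + v + 2 * z.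
  by lra.
have -> : 4 * e * B * C = 2 * (2 * e * B * C) by rewrite !mulrA -natrM.
exact: combine h1 h2 hB.
Qed.

Lemma divergence_ge0 p : policies_clip alpha p -> 0 <= D p.
Proof.
move=> cp; apply: sumr_ge0 => s _; rewrite mulr_ge0 ?vis0 //.
by apply: breg_ge0; [exact: simplex_clipW (cp s)|exact: simplex_clipW (clip_a s)].
Qed.

End OneStep.

Section Recursions.
Context {R : realType}.
Implicit Types (a b eta : nat -> R).

(** The right-hand sides telescope. As a may grow by x at each step, K a_K exceeds
    the sum of the a_k by at most K^2 x. *)
Lemma constant_step_recursion a b (eta C x z : R) K : 0 <= x ->
  (forall k, (k < K)%N -> a k.+1 <= a k + x) ->
  (forall k, (k < K)%N -> a k <= (b k - b k.+1) / eta + C * (a k - a k.+1) + z) ->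
  K%:R * a K <= (b 0%N - b K) / eta + C * (a 0%N - a K) + K%:R * z + K%:R ^+ 2 * x.
Proof.
move=> x0; elim: K => [|K IH] h1 h2; first by rewrite !subrr !(mul0r, mulr0) expr0n /= mul0r !addr0.
have {}IH := IH (fun k lt => h1 k (ltnW lt)) (fun k lt => h2 k (ltnW lt)).
have {}h1 := h1 K (ltnSn K); have {}h2 := h2 K (ltnSn K).
have K0 : 0 <= K%:R :> R := ler0n _ _.
have h3 := ler_wpM2l K0 h1.
have h4 : 0 <= K%:R * x by rewrite mulr_ge0.
rewrite -natr1 expr2 in IH *; rewrite !mulrBl in IH h2 *; lra.
Qed.

(** The recursion multiplies the potential a_k + b_k / (eta_k (C - 1)) by 1 - 1/C,
    but leaves b_(k+1) / (C eta_k) as its second term; the growth of the step sizes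
    makes this at least b_(k+1) / (eta_(k+1) (C - 1)). *)
Lemma adaptive_step_recursion a b eta (C z : R) K : 1 < C ->
  (forall k, 0 < eta k) -> (forall k, eta k * C <= eta k.+1 * (C - 1)) ->
  0 <= z -> (forall k, (k <= K)%N -> 0 <= b k) ->
  (forall k, (k < K)%N -> a k <= (b k - b k.+1) / eta k + C * (a k - a k.+1) + z) ->
  a K + b K / (eta K * (C - 1)) <=
    (1 - C^-1) ^+ K * (a 0%N + b 0%N / (eta 0%N * (C - 1))) + z.
Proof.
move=> C1 eta0 etaC z0 b0 rec.
have C0 : 0 < C by lra.
have Cm : 0 < C - 1 by lra.
have Cm' : C - 1 != 0 by rewrite gt_eqF.
have CC : C * C^-1 = 1 by rewrite mulfV // gt_eqF.
pose phi k := a k + b k / (eta k * (C - 1)).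
have step k : (k < K)%N -> phi k.+1 <= (1 - C^-1) * phi k + z * C^-1.
  move=> kK; have r := rec k kK.
  have e0 := eta0 k; have e1 := eta0 k.+1.
  have bS := b0 k.+1 kK.
  have h1 : C * (b k.+1 / (eta k.+1 * (C - 1))) <= b k.+1 / eta k.
    rewrite mulrCA ler_wpM2l // ler_pdivrMr ?mulr_gt0 //.
    by rewrite [_^-1 * _]mulrC ler_pdivlMr // mulrC.
  have h2 : (C - 1) * (b k / (eta k * (C - 1))) = b k / eta k.
    by field; rewrite Cm' gt_eqF.
  have h3 : C * phi k.+1 <= (C - 1) * phi k + z.
    by rewrite /phi mulrDr [X in _ <= X + _]mulrDr h2; rewrite mulrBl in r; lra.
  rewrite -(ler_pM2l C0); apply: le_trans h3 _; apply: eq_ler.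
  by field; rewrite gt_eqF.
have q0 : 0 <= 1 - C^-1 by rewrite subr_ge0 invf_le1 // ltW.
suff H k : (k <= K)%N -> phi k <= (1 - C^-1) ^+ k * phi 0%N + z by exact: H.
elim: k => [|k IH] kK; first by rewrite expr0 mul1r lerDl.
apply: le_trans (step k kK) _.
have := ler_wpM2l q0 (IH (ltnW kK)); rewrite exprS -mulrA; lra.
Qed.

End Recursions.

Section RunProbability.
Context {R : realType} {nS nA : nat} (M : mdp R nS nA) (h : mirror_map R nA).
Context (alpha : R) (eta : nat -> R) (cp : critic_schedule R nS nA).
Hypothesis alpha_gt0 : 0 < alpha.

Definition good_step (e : R) k (pi pi' : 'M[R]_(nS, nA)) :=
  policies_clip alpha pi /\ exists2 G, accurate_up_to_offset M pi e G &
    pi' = mirror_step h alpha (eta k) G pi.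

Lemma run_prob_ge0 k n pi E : policies_clip alpha pi ->
  0 <= run_prob M h alpha eta cp k n pi E.
Proof.
elim: n k pi E => [|n IH] k pi E cpi /=; first by case: asbool.
have pol := policies_posW (policies_clipW alpha_gt0 cpi).
apply: sumr_ge0 => w _; apply: sumr_ge0 => w' _; apply: mulr_ge0.
  by rewrite mulr_ge0 // batch_prob_ge0.
by apply: IH; exact: mirror_step_clip.
Qed.

(** Given the current policy, the critic does not depend on the past, so the failure
    probabilities of the iterations add up. *)
Lemma run_prob_lb (e d : R) k n pi (E : seq 'M[R]_(nS, nA) -> Prop) :
  0 <= d -> d <= 1 ->
  (forall k pi, policies_clip alpha pi -> let c := cp k pi in
    1 - d <= \sum_(w : batch nS nA (par_N c) (par_H c))
      \sum_(w' : batch nS nA (par_N' c) (par_H' c))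
        batch_prob M pi w * batch_prob M pi w' *
        `[< accurate_up_to_offset M pi e (G_hat M w w') >]%:R) ->
  policies_clip alpha pi ->
  (forall tr, nth 0 tr 0 = pi ->
    (forall i, (i < n)%N -> good_step e (k + i) (nth 0 tr i) (nth 0 tr i.+1)) ->
    policies_clip alpha (nth 0 tr n) -> E tr) ->
  1 - n%:R * d <= run_prob M h alpha eta cp k n pi E.
Proof.
move=> d0 d1 acc; elim: n k pi E => [|n IH] k pi E cpi hE /=.
  by rewrite mul0r subr0 asboolT //; apply: hE.
have pol := policies_posW (policies_clipW alpha_gt0 cpi).
set c := cp k pi.
have clip' G : policies_clip alpha (mirror_step h alpha (eta k) G pi).
  exact: mirror_step_clip.
pose q : R := Num.max 0 (1 - n%:R * d).
have q0 : 0 <= q by rewrite le_max lexx.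
apply: (@le_trans _ _ ((1 - d) * q)).
  rewrite -natr1 /q; case: (lerP 0 (1 - n%:R * d)) => hn.
    have : 0 <= d * (n%:R * d) by apply: mulr_ge0 => //; exact: mulr_ge0.
    by lra.
  by lra.
apply: le_trans (ler_wpM2r q0 (acc k pi cpi)) _.
rewrite mulr_suml; apply: ler_sum => w _; rewrite mulr_suml; apply: ler_sum => w' _.
rewrite -[X in X <= _]mulrA; apply: ler_wpM2l; first by rewrite mulr_ge0 // batch_prob_ge0.
case: asboolP => [good|_]; last by rewrite mul0r run_prob_ge0.
rewrite mul1r /q ge_max run_prob_ge0 //=; apply: IH => // tr tr0 steps clip_n.
apply: hE => // -[|i] ilt /=.
  by rewrite addn0 tr0; split=> //; exists (G_hat M w w').
by rewrite addnS -addSn; exact: steps.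
Qed.

End RunProbability.

(** * Choice of the critic parameters *)

Section Schedule.
Context {R : realType} {nS nA : nat} (M : mdp R nS nA).

Definition nat_above (x : R) : nat := (Num.truncn x).+1.

Lemma nat_above_gt x : x < (nat_above x)%:R.
Proof. exact: truncnS_gt. Qed.

Lemma nat_above_le2 x : 1 <= x -> (nat_above x)%:R <= 2 * x.
Proof.
move=> x1; have : (Num.truncn x)%:R <= x by rewrite truncn_le (le_trans ler01).
by rewrite /nat_above -natr1; lra.
Qed.

(** The number of samples is of order Rm^2 t^3 Q^3 Y^5 L per state-action pair. *)
Definition critic_choice (Y L : R) : critic_schedule R nS nA := fun _ pi =>
  let t := max1 (target_time M pi) in let Q := max1 `|Q_of M pi| in
  let Rm := max1 (reward_bound M) in
  let H' := nat_above (8 * t * Q * Y) in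
  CriticParams (nat_above (32 * Rm ^+ 2 * (24 * t * Y) ^+ 2 * L))
               (nat_above (48 * Q * t * Y))
               (nat_above (32 * (2 * Rm * H'.+1%:R) ^+ 2 * (2 * Y) ^+ 2 * L))
               H'.

Lemma critic_choice_positive Y L : positive_schedule (critic_choice Y L).
Proof. by []. Qed.

Lemma critic_choice_accuracy Y L k pi : 1 <= Y -> policies_pos pi ->
  let c := critic_choice Y L k pi in
  1 - 2 * ((nS * nA)%:R * (2 * expR (- L))) <=
  \sum_(w : batch nS nA (par_N c) (par_H c))
    \sum_(w' : batch nS nA (par_N' c) (par_H' c))
      batch_prob M pi w * batch_prob M pi w' *
      `[< accurate_up_to_offset M pi Y^-1 (G_hat M w w') >]%:R.
Proof.
move=> Y1 pos /=.
have nat_aboveS x : x <= (nat_above x).+1%:R.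
  by apply: le_trans (ltW (nat_above_gt x)) _; rewrite ler_nat.
apply: critic_accuracy => //.
- exact/ltW/nat_above_gt.
- exact/ltW/nat_above_gt.
Qed.

Lemma max1_ge1 (x : R) : 1 <= max1 x. Proof. by rewrite /max1 le_max lexx. Qed.
Lemma max1_ge (x : R) : x <= max1 x. Proof. by rewrite /max1 le_max lexx orbT. Qed.
Lemma max1_mono (x y : R) : x <= y -> max1 x <= max1 y.
Proof. by move=> xy; rewrite /max1 ge_max !le_max lexx xy orbT. Qed.
Lemma max1_id (x : R) : 1 <= x -> max1 x = x.
Proof. by move=> x1; rewrite /max1; apply/max_idPr. Qed.

Lemma product_cost (c1 c2 c3 c4 r t Q Y L n1 h1 n2 h2 : R) :
  0 <= c1 -> 0 <= c2 -> 0 <= c3 -> 0 <= c4 ->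
  1 <= r -> 1 <= t -> 1 <= Q -> 1 <= Y -> 1 <= L ->
  0 <= n1 -> 0 <= h1 -> 0 <= n2 -> 0 <= h2 ->
  n1 <= c1 * (r ^+ 2 * (t ^+ 2 * Y ^+ 2 * L)) -> h1 <= c2 * (t * Q * Y) ->
  n2 <= c3 * (r ^+ 2 * ((h2 + 1) ^+ 2 * Y ^+ 2 * L)) -> h2 <= c4 * (t * Q * Y) ->
  n1 * h1 + n2 * h2 <=
  (c1 * c2 + c3 * (c4 + 1) ^+ 2 * c4) * (r ^+ 2 * t ^+ 3 * Q ^+ 3 * Y ^+ 5 * L).
Proof.
move=> c10 c20 c30 c40 r1 t1 Q1 Y1 L1 n10 h10 n20 h20 hn1 hh1 hn2 hh2.
have [r0 t0 Q0] : [/\ 0 <= r, 0 <= t & 0 <= Q] by split; apply: le_trans ler01 _.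
have [Y0 L0] : 0 <= Y /\ 0 <= L by split; apply: le_trans ler01 _.
have x1 : 1 <= t * Q * Y by do 2!apply: mulr_ege1 => //.
have hS : h2 + 1 <= (c4 + 1) * (t * Q * Y) by rewrite mulrDl mul1r lerD.
have hn2' : n2 <= c3 * (r ^+ 2 * (((c4 + 1) * (t * Q * Y)) ^+ 2 * Y ^+ 2 * L)).
  apply: le_trans hn2 _; apply: (ler_wpM2l c30); apply: (ler_wpM2l (exprn_ge0 2 r0)).
  apply: (ler_wpM2r L0); apply: (ler_wpM2r (exprn_ge0 2 Y0)).
  by apply: lerXn2r => //; rewrite nnegrE ?addr_ge0 // (le_trans _ hS) // addr_ge0.
have p1 := ler_pM n10 h10 hn1 hh1.
have p2 := ler_pM n20 h20 hn2' hh2.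
apply: le_trans (lerD p1 p2) _; rewrite [X in _ <= X]mulrDl; apply: lerD; last by apply: eq_ler; ring.
have -> : c1 * (r ^+ 2 * (t ^+ 2 * Y ^+ 2 * L)) * (c2 * (t * Q * Y)) =
    c1 * c2 * (r ^+ 2 * t ^+ 3 * Q ^+ 1 * Y ^+ 3 * L) by ring.
apply: (ler_wpM2l (mulr_ge0 c10 c20)); apply: (ler_wpM2r L0).
have rt : 0 <= r ^+ 2 * t ^+ 3 by rewrite mulr_ge0 ?exprn_ge0.
apply: ler_pM; [by rewrite mulr_ge0 ?exprn_ge0|by rewrite exprn_ge0| |exact: ler_weXn2l].
by apply: (ler_wpM2l rt); exact: ler_weXn2l.
Qed.

Lemma critic_choice_cost Y L k pi : 1 <= Y -> 1 <= L ->
  let c := critic_choice Y L k pi in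
  (par_N c * par_H c + par_N' c * par_H' c)%:R <=
  10 ^+ 8 * (max1 (reward_bound M) ^+ 2 * max1 (target_time M pi) ^+ 3 *
    max1 `|Q_of M pi| ^+ 3 * Y ^+ 5 * L).
Proof.
move=> Y1 L1 /=.
set t := max1 (target_time M pi); set Q := max1 `|_|; set r := max1 (reward_bound M).
have t1 : 1 <= t := max1_ge1 _; have Q1 : 1 <= Q := max1_ge1 _.
have r1 : 1 <= r := max1_ge1 _.
clearbody t Q r.
set H' := nat_above (8 * t * Q * Y).
have x1 : 1 <= t * Q * Y by do 2!apply: mulr_ege1 => //.
have hH' : H'%:R <= 16 * (t * Q * Y).
  apply: le_trans (nat_above_le2 _) _; last by lra.
  by move: x1; lra.
have H'1 : 1 <= H'%:R + 1 :> R by rewrite lerDr.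
have hH : (nat_above (48 * Q * t * Y))%:R <= 96 * (t * Q * Y).
  by apply: le_trans (nat_above_le2 _) _; lra.
have y1 : 1 <= r ^+ 2 * (t ^+ 2 * Y ^+ 2 * L).
  by apply: mulr_ege1; [exact: exprn_ege1|do 2!apply: mulr_ege1 => //; exact: exprn_ege1].
have hN : (nat_above (32 * r ^+ 2 * (24 * t * Y) ^+ 2 * L))%:R <=
    64 * 576 * (r ^+ 2 * (t ^+ 2 * Y ^+ 2 * L)).
  apply: le_trans (nat_above_le2 _) _; rewrite !exprMn; first by lra.
  by apply: eq_ler; ring.
have z1 : 1 <= r ^+ 2 * ((H'%:R + 1) ^+ 2 * Y ^+ 2 * L).
  by apply: mulr_ege1; [exact: exprn_ege1|do 2!apply: mulr_ege1 => //; exact: exprn_ege1].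
have hN' : (nat_above (32 * (2 * r * H'.+1%:R) ^+ 2 * (2 * Y) ^+ 2 * L))%:R <=
    1024 * (r ^+ 2 * ((H'%:R + 1) ^+ 2 * Y ^+ 2 * L)).
  rewrite -natr1; apply: le_trans (nat_above_le2 _) _; rewrite !exprMn; first by lra.
  by apply: eq_ler; ring.
rewrite natrD !natrM.
have c1 : 0 <= 64 * 576 :> R by apply: mulr_ge0; exact: ler0n.
have := product_cost c1 (ler0n R 96) (ler0n R 1024) (ler0n R 16) r1 t1 Q1 Y1 L1
  (ler0n R _) (ler0n R _) (ler0n R _) (ler0n R _) hN hH hN' hH'.
have [r0 t0 Q0] : [/\ 0 <= r, 0 <= t & 0 <= Q] by split; apply: le_trans ler01 _.
have [Y0 L0] : 0 <= Y /\ 0 <= L by split; apply: le_trans ler01 _.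
have : 0 <= r ^+ 2 * t ^+ 3 * Q ^+ 3 * Y ^+ 5 * L.
  apply: mulr_ge0 L0; apply: mulr_ge0 (exprn_ge0 5 Y0); apply: mulr_ge0 (exprn_ge0 3 Q0).
  exact: mulr_ge0 (exprn_ge0 2 r0) (exprn_ge0 3 t0).
set X := r ^+ 2 * _ * _ * _ * _ => X0 /le_trans; apply.
by apply: (ler_wpM2r X0); rewrite !exprS expr0; lra.
Qed.

Lemma sample_complexity_le Y L K tr : 1 <= Y -> 1 <= L ->
  (sample_complexity (critic_choice Y L) K tr)%:R <=
  K%:R * (10 ^+ 8 * (max1 (reward_bound M) ^+ 2 * max1 (max_target_time M K tr) ^+ 3 *
    max1 (max_Q_norm M K tr) ^+ 3 * Y ^+ 5 * L)) * (nS%:R * nA%:R).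
Proof.
move=> Y1 L1; set X := max1 (reward_bound M) ^+ 2 * _ * _ * _ * _.
have c0 : 0 <= 10 ^+ 8 :> R by rewrite exprn_ge0.
rewrite /sample_complexity natr_sum.
apply: (@le_trans _ _ (\sum_(k < K) 10 ^+ 8 * X * (nS%:R * nA%:R))); last first.
  by rewrite sumr_const card_ord -[X in X <= _]mulr_natl mulrA.
apply: ler_sum => k _; rewrite [X in X <= _]natrM [X in _ * X <= _]natrM.
apply: ler_wpM2r; first by rewrite mulr_ge0.
apply: le_trans (critic_choice_cost k (nth 0 tr k) Y1 L1) _.
have ge0 (x : R) : 0 <= max1 x := le_trans ler01 (max1_ge1 x).
have [Y0 L0] : 0 <= Y /\ 0 <= L by split; apply: le_trans ler01 _.
apply: (ler_wpM2l c0); apply: (ler_wpM2r L0); apply: (ler_wpM2r (exprn_ge0 5 Y0)).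
have leX (x y : R) : x <= y -> max1 x ^+ 3 <= max1 y ^+ 3.
  by move=> xy; apply: lerXn2r; rewrite ?nnegrE ?ge0 // max1_mono.
apply: ler_pM; [by rewrite mulr_ge0 ?exprn_ge0|by rewrite exprn_ge0| |].
  apply: ler_wpM2l; first by rewrite exprn_ge0.
  apply: leX; exact: (le_bigmax_cond _ (fun k : 'I_K => target_time M (nth 0 tr k))).
apply: leX; exact: (le_bigmax_cond _ (fun k : 'I_K => `|Q_of M (nth 0 tr k)|)).
Qed.

End Schedule.

(** * Runs of the algorithm *)

Section Rounding.
Context {R : realType}.

Lemma nat_ceilE (x : R) : (nat_ceil x)%:R = (Num.max (0 : int) (Num.ceil x))%:~R :> R.
Proof. by rewrite /nat_ceil natr_absz ger0_norm // le_max lexx. Qed.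

Lemma nat_ceil_ge (x : R) : x <= (nat_ceil x)%:R.
Proof.
rewrite nat_ceilE; have /andP[_ h] := ceil_itv x; apply: le_trans h _.
by rewrite ler_int le_max lexx orbT.
Qed.

Lemma nat_ceil_le (x : R) : 0 <= x -> (nat_ceil x)%:R <= x + 1.
Proof.
move=> x0; rewrite nat_ceilE; have h := ceilB1_lt x.
have : 0 <= Num.ceil x by rewrite ceil_ge0; apply: lt_le_trans x0; rewrite oppr_lt0.
move=> /max_idPr ->; move: h; rewrite intrB; lra.
Qed.

Lemma nat_ceil_eq0 (x : R) : x <= 0 -> nat_ceil x = 0%N.
Proof.
move=> x0; have : Num.ceil x <= 0 by rewrite ceil_le_int.
by move=> /max_idPl; rewrite /nat_ceil => ->.
Qed.

End Rounding.

Section Assembly.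
Context {R : realType} {nS nA : nat} (M : mdp R nS nA) (h : mirror_map R nA).
Variables (eps delta alpha : R) (mu : 'rV[R]_nS) (pi0 pia : 'M[R]_(nS, nA)).
Hypothesis eps_gt0 : 0 < eps.
Hypothesis delta_gt0 : 0 < delta.
Hypothesis alpha_gt0 : 0 < alpha.
Hypothesis alpha_lt : alpha < nA%:R^-1.
Hypothesis mu_pos : simplex_pos mu.
Hypothesis clip_0 : policies_clip alpha pi0.
Hypothesis clip_a : policies_clip alpha pia.
Hypothesis pia_max : forall pi, policies_clip alpha pi ->
  avg_reward_mu M mu pi <= avg_reward_mu M mu pia.

Let C := C_alpha M mu alpha.
Let B := B_alpha M mu alpha.
Let gap pi := avg_reward_mu M mu pia - avg_reward_mu M mu pi.
Let D pi := breg_w h (visit M mu pia) pia pi.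
Let r := max1 (reward_bound M).
Let E := max1 eps^-1.

Let C1 : 1 <= C. Proof. exact: C_alpha_ge1 clip_a. Qed.
Let B1 : 1 <= B. Proof. exact: B_alpha_ge1 clip_a. Qed.
Let r1 : 1 <= r. Proof. exact: max1_ge1. Qed.
Let E1 : 1 <= E. Proof. exact: max1_ge1. Qed.

Lemma invE_le : E^-1 <= eps.
Proof.
rewrite -[X in _ <= X]invrK lef_pV2 ?posrE ?invr_gt0 //; first exact: max1_ge.
exact: lt_le_trans E1.
Qed.

Lemma gap_ge0 pi : policies_clip alpha pi -> 0 <= gap pi.
Proof. by move=> cp; rewrite subr_ge0 pia_max. Qed.

Lemma avg_reward_mu_le pi : policies_clip alpha pi -> `|avg_reward_mu M mu pi| <= r.
Proof.
move=> cp; have pol := policies_posW (policies_clipW alpha_gt0 cp).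
have [[mu0 mu1] _] := mu_pos.
have [L0 L1] := cesaro_stoch (chain_stoch M pol).
rewrite -[r]mul1r -mu1 mulr_suml; apply: le_trans (ler_norm_sum _ _ _) _.
apply: ler_sum => s _; rewrite normrM (ger0_norm (mu0 s)) ler_wpM2l //.
rewrite (avg_rewardE M pol) mxE -[r]mul1r -(L1 s) mulr_suml.
apply: le_trans (ler_norm_sum _ _ _) _; apply: ler_sum => s' _.
rewrite normrM (ger0_norm (L0 s s')) ler_wpM2l //.
apply: act_mean_le => // a; apply: le_trans (reward_abs_le M s' a) _.
exact: max1_ge.
Qed.

Lemma gap_le pi : policies_clip alpha pi -> gap pi <= 2 * r.
Proof.
move=> cp; apply: le_trans (ler_norm _) _; apply: le_trans (ler_normB _ _) _.
by rewrite mulrDl mul1r; apply: lerD; exact: avg_reward_mu_le.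
Qed.

Section Params.
Variable T0 : R.
Let T := max1 T0.
Let X := E * T * C * r.
Let ps := [:: reward_bound M; C; T0; B; nS%:R; nA%:R; eps^-1; delta^-1].
Let Pi0 := \prod_(x <- ps) max1 x.
(** The logarithmic factor of [soft_O] without t and Q, which depend on the run and
    are not known when the parameters of the critic are chosen. *)
Definition log_factor := 1 + ln Pi0.

Lemma nS_ge1 : 1 <= nS%:R :> R.
Proof.
rewrite ler1n lt0n; apply/eqP => z.
have [[_ mu1] _] := mu_pos; have : (1 : R) = 0; last by move/eqP; rewrite oner_eq0.
by rewrite -mu1 big1 // => -[i i0] _; exfalso; move: i0; rewrite z ltn0.
Qed.

Lemma nA_ge1 : 1 <= nA%:R :> R.
Proof.
rewrite ler1n lt0n; apply/eqP => z; move: (lt_trans alpha_gt0 alpha_lt).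
by rewrite z invr0 ltxx.
Qed.

Lemma Pi0E : Pi0 = B * (X * (nS%:R * nA%:R) * max1 delta^-1).
Proof.
rewrite /Pi0 /ps !big_cons big_nil (max1_id C1) (max1_id B1).
by rewrite (max1_id nS_ge1) (max1_id nA_ge1) /X /E /T /r; ring.
Qed.

Let T1 : 1 <= T. Proof. exact: max1_ge1. Qed.
Lemma X_ge1 : 1 <= X. Proof. by do 3!apply: mulr_ege1 => //. Qed.

Lemma Pi0_ge : X * (nS%:R * nA%:R) * max1 delta^-1 <= Pi0.
Proof.
rewrite Pi0E ler_peMl // (le_trans ler01) //.
by apply: mulr_ege1 (max1_ge1 _); apply: mulr_ege1 X_ge1 _; exact: mulr_ege1 nS_ge1 nA_ge1.
Qed.

Lemma Pi0_ge1 : 1 <= Pi0.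
Proof.
rewrite /Pi0; apply: (big_ind (fun x => 1 <= x)) => // [x y|i _]; first exact: mulr_ege1.
exact: max1_ge1.
Qed.

Lemma log_factor_ge1 : 1 <= log_factor.
Proof. by rewrite lerDl ln_ge0 // Pi0_ge1. Qed.

Lemma log_factor_ge : 1 + ln X <= log_factor.
Proof.
have X0 : 0 < X by exact: lt_le_trans X_ge1.
rewrite lerD2l ler_ln ?posrE //; last exact: lt_le_trans Pi0_ge1.
apply: le_trans Pi0_ge; rewrite -mulrA ler_peMr ?(ltW X0) //.
by apply: mulr_ege1 (max1_ge1 _); exact: mulr_ege1 nS_ge1 nA_ge1.
Qed.

Let ln36 : 0 <= ln 36 :> R. Proof. by rewrite ln_ge0 //; lra. Qed.
(** The number 36 is the product of the factors 4, for the tails of one iteration,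
    and 9, for the number of iterations, in [run_success]. *)
Definition confidence := (1 + ln 36) * log_factor.

Lemma confidence_ge1 : 1 <= confidence.
Proof. by apply: mulr_ege1 log_factor_ge1; rewrite lerDl. Qed.

Lemma tail_bound : expR (- confidence) <= (36 * Pi0)^-1.
Proof.
have P0 : 0 < Pi0 by exact: lt_le_trans Pi0_ge1.
rewrite -[X in _ <= X](lnK (_ : _ \is Num.pos)); last by rewrite posrE invr_gt0 mulr_gt0.
rewrite ler_expR lnV ?posrE ?mulr_gt0 // lerN2 lnM ?posrE //.
rewrite /confidence /log_factor.
have l0 : 0 <= ln Pi0 by rewrite ln_ge0 // Pi0_ge1.
have := mulr_ge0 ln36 l0; lra.
Qed.

(** The failure probability of one iteration is at most 4 |S| |A| exp (- L), which
    the choice of L makes smaller than delta / (9 X). *)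
Lemma run_success (eta : nat -> R) (K : nat) (Y : R) (Ev : seq 'M[R]_(nS, nA) -> Prop) :
  1 <= Y -> K%:R <= 9 * X ->
  (forall tr, nth 0 tr 0 = pi0 ->
    (forall i, (i < K)%N -> good_step M h alpha eta Y^-1 i (nth 0 tr i) (nth 0 tr i.+1)) ->
    policies_clip alpha (nth 0 tr K) -> Ev tr) ->
  1 - delta <= run_prob M h alpha eta (critic_choice M Y confidence) 0 K pi0 Ev.
Proof.
move=> Y1 KX hEv.
set d := 2 * ((nS * nA)%:R * (2 * expR (- confidence))).
have d0 : 0 <= d by rewrite !mulr_ge0 ?expR_ge0.
have P0 : 0 < Pi0 by exact: lt_le_trans Pi0_ge1.
have SA : 1 <= nS%:R * nA%:R :> R := mulr_ege1 nS_ge1 nA_ge1.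
have D1 := max1_ge1 delta^-1; set D' := max1 delta^-1 in D1.
have key := Pi0_ge; rewrite -/D' in key.
have hd : d * (9 * Pi0) <= nS%:R * nA%:R.
  have t := ler_wpM2r (ltW P0) tail_bound.
  rewrite invfM -mulrA mulVf ?gt_eqF // mulr1 in t.
  rewrite /d natrM; have := ler_wpM2l (le_trans ler01 SA) t; lra.
have XSA : 1 * (nS%:R * nA%:R) <= X * (nS%:R * nA%:R) by rewrite ler_wpM2r ?X_ge1 ?(le_trans ler01).
have XSA0 : 0 <= X * (nS%:R * nA%:R) by rewrite (le_trans _ XSA) // mul1r (le_trans ler01).
have key1 : X * (nS%:R * nA%:R) <= Pi0 by apply: le_trans key; rewrite ler_peMr.
have d1 : d <= 1.
  have : d * (9 * Pi0) <= 1 * (9 * Pi0) by move: hd XSA key1; lra.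
  by rewrite ler_pM2r // mulr_gt0.
have Kd : K%:R * d <= delta.
  have h1 : K%:R * d * Pi0 <= X * (nS%:R * nA%:R).
    have h2 := ler_wpM2r (mulr_ge0 d0 (ltW P0)) KX.
    have h3 := ler_wpM2l (le_trans ler01 X_ge1) hd; move: h2 h3; lra.
  have h4 : K%:R * d * D' <= 1.
    have X0 : 0 < X * (nS%:R * nA%:R) by apply: lt_le_trans (_ : 0 < 1) _ => //; apply: le_trans XSA; rewrite mul1r.
    rewrite -(ler_pM2r X0) mul1r; apply: le_trans h1.
    have -> : K%:R * d * D' * (X * (nS%:R * nA%:R)) = K%:R * d * (X * (nS%:R * nA%:R) * D') by ring.
    by apply: ler_wpM2l => //; exact: mulr_ge0.
  have D0 : 0 < D' by exact: lt_le_trans D1.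
  apply: (@le_trans _ _ D'^-1); first by rewrite -[X in _ <= X]mul1r ler_pdivlMr.
  rewrite -[X in _ <= X]invrK lef_pV2 ?posrE ?invr_gt0 //; exact: max1_ge.
apply: (@le_trans _ _ (1 - K%:R * d)); first by rewrite lerD2l lerN2.
apply: (@run_prob_lb _ _ _ _ _ _ _ _ alpha_gt0 Y^-1) => //.
by move=> k pi cp; apply: critic_choice_accuracy => //; exact: policies_clipW cp.
Qed.

Lemma soft_O_ge (c : R) d (t Q mono main : R) : 0 <= c -> 0 <= mono -> mono <= main ->
  c * mono * log_factor ^+ d <= soft_O c d (t :: Q :: ps) main.
Proof.
move=> c0 m0 mm; rewrite /soft_O 2!big_cons -/Pi0.
have lf : log_factor <= 1 + ln (max1 t * (max1 Q * Pi0)).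
  rewrite /log_factor lerD2l ler_ln ?posrE.
  - rewrite mulrA ler_peMl //; first exact: le_trans Pi0_ge1.
    by apply: mulr_ege1; exact: max1_ge1.
  - exact: lt_le_trans Pi0_ge1.
  - by apply: (@lt_le_trans _ _ 1) => //; apply: mulr_ege1 (max1_ge1 _) (mulr_ege1 (max1_ge1 _) Pi0_ge1).
have l0 : 0 <= log_factor by exact: le_trans log_factor_ge1.
apply: ler_pM; [by rewrite mulr_ge0|by rewrite exprn_ge0|by rewrite ler_wpM2l|].
by apply: lerXn2r; rewrite ?nnegrE // (le_trans l0).
Qed.

End Params.

Section Trajectory.
Variables (eta : nat -> R) (K : nat) (Y : R) (tr : seq 'M[R]_(nS, nA)).
Hypothesis eta_gt0 : forall k, 0 < eta k.
Hypothesis Y1 : 1 <= Y.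
Hypothesis steps : forall i, (i < K)%N ->
  good_step M h alpha eta Y^-1 i (nth 0 tr i) (nth 0 tr i.+1).
Hypothesis clip_K : policies_clip alpha (nth 0 tr K).

Let a k := gap (nth 0 tr k).
Let b k := D (nth 0 tr k).
Let Yi : 0 <= Y^-1. Proof. by rewrite invr_ge0 (le_trans ler01). Qed.

Let clip_k k : (k <= K)%N -> policies_clip alpha (nth 0 tr k).
Proof. by rewrite leq_eqVlt => /orP[/eqP->//|/steps[]]. Qed.

Let a_incr k : (k < K)%N -> a k.+1 <= a k + 2 * Y^-1 * B.
Proof. by move=> /steps[ck [G aG e]]; rewrite /a e; exact: step_gap_le. Qed.

Let a_rec k : (k < K)%N ->
  a k <= (b k - b k.+1) / eta k + C * (a k - a k.+1) + 4 * Y^-1 * B * C.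
Proof. by move=> /steps[ck [G aG e]]; rewrite /a /b e; exact: step_gap_recursion. Qed.

Let b_ge0 k : (k <= K)%N -> 0 <= b k.
Proof. by move=> kK; apply: (divergence_ge0 M h alpha_gt0 mu_pos clip_a); exact: clip_k. Qed.

(** K is chosen so that the initial gap and divergence contribute at most eps / 2,
    and Y so that the errors of the critic do. *)
Lemma constant_step_gap (eta0 : R) : (forall k, eta k = eta0) ->
  2 / eps * (b 0%N / eta0 + C * a 0%N) <= K%:R ->
  E * B * (8 * C + 4 * K%:R) <= Y -> a K <= eps.
Proof.
move=> etaE hK hY; have e0 : 0 < eta0 by rewrite -(etaE 0%N).
have B0 : 0 <= B by exact: le_trans B1.
have x0 : 0 <= 2 * Y^-1 * B by rewrite !mulr_ge0.
have rec' k : (k < K)%N ->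
    a k <= (b k - b k.+1) / eta0 + C * (a k - a k.+1) + 4 * Y^-1 * B * C.
  by move=> /a_rec; rewrite etaE.
have rec := constant_step_recursion x0 a_incr rec'.
have aK0 : 0 <= a K by apply: gap_ge0.
have bK : 0 <= b K / eta0 by rewrite divr_ge0 ?(ltW e0) // b_ge0.
have b00 : 0 <= b 0%N / eta0 by rewrite divr_ge0 ?(ltW e0) // b_ge0.
have a00 : 0 <= a 0%N by apply: gap_ge0; exact: clip_k.
have hK' : b 0%N / eta0 + C * a 0%N <= eps / 2 * K%:R.
  have := ler_wpM2l (_ : 0 <= eps / 2) hK; rewrite mulrA => /(_ _)/wrap[]; first by rewrite divr_ge0 // ltW.
  by rewrite mulf_div [eps * 2]mulrC divff ?mul1r // gt_eqF // mulr_gt0.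
have [K0|K0] := posnP K.
  have -> : a K = a 0%N by rewrite K0.
  move: hK'; rewrite K0 mulr0 => z.
  have Ca : C * a 0%N <= 0 by apply: le_trans z; rewrite lerDr.
  by apply: le_trans (ltW eps_gt0); apply: le_trans Ca; rewrite ler_peMl.
have Kp : 0 < K%:R :> R by rewrite ltr0n.
have Yp : 0 < Y by exact: lt_le_trans Y1.
have EB : (8 * C + 4 * K%:R) * (Y^-1 * B) <= eps.
  apply: le_trans invE_le.
  have Ep : 0 < E by exact: lt_le_trans E1.
  have hh : E * B * (8 * C + 4 * K%:R) / Y <= 1 by rewrite ler_pdivrMr // mul1r.
  have -> : (8 * C + 4 * K%:R) * (Y^-1 * B) = E * B * (8 * C + 4 * K%:R) / Y * E^-1.
    by field; rewrite !gt_eqF.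
  by rewrite ler_piMl // invr_ge0 ltW.
rewrite -(ler_pM2l Kp).
have EBK := ler_wpM2l (ltW Kp) EB.
rewrite expr2 [(b 0%N - b K) / eta0]mulrBl in rec.
have CaK := mulr_ge0 (le_trans ler01 C1) aK0.
have combine (k x z u v c y d e : R) :
    k * x <= u - v + c * (z - x) + k * (4 * y * d * c) + k * k * (2 * y * d) ->
    0 <= v -> 0 <= c * x -> u + c * z <= e / 2 * k ->
    k * ((8 * c + 4 * k) * (y * d)) <= k * e -> k * x <= k * e by lra.
exact: (combine _ _ _ _ _ _ _ _ _ rec bK CaK hK' EBK).
Qed.

(** Again the initial potential and the errors of the critic contribute eps / 2
    each. *)
Lemma adaptive_step_gap : 1 < C ->
  (forall k, eta k * C <= eta k.+1 * (C - 1)) ->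
  ln (2 / eps * (a 0%N + b 0%N / (eta 0%N * (C - 1)))) / ln (C / (C - 1)) <= K%:R ->
  8 * B * C * E <= Y -> a K <= eps.
Proof.
move=> Cgt etaC hK hY.
have B0 : 0 <= B by exact: le_trans B1.
have C0 : 0 < C by exact: lt_le_trans C1.
have Cm : 0 < C - 1 by rewrite subr_gt0.
have z0 : 0 <= 4 * Y^-1 * B * C by rewrite !mulr_ge0 // ltW.
have := adaptive_step_recursion Cgt eta_gt0 etaC z0 b_ge0 a_rec.
pose phi0 := a 0%N + b 0%N / (eta 0%N * (C - 1)); rewrite -/phi0.
have p0 : 0 <= phi0.
  apply: addr_ge0; first by apply: gap_ge0; exact: clip_k.
  by apply: divr_ge0; [exact: b_ge0|rewrite mulr_ge0 // ltW].
have bK : 0 <= b K / (eta K * (C - 1)).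
  by apply: divr_ge0; [exact: b_ge0|rewrite mulr_ge0 // ltW].
have zE : 4 * Y^-1 * B * C <= eps / 2.
  have Ep : 0 < E by exact: lt_le_trans E1.
  have Yp : 0 < Y by exact: lt_le_trans Y1.
  have : 8 * B * C * Y^-1 <= eps.
    apply: le_trans invE_le.
    by rewrite ler_pdivrMr // [_^-1 * _]mulrC ler_pdivlMr.
  by lra.
have pK : (1 - C^-1) ^+ K * phi0 <= eps / 2.
  move: p0; rewrite le_eqVlt => /orP[/eqP <-|p0]; first by rewrite mulr0 divr_ge0 // ltW.
  pose rho := C / (C - 1).
  have rho1 : 1 < rho by rewrite /rho ltr_pdivlMr //; lra.
  have rho0 : 0 < rho by lra.
  have lrho : 0 < ln rho by rewrite ln_gt0.
  have -> : 1 - C^-1 = rho^-1 by rewrite /rho; field; rewrite !gt_eqF.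
  have x0 : 0 < 2 / eps * phi0 by rewrite mulr_gt0 // divr_gt0.
  have : 2 / eps * phi0 <= rho ^+ K.
    rewrite -ler_ln ?posrE ?exprn_gt0 // lnXn // -[ln rho *+ K]mulr_natl.
    by rewrite -ler_pdivrMr.
  move=> hh; rewrite exprVn mulrC ler_pdivrMr ?exprn_gt0 //.
  have e2 : 0 < eps / 2 by rewrite divr_gt0.
  have := ler_wpM2l (ltW e2) hh; rewrite mulrA mulf_div [eps * 2]mulrC divff ?mul1r //.
  by rewrite gt_eqF // mulr_gt0.
rewrite -/(a K); lra.
Qed.

End Trajectory.
End Assembly.

(** * Complexity *)

Section Complexity.
Context {R : realType}.

Definition cost_const : R := (1 + ln 36) * 10 ^+ 8.

Lemma cost_const_gt0 : 0 < cost_const.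
Proof.
have : 0 <= ln 36 :> R by rewrite ln_ge0 //; lra.
by move=> ?; rewrite mulr_gt0 ?exprn_gt0 //; lra.
Qed.

Lemma constant_step_iterations (eps D C g r : R) :
  0 < eps -> 0 <= D -> 1 <= C -> 1 <= r -> 0 <= g -> g <= 2 * r ->
  (nat_ceil (2 / eps * (D + C * g)))%:R <= 9 * (max1 eps^-1 * max1 D * C * r).
Proof.
move=> eps0 D0 C1 r1 g0 gr; set E := max1 _; set T := max1 _.
have [E1 T1] : 1 <= E /\ 1 <= T by split; exact: max1_ge1.
have C0 : 0 <= C := le_trans ler01 C1.
have s0 : 0 <= D + C * g by rewrite addr_ge0 // mulr_ge0.
have c0 : 0 <= 2 / eps by rewrite divr_ge0 // ltW.
have epsE : 2 / eps <= 2 * E by rewrite ler_wpM2l // max1_ge.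
apply: le_trans (nat_ceil_le (mulr_ge0 c0 s0)) _.
have h1 : D + C * g <= 3 * (T * C * r).
  have CR : 1 <= C * r by exact: mulr_ege1.
  have h2 : D <= T * (C * r).
    by apply: le_trans (max1_ge _) _; rewrite ler_peMr // (le_trans ler01).
  have h3 : C * g <= 2 * (1 * (C * r)).
    by apply: le_trans (ler_wpM2l C0 gr) _; apply: eq_ler; ring.
  have h4 : 1 * (C * r) <= T * (C * r) by rewrite ler_wpM2r // (le_trans ler01).
  by lra.
have h2 := ler_pM c0 s0 epsE h1.
have h3 : 1 <= E * T * C * r by do 3!apply: mulr_ege1 => //.
lra.
Qed.

(** Each step multiplies the potential by 1 - 1/C, and ln (C / (C - 1)) is at least
    1/C. *)
Lemma adaptive_step_iterations (eps D C g r : R) :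
  0 < eps -> 0 <= D -> 1 < C -> 1 <= r -> 0 <= g -> g <= 2 * r ->
  let K := nat_ceil (ln (2 / eps * (g + D)) / ln (C / (C - 1))) in
  let X := max1 eps^-1 * max1 D * C * r in
  K%:R <= 9 * X /\ K%:R <= (2 + ln 6) * (C * (1 + ln X)).
Proof.
move=> eps0 D0 C1 r1 g0 gr K X; rewrite /X; set E := max1 _; set T := max1 _.
have [E1 T1] : 1 <= E /\ 1 <= T by split; exact: max1_ge1.
have C0 : 0 < C by lra.
pose W := E * T * r; have W1 : 1 <= W by do 2!apply: mulr_ege1 => //.
have -> : E * T * C * r = C * W by rewrite /W; ring.
have Cm : 0 < C - 1 by lra.
pose rho := C / (C - 1).
have rho1 : 1 < rho by rewrite /rho ltr_pdivlMr //; lra.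
have lrho : C^-1 <= ln rho.
  have Ci1 : C^-1 < 1 by rewrite invf_lt1.
  have := @le_ln1Dx R (- C^-1); rewrite ltrN2 => /(_ Ci1).
  have -> : 1 + - C^-1 = rho^-1 by rewrite /rho; field; rewrite !gt_eqF.
  by rewrite lnV ?posrE ?(lt_trans ltr01) // lerN2.
have lrho0 : 0 < ln rho by apply: lt_le_trans lrho; rewrite invr_gt0.
have l6 : 0 <= ln 6 :> R by rewrite ln_ge0 //; lra.
have lW : 0 <= ln W by rewrite ln_ge0.
have l6W : ln (6 * W) = ln 6 + ln W by rewrite lnM ?posrE // (lt_le_trans ltr01).
have W0 : 0 < W := lt_le_trans ltr01 W1.
have lCW : ln W <= ln (C * W).
  rewrite ler_ln ?posrE //; last exact: mulr_gt0 C0 W0.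
  by rewrite ler_peMl // ltW.
have K1 : K%:R <= C * ln (6 * W) + 1.
  have CW0 : 0 <= C * ln (6 * W) by apply: mulr_ge0; [exact: ltW|rewrite l6W addr_ge0].
  have [q0|q0] := lerP (ln (2 / eps * (g + D)) / ln rho) 0.
    by rewrite /K (nat_ceil_eq0 q0) addr_ge0.
  apply: le_trans (nat_ceil_le (ltW q0)) _; rewrite lerD2r.
  rewrite pmulr_lgt0 ?invr_gt0 // in q0.
  have argle : ln (2 / eps * (g + D)) <= ln (6 * W).
    have [a0|a0] := lerP (2 / eps * (g + D)) 0; first by rewrite (ln0 a0) l6W addr_ge0.
    rewrite ler_ln ?posrE //; last by rewrite mulr_gt0 // (lt_le_trans ltr01).
    have epsE : 2 / eps <= 2 * E by rewrite ler_wpM2l // max1_ge.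
    have c0 : 0 <= 2 / eps by rewrite divr_ge0 // ltW.
    have h1 : g + D <= 3 * (T * r).
      have h2 : D <= T * r.
        by apply: le_trans (max1_ge _) _; rewrite ler_peMr // (le_trans ler01).
      have h4 : 1 * r <= T * r by rewrite ler_wpM2r // (le_trans ler01).
      by lra.
    have := ler_pM c0 (addr_ge0 g0 D0) epsE h1; rewrite /W; lra.
  rewrite ler_pdivrMr // [leRHS]mulrAC; apply: le_trans argle _.
  rewrite -[X in X <= _]mul1r; apply: ler_wpM2r; first by rewrite l6W addr_ge0.
  by have := ler_wpM2l (ltW C0) lrho; rewrite mulfV // gt_eqF.
split.
  have h : ln (6 * W) <= 6 * W by rewrite ltW // ln_sublinear // mulr_gt0 // (lt_le_trans ltr01).
  have h2 := ler_wpM2l (ltW C0) h.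
  have h3 : 1 <= C * W by apply: mulr_ege1 => //; exact: ltW.
  by lra.
apply: le_trans K1 _; rewrite l6W.
have lCW' := ler_wpM2l (ltW C0) lCW.
have h1 := mulr_ge0 (ltW C0) (mulr_ge0 l6 (le_trans lW lCW)).
have h2 := mulr_ge0 (ltW C0) (le_trans lW lCW).
lra.
Qed.

(** With X = E T C r, there are at most 9 X iterations, and Y is of order E B X. *)
Lemma constant_step_cost (k0 c0 l r t Q C T E B SA K Y : R) :
  0 <= k0 -> 0 <= c0 -> 0 <= l -> 1 <= r -> 1 <= t -> 1 <= Q -> 1 <= C -> 1 <= T ->
  1 <= E -> 1 <= B -> 1 <= SA -> 0 <= K ->
  K <= 9 * (E * T * C * r) -> Y = E * B * (8 * C + 4 * K) ->
  K * (c0 * (r ^+ 2 * t ^+ 3 * Q ^+ 3 * Y ^+ 5 * (k0 * l))) * SA <=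
  (9 * 44 ^+ 5 * (k0 * c0)) *
    (t ^+ 3 * Q ^+ 3 * r ^+ 8 * C ^+ 6 * T ^+ 6 * B ^+ 5 * SA * E ^+ 11) * l.
Proof.
move=> k0p c0p lp r1 t1 Q1 C1 T1 E1 B1 SA1 K0 hK ->.
have [r0 t0 Q0] : [/\ 0 <= r, 0 <= t & 0 <= Q] by split; apply: le_trans ler01 _.
have [C0 T0 E0] : [/\ 0 <= C, 0 <= T & 0 <= E] by split; apply: le_trans ler01 _.
have [B0 SA0] : 0 <= B /\ 0 <= SA by split; apply: le_trans ler01 _.
set X := E * T * C * r in hK.
have CX : C <= X.
  have : 1 * C <= E * T * r * C.
    by apply: ler_wpM2r => //; do 2!apply: mulr_ege1 => //.
  by rewrite mul1r /X; have -> : E * T * r * C = E * T * C * r by ring.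
have X0 : 0 <= X by apply: le_trans CX.
have hY : E * B * (8 * C + 4 * K) <= E * B * (44 * X).
  by apply: ler_wpM2l; [exact: mulr_ge0|lra].
have Y0 : 0 <= E * B * (8 * C + 4 * K) by rewrite !mulr_ge0 // addr_ge0 // mulr_ge0.
have hY5 : (E * B * (8 * C + 4 * K)) ^+ 5 <= (E * B * (44 * X)) ^+ 5.
  by apply: lerXn2r => //; rewrite nnegrE // !mulr_ge0.
have kl : 0 <= k0 * l by exact: mulr_ge0.
have rtq : 0 <= r ^+ 2 * t ^+ 3 * Q ^+ 3 by rewrite !mulr_ge0 ?exprn_ge0.
have h1 := ler_wpM2r kl (ler_wpM2l rtq hY5).
have h2 := ler_wpM2l c0p h1.
have pos : 0 <= c0 * (r ^+ 2 * t ^+ 3 * Q ^+ 3 * (E * B * (8 * C + 4 * K)) ^+ 5 * (k0 * l)).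
  by do 3!apply: mulr_ge0 => //; exact: exprn_ge0.
have h3 := ler_wpM2r SA0 (ler_pM K0 pos hK h2).
apply: le_trans h3 _; apply: eq_ler; rewrite /X; ring.
Qed.

Lemma adaptive_step_cost (k0 c0 kap l r t Q C E B SA K : R) :
  0 <= k0 -> 0 <= c0 -> 0 <= l -> 1 <= r -> 1 <= t -> 1 <= Q -> 1 <= C ->
  1 <= E -> 1 <= B -> 1 <= SA -> K <= kap * (C * l) ->
  K * (c0 * (r ^+ 2 * t ^+ 3 * Q ^+ 3 * (8 * B * C * E) ^+ 5 * (k0 * l))) * SA <=
  (kap * 8 ^+ 5 * (k0 * c0)) *
    (t ^+ 3 * Q ^+ 3 * r ^+ 2 * C ^+ 6 * B ^+ 5 * SA * E ^+ 5) * l ^+ 2.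
Proof.
move=> k0p c0p lp r1 t1 Q1 C1 E1 B1 SA1 hK.
have [r0 t0 Q0] : [/\ 0 <= r, 0 <= t & 0 <= Q] by split; apply: le_trans ler01 _.
have [C0 E0] : 0 <= C /\ 0 <= E by split; apply: le_trans ler01 _.
have [B0 SA0] : 0 <= B /\ 0 <= SA by split; apply: le_trans ler01 _.
have pos : 0 <= c0 * (r ^+ 2 * t ^+ 3 * Q ^+ 3 * (8 * B * C * E) ^+ 5 * (k0 * l)).
  by rewrite !mulr_ge0 ?exprn_ge0 // !mulr_ge0.
apply: le_trans (ler_wpM2r SA0 (ler_wpM2r pos hK)) _.
by apply: eq_ler; ring.
Qed.

End Complexity.

Theorem theorem13 (R : realType) :
  (* (1) constant step size *)
  (exists (c : R) (d : nat), 0 < c /\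
    forall (nS nA : nat) (M : mdp R nS nA) (h : mirror_map R nA)
      (eps delta alpha : R) (mu : 'rV[R]_nS) (pi0 pia : 'M[R]_(nS, nA))
      (eta : R),
    0 < eps -> 0 < delta -> 0 < alpha -> alpha < nA%:R^-1 ->
    simplex_pos mu -> policies_clip alpha pi0 ->
    policies_clip alpha pia ->
    (forall pi, policies_clip alpha pi ->
      avg_reward_mu M mu pi <= avg_reward_mu M mu pia) ->
    0 < eta ->
    let C := C_alpha M mu alpha in
    let B := B_alpha M mu alpha in
    let gap pi := avg_reward_mu M mu pia - avg_reward_mu M mu pi in
    let D := breg_w h (visit M mu pia) pia pi0 in
    let K := nat_ceil (2 / eps * (D / eta + C * gap pi0)) in
    exists cp : critic_schedule R nS nA, positive_schedule cp /\
      1 - delta <= run_prob M h alpha (fun=> eta) cp 0 K pi0 (fun tr =>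
        let t := max_target_time M K tr in
        let Q := max_Q_norm M K tr in
        gap (nth 0 tr K) <= eps /\
        (sample_complexity cp K tr)%:R <=
          soft_O c d
            [:: t; Q; reward_bound M; C; D / eta; B; nS%:R; nA%:R;
                eps^-1; delta^-1]
            (max1 t ^+ 3 * max1 Q ^+ 4 * max1 (reward_bound M) ^+ 9 * C ^+ 6 *
             max1 (D / eta) ^+ 6 * B ^+ 6 * nS%:R * nA%:R *
             max1 eps^-1 ^+ 12)))
  /\
  (* (2) adaptive step size *)
  (exists (c : R) (d : nat), 0 < c /\
    forall (nS nA : nat) (M : mdp R nS nA) (h : mirror_map R nA)
      (eps delta alpha : R) (mu : 'rV[R]_nS) (pi0 pia : 'M[R]_(nS, nA))
      (eta : nat -> R),
    0 < eps -> 0 < delta -> 0 < alpha -> alpha < nA%:R^-1 ->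
    simplex_pos mu -> policies_clip alpha pi0 ->
    policies_clip alpha pia ->
    (forall pi, policies_clip alpha pi ->
      avg_reward_mu M mu pi <= avg_reward_mu M mu pia) ->
    let C := C_alpha M mu alpha in
    let B := B_alpha M mu alpha in
    let gap pi := avg_reward_mu M mu pia - avg_reward_mu M mu pi in
    let D := breg_w h (visit M mu pia) pia pi0 in
    (forall k : nat, 0 < eta k) ->
    (forall k : nat, eta k * C <= eta k.+1 * (C - 1) /\ 0 < eta k * C) ->
    let K := nat_ceil (ln (2 / eps * (gap pi0 + D / (eta 0%N * (C - 1))))
                       / ln (C / (C - 1))) in
    exists cp : critic_schedule R nS nA, positive_schedule cp /\
      1 - delta <= run_prob M h alpha eta cp 0 K pi0 (fun tr =>
        let t := max_target_time M K tr in
        let Q := max_Q_norm M K tr in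
        gap (nth 0 tr K) <= eps /\
        (sample_complexity cp K tr)%:R <=
          soft_O c d
            [:: t; Q; reward_bound M; C; D / (eta 0%N * (C - 1)); B; nS%:R;
                nA%:R; eps^-1; delta^-1]
            (max1 t ^+ 3 * max1 Q ^+ 4 * max1 (reward_bound M) ^+ 3 * C ^+ 6 *
             B ^+ 6 * nS%:R * nA%:R * max1 eps^-1 ^+ 6))).
Proof.
split.
- have cpos : 0 < 9 * 44 ^+ 5 * cost_const :> R.
    by apply: mulr_gt0; [rewrite mulr_gt0 ?exprn_gt0|exact: cost_const_gt0].
  exists (9 * 44 ^+ 5 * cost_const), 1%N; split=> //.
  move=> nS nA M h eps delta alpha mu pi0 pia eta eps0 delta0 alpha0 alpha_lt mu_pos
    clip0 clipa pia_max eta0 C B gap D K.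
  have C1 : 1 <= C := C_alpha_ge1 M alpha0 mu_pos clipa.
  have B1 : 1 <= B := B_alpha_ge1 M alpha0 mu_pos clipa.
  set E := max1 eps^-1; set T := max1 (D / eta); set r := max1 (reward_bound M).
  have E1 : 1 <= E := max1_ge1 _; have T1 : 1 <= T := max1_ge1 _.
  have r1 : 1 <= r := max1_ge1 _.
  have g0 : 0 <= gap pi0 by rewrite subr_ge0 pia_max.
  have gr : gap pi0 <= 2 * r by apply: (gap_le M alpha0 mu_pos clipa clip0).
  have D0 : 0 <= D / eta.
    by rewrite divr_ge0 ?(ltW eta0) // (divergence_ge0 M h alpha0 mu_pos clipa).
  have hK := constant_step_iterations eps0 D0 C1 r1 g0 gr; rewrite -/K -/E -/T in hK.
  pose Y := E * B * (8 * C + 4 * K%:R).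
  have Y1 : 1 <= Y.
    by apply: mulr_ege1; [exact: mulr_ege1|have := ler0n R K; lra].
  pose L := confidence M eps delta alpha mu (D / eta).
  have L1 : 1 <= L := confidence_ge1 M eps delta alpha mu _.
  exists (critic_choice M Y L); split; first exact: critic_choice_positive.
  apply: (run_success delta0 alpha0 alpha_lt mu_pos clip0 clipa Y1 hK) => tr tr0 steps clipK.
  split.
    apply: (constant_step_gap eps0 alpha0 mu_pos clipa pia_max (fun=> eta0) Y1 steps clipK (fun=> erefl)).
      by rewrite tr0; exact: nat_ceil_ge.
    exact: lexx.
  apply: le_trans (sample_complexity_le M K tr Y1 L1) _.
  set t := max1 (max_target_time M K tr); set Q := max1 (max_Q_norm M K tr).
  have t1 : 1 <= t := max1_ge1 _; have Q1 : 1 <= Q := max1_ge1 _.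
  have SA : 1 <= nS%:R * nA%:R :> R := mulr_ege1 (nS_ge1 mu_pos) (nA_ge1 alpha0 alpha_lt).
  have lf := log_factor_ge1 M eps delta alpha mu (D / eta).
  have lf0 := le_trans ler01 lf.
  have k0 : 0 <= 1 + ln 36 :> R by rewrite addr_ge0 // ln_ge0 //; lra.
  have c0 : 0 <= 10 ^+ 8 :> R by rewrite exprn_ge0.
  apply: le_trans (constant_step_cost k0 c0 lf0 r1 t1 Q1 C1 T1 E1 B1 SA (ler0n _ K) hK (erefl Y)) _.
  have [r0 [t0 Q0]] : 0 <= r /\ 0 <= t /\ 0 <= Q by do !split; apply: le_trans ler01 _.
  have [E0 [T0 [C0 B0]]] : 0 <= E /\ 0 <= T /\ 0 <= C /\ 0 <= B.
    by do !split; apply: le_trans ler01 _.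
  have SA0 := le_trans ler01 SA.
  rewrite -/cost_const -[X in _ * X <= _]expr1.
  apply: soft_O_ge => //.
  + exact: ltW.
  + by rewrite !mulr_ge0 ?exprn_ge0.
  set mono := t ^+ 3 * Q ^+ 3 * _ * _ * _ * _ * _ * _.
  have m0 : 0 <= mono by rewrite !mulr_ge0 ?exprn_ge0.
  (* The main term has the factors Q, r, B and E to spare. *)
  apply: (@le_trans _ _ (mono * (Q * r * B * E))).
    by rewrite ler_peMr //; do 3!apply: mulr_ege1 => //.
  by apply: eq_ler; rewrite /mono; ring.
- have l6 : 0 <= ln 6 :> R by rewrite ln_ge0 //; lra.
  have kap0 : 0 < 2 + ln 6 :> R by lra.
  have cpos : 0 < (2 + ln 6) * 8 ^+ 5 * cost_const :> R.
    by apply: mulr_gt0; [rewrite mulr_gt0 ?exprn_gt0|exact: cost_const_gt0].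
  exists ((2 + ln 6) * 8 ^+ 5 * cost_const), 2%N.
  split=> //.
  move=> nS nA M h eps delta alpha mu pi0 pia eta eps0 delta0 alpha0 alpha_lt mu_pos
    clip0 clipa pia_max C B gap D eta0 etaC K.
  have C1 : 1 <= C := C_alpha_ge1 M alpha0 mu_pos clipa.
  have B1 : 1 <= B := B_alpha_ge1 M alpha0 mu_pos clipa.
  (* The step size condition excludes C = 1. *)
  have Cgt : 1 < C.
    have [h1 h2] := etaC 0%N.
    by have := lt_le_trans h2 h1; rewrite pmulr_rgt0 // subr_gt0.
  pose T0 := D / (eta 0%N * (C - 1)).
  set E := max1 eps^-1; set T := max1 T0; set r := max1 (reward_bound M).
  have E1 : 1 <= E := max1_ge1 _; have T1 : 1 <= T := max1_ge1 _.
  have r1 : 1 <= r := max1_ge1 _.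
  have g0 : 0 <= gap pi0 by rewrite subr_ge0 pia_max.
  have gr : gap pi0 <= 2 * r by apply: (gap_le M alpha0 mu_pos clipa clip0).
  have D0 : 0 <= T0.
    rewrite divr_ge0 ?mulr_ge0 ?subr_ge0 ?(ltW (eta0 _)) //.
    exact: (divergence_ge0 M h alpha0 mu_pos clipa).
  have [hK hK'] := adaptive_step_iterations eps0 D0 Cgt r1 g0 gr.
  rewrite -/K -/E -/T in hK hK'.
  pose Y := 8 * B * C * E.
  have Y1 : 1 <= Y by do 3!apply: mulr_ege1 => //; lra.
  pose L := confidence M eps delta alpha mu T0.
  have L1 : 1 <= L := confidence_ge1 M eps delta alpha mu _.
  exists (critic_choice M Y L); split; first exact: critic_choice_positive.
  apply: (run_success delta0 alpha0 alpha_lt mu_pos clip0 clipa Y1 hK) => tr tr0 steps clipK.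
  split.
    apply: (adaptive_step_gap eps0 alpha0 mu_pos clipa pia_max eta0 Y1 steps clipK Cgt).
    + by move=> k; case: (etaC k).
    + by rewrite tr0; exact: nat_ceil_ge.
    exact: lexx.
  apply: le_trans (sample_complexity_le M K tr Y1 L1) _.
  set t := max1 (max_target_time M K tr); set Q := max1 (max_Q_norm M K tr).
  have t1 : 1 <= t := max1_ge1 _; have Q1 : 1 <= Q := max1_ge1 _.
  have SA : 1 <= nS%:R * nA%:R :> R := mulr_ege1 (nS_ge1 mu_pos) (nA_ge1 alpha0 alpha_lt).
  have lf := log_factor_ge1 M eps delta alpha mu T0.
  have lf0 := le_trans ler01 lf.
  have k0 : 0 <= 1 + ln 36 :> R by rewrite addr_ge0 // ln_ge0 //; lra.
  have c0 : 0 <= 10 ^+ 8 :> R by rewrite exprn_ge0.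
  have hK2 : K%:R <= (2 + ln 6) * (C * log_factor M eps delta alpha mu T0).
    apply: le_trans hK' _; apply: (ler_wpM2l (ltW kap0)).
    apply: ler_wpM2l; first exact: le_trans ler01 C1.
    exact: (log_factor_ge M eps delta alpha0 alpha_lt mu_pos clipa T0).
  apply: le_trans (adaptive_step_cost k0 c0 lf0 r1 t1 Q1 C1 E1 B1 SA hK2) _.
  have [r0 [t0 Q0]] : 0 <= r /\ 0 <= t /\ 0 <= Q by do !split; apply: le_trans ler01 _.
  have [E0 [C0 B0]] : 0 <= E /\ 0 <= C /\ 0 <= B.
    by do !split; apply: le_trans ler01 _.
  have SA0 := le_trans ler01 SA.
  rewrite -/cost_const.
  apply: soft_O_ge => //.
  + exact: ltW.
  + by rewrite !mulr_ge0 ?exprn_ge0.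
  set mono := t ^+ 3 * Q ^+ 3 * _ * _ * _ * _ * _.
  have m0 : 0 <= mono by rewrite !mulr_ge0 ?exprn_ge0.
  (* The main term has the factors Q, r, B and E to spare. *)
  apply: (@le_trans _ _ (mono * (Q * r * B * E))).
    by rewrite ler_peMr //; do 3!apply: mulr_ege1 => //.
  by apply: eq_ler; rewrite /mono; ring.
Qed.
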